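(* Let $n\ge2$ and let $\nu\ge2$ be even. Let $\theta=(p,\mathbf u)$ range near $0\in\mathbb R^m\times\mathbb R^{\nu-2}$, and consider a prepared physical multiwell return over the complete prepared contact graph (see context), with passage correction $D(q,\theta)$, active coefficient $B$ with $\beta=B(0,0,0)\ne0$, and smooth family of regular outgoing transitions $\mathcal R_\theta$ with $\mathcal R_0(0)=0$. Let its actual return displacement have the exact decomposition $$\Delta(q,p,\mathbf u)=S(q,p,\mathbf u)+G(q,p,\mathbf u),$$ where $S$ is the smooth reference $X^-$-displacement and $$G(q,\theta)=\mathcal R_\theta(q+D(q,\theta))-\mathcal R_\theta(q),\qquad L_0=\mathcal R_0'(0)\ne0.$$ Assume $$\partial_q^jS(0,0,0)=0\ (0\le j<n),\qquad c=\frac{\partial_q^nS(0,0,0)}{n!}\ne0,\qquad d=L_0\beta\ne0.$$ Then there are $r_0>0$ and a neighbourhood $V$ of $(p,\mathbf u)=(0,0)$ such that, for every $(p,\mathbf u)\in V$, $$\#\{q:|q|<r_0,\ \Delta(q,p,\mathbf u)=0\}\le\begin{cases}n,&cd>0,\\ n+1,&cd<0.\end{cases}$$ All zeros in this interval are isolated. If the central smooth coefficient map $$p\longmapsto\left(S(0,p,0),\partial_qS(0,p,0),\dots,\frac{\partial_q^{n-1}S(0,p,0)}{(n-1)!}\right)$$ has rank $n$ at $p=0$, and the central slice $\mathbf u=0$ is a fixed-contact actual-return family satisfying $(\mathrm{FR})_\nu$ (see context), the applicable bound is sharp on that slice; its simple periodic orbits have alternating stability.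
   Context: Smooth means $C^\infty$; $x_+=\max\{x,0\}$; $\mathbf u=(u_1,\dots,u_{\nu-2})$ (absent if $\nu=2$). Prepared passage. On a common flow box $[-T,T]\times(-I_*,I_* )$ with coordinates $(t,I)$, $X^-_\theta=\partial_t$, the seam function is $h_\theta(t,I)=g(t,I,\theta)(I-\Phi_\theta(t))$ with $g>0$ smooth, and the prepared contact graph is $$\Phi_\theta(t)=a(\theta)t^\nu+\sum_{j=1}^{\nu-2}u_jt^j+t^{\nu+1}R(t,\theta),\qquad a(0)>0,$$ with $a,R$ smooth and $\partial_t^\nu\Phi_\theta(t)\ge\kappa_*>0$ for $|t|\le T$. The second field is $X_\theta^+=X_\theta^-+h_\theta W_\theta$, $W_\theta=A_{\mathrm{geo}}\partial_t+B_{\mathrm{geo}}\partial_I$ smooth, and the physical field is $X_\theta^-+(h_\theta)_+W_\theta$. Its trajectories satisfy the scalar equation $$I'=(I-\Phi_\theta(t))_+B(t,I,\theta),\qquad B=\frac{gB_{\mathrm{geo}}}{1+g(I-\Phi_\theta(t))A_{\mathrm{geo}}}\ \text{(on the active side } I>\Phi_\theta),$$ with $B$ jointly $C^2$ and $\beta=B(0,0,0)\ne0$. $D(q,\theta)=I(T;q,\theta)-q$, where $I(\cdot;q,\theta)$ is the solution with $I(-T)=q$; the box and parameter germ are small enough that trajectories with small $(q,\theta)$ are inactive ($I<\Phi_\theta$) at $t=\pm T$. Return. The passage is a prepared physical multiwell return when a smooth compatible transition outside the box, here $\mathcal R_\theta$ from the outgoing $I$-coordinate at $t=T$ back to the incoming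 coordinate $q$, closes the same finite-time itinerary, all intervening sections are transverse, and no orbit meets the incoming section before the designated return. The actual return is $P_\theta(q)=\mathcal R_\theta(q+D(q,\theta))$, $\Delta=P_\theta(q)-q$, and $S(q,\theta)=\mathcal R_\theta(q)-q$. $(\mathrm{FR})_\nu$ for a family $P_p$: in a two-dimensional phase space there are jointly smooth $h_p$, $X_p^\pm$ with $X_p^+-X_p^-=h_pW_p$ ($W_p$ smooth), physical field $X_p^-$ on $h_p\le0$ and $X_p^+$ on $h_p\ge0$, and a smooth contact point $z_p$ with $h_p(z_p)=0$, $dh_p(z_p)\ne0$, $X_p^-(z_p)\ne0$, $(X_p^-)^jh_p(z_p)=0$ ($1\le j<\nu$), $-(X_p^-)^\nu h_p(z_p)>0$; $I_p$ is the first integral of $X_p^-$ with $I_p(z_p)=0$, $dI_p(z_p)=dh_p(z_p)$; incoming and outgoing transverse sections depend smoothly on $p$, with incoming coordinate $q=I_p$; $\mathcal D_{\mathrm{gr}}(q,p)$ is the outgoing $I_p$-coordinate of the physical excursion minus that of the $X_p^-$-excursion from the same incoming point; and $P_p(q)=\mathcal R_p(q+\mathcal D_{\mathrm{gr}}(q,p))$ for a jointly smooth family of local diffeomorphisms $\mathcal R_p$, both factors being compatible finite-time flow maps along one itinerary, with all intervening sections transverse and no earlier return to the incoming section. Simple periodic orbits correspond to zeros with $\Delta_q\ne0$. Alternating stability: ordered along the section, they alternate between attracting and repelling. *)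

(* Defs.v *)
From HB Require Import structures.
From mathcomp Require Import all_boot all_order all_algebra.
From mathcomp Require Import all_classical all_reals all_analysis.

Set Implicit Arguments.
Unset Strict Implicit.
Unset Printing Implicit Defensive.

Import Order.TTheory GRing.Theory Num.Theory.
Import numFieldNormedType.Exports.

Local Open Scope classical_set_scope.
Local Open Scope ring_scope.

Section smoothness.
Context {R : realType}.
Implicit Types V W : normedModType R.

(* [Ck k U f], for U open in a finite-dimensional space: all iterated
   directional derivatives of f of order at most k exist and are continuous
   on U. *)
Fixpoint Ck V W (k : nat) (U : set V) (f : V -> W) : Prop :=
  (forall x, U x -> {for x, continuous f}) /\
  match k with
  | 0 => True
  | k'.+1 => forall v : V,
      (forall x, U x -> derivable f x v) /\ Ck k' U (fun x => 'D_v f x)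
  end.

(* On a set A that need not be open, differentiability means differentiability
   on an open neighbourhood of A. *)
Definition Ck_on V W (k : nat) (A : set V) (f : V -> W) : Prop :=
  exists U : set V, [/\ open U, A `<=` U & Ck k U f].

Definition smooth_on V W (A : set V) (f : V -> W) : Prop :=
  exists U : set V, [/\ open U, A `<=` U & forall k, Ck k U f].

Definition det2 (v w : R * R) : R := v.1 * w.2 - v.2 * w.1.

End smoothness.

Record surface (R : realType) := Surface {
  surf_point :> topologicalType ;
  chart : Type ;
  cdom : chart -> set surf_point ;
  cmap : chart -> surf_point -> R * R ;
  cinv : chart -> R * R -> surf_point ;
  surf_hausdorff : hausdorff_space surf_point ;
  surf_second_countable : @second_countable surf_point ;
  cdom_cover : forall z, exists i, cdom i z ;
  cdom_open : forall i, open (cdom i) ;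
  cimage_open : forall i, open (cmap i @` cdom i) ;
  cmapK : forall i z, cdom i z -> cinv i (cmap i z) = z ;
  cmap_continuous : forall i z, cdom i z -> {for z, continuous (cmap i)} ;
  cinv_continuous : forall i z, cdom i z -> {for cmap i z, continuous (cinv i)} ;
  transition_smooth : forall i j, smooth_on (cmap i @` (cdom i `&` cdom j)) (cmap j \o cinv i)
}.

Arguments cdom {R} s _.
Arguments cmap {R} s _ _.
Arguments cinv {R} s _ _.

Section phase_space.
Context {R : realType}.
Variables (M : surface R) (Par : normedModType R).

Definition smooth_map_on (V : normedModType R) (A : set V) (f : V -> M) : Prop :=
  exists U : set V, [/\ open U, A `<=` U,
    forall x, U x -> {for x, continuous f} &
    forall i k, Ck k (U `&` (f @^-1` cdom M i)) (cmap M i \o f)].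

(* A family of vector fields, given by its components in the charts. *)
Definition vfield := chart M -> Par -> R * R -> R * R.

Definition smooth_vfield (rho : R) (X : vfield) : Prop :=
  (forall i, smooth_on
     [set y : Par * (R * R) | `|y.1| < rho /\ (cmap M i @` cdom M i) y.2]
     (fun y => X i y.1 y.2)) /\
  (forall (th : Par) i j z, `|th| < rho -> cdom M i z -> cdom M j z ->
     X j th (cmap M j z) =
     'D_(X i th (cmap M i z)) (cmap M j \o cinv M i) (cmap M i z)).

(* The derivative of a function along a vector field, inside one chart. *)
Definition lie (X : R * R -> R * R) (f : R * R -> R) : R * R -> R :=
  fun x => 'D_(X x) f x.

Record switching := Switching {
  seam : Par -> M -> R ;
  Xminus : vfield ;
  Xplus : vfield ;
  Wfield : vfield
}.

Definition is_switching (rho : R) (Z : switching) : Prop :=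
  [/\ forall i, smooth_on
        [set y : Par * (R * R) | `|y.1| < rho /\ (cmap M i @` cdom M i) y.2]
        (fun y => seam Z y.1 (cinv M i y.2)),
      smooth_vfield rho (Xminus Z),
      smooth_vfield rho (Xplus Z),
      smooth_vfield rho (Wfield Z) &
      forall (th : Par) i z, `|th| < rho -> cdom M i z ->
        Xplus Z i th (cmap M i z) - Xminus Z i th (cmap M i z) =
        seam Z th z *: Wfield Z i th (cmap M i z)].

(* X^- where h <= 0 and X^+ where h >= 0; on a switching system this is
   X^- + max(h, 0) W. *)
Definition physical (Z : switching) : vfield := fun i th x =>
  if seam Z th (cinv M i x) <= 0 then Xminus Z i th x else Xplus Z i th x.

Definition trajectory (Y : vfield) (th : Par) (gam : R -> M) (tau : R) : Prop :=
  [/\ 0 < tau, {within `[0, tau], continuous gam} &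
      forall s i, 0 < s < tau -> cdom M i (gam s) ->
        is_derive s (1 : R) (cmap M i \o gam) (Y i th (cmap M i (gam s)))].

(* A family of parametrized sections x |-> scurve th x, |x| < swidth. *)
Record xsection := XSection { scurve : Par -> R -> M ; swidth : R }.

Definition section_set (sg : xsection) (th : Par) : set M :=
  [set z | exists2 x, `|x| < swidth sg & z = scurve sg th x].

Definition transverse_section (rho : R) (Y : vfield) (sg : xsection) : Prop :=
  [/\ 0 < swidth sg,
      smooth_map_on [set y : Par * R | `|y.1| < rho /\ `|y.2| < swidth sg]
        (fun y => scurve sg y.1 y.2),
      forall th x x', `|th| < rho -> `|x| < swidth sg -> `|x'| < swidth sg ->
        scurve sg th x = scurve sg th x' -> x = x' &
      forall th x i, `|th| < rho -> `|x| < swidth sg ->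
        cdom M i (scurve sg th x) ->
        det2 (derive1 (cmap M i \o scurve sg th) x)
             (Y i th (cmap M i (scurve sg th x))) != 0].

(* gam runs from the point of coordinate x of sg to the point of coordinate y
   of sg', avoiding K strictly in between. *)
Definition leg (Y : vfield) (th : Par) (sg sg' : xsection) (K : set M)
    (x y : R) (gam : R -> M) (tau : R) : Prop :=
  [/\ trajectory Y th gam tau, gam 0 = scurve sg th x,
      `|x| < swidth sg /\ `|y| < swidth sg',
      gam tau = scurve sg' th y &
      forall s, 0 < s < tau -> ~ K (gam s)].

Definition visits (N : nat) (sec : nat -> xsection) (th : Par)
    (gam : R -> M) (tau : R) : Prop :=
  exists ts : nat -> R,
    [/\ ts 0%N = 0, ts N = tau, forall k, (k < N)%N -> ts k < ts k.+1 &
        forall k, (k <= N)%N -> section_set (sec k) th (gam (ts k))].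

(* Rt is a smooth family of local diffeomorphisms, which is the finite-time
   flow map of Y from sout to sin through a finite chain of transverse
   sections. *)
Definition regular_transition (rho delta : R) (Y : vfield)
    (sout sin : xsection) (K : Par -> set M) (Rt : Par -> R -> R) : Prop :=
  [/\ smooth_on [set y : Par * R | `|y.1| < rho /\ `|y.2| < delta]
        (fun y => Rt y.1 y.2),
      forall th x, `|th| < rho -> `|x| < delta -> derive1 (Rt th) x != 0 &
      exists (N : nat) (sec : nat -> xsection),
        [/\ (0 < N)%N, sec 0%N = sout, sec N = sin,
            forall k, (k <= N)%N -> transverse_section rho Y (sec k) &
            forall th x, `|th| < rho -> `|x| < delta ->
              exists gam tau, leg Y th sout sin (K th) x (Rt th x) gam tau /\
                visits N sec th gam tau]].

End phase_space.

Arguments switching {R} M Par.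
Arguments xsection {R} M Par.
Arguments seam {R M Par} _ _ _.
Arguments scurve {R M Par} _ _ _.
Arguments swidth {R M Par} _.

(* theta = (p, u) *)
Definition param (R : realType) (m nu : nat) : normedModType R :=
  ('rV[R]_m * 'rV[R]_(nu - 2))%type.

Section passage_coordinates.
Context {R : realType} (m nu : nat).
Notation Theta := (param R m nu).

Definition contact_graph (a : Theta -> R) (Rem : R -> Theta -> R)
    (th : Theta) (t : R) : R :=
  a th * t ^+ nu + \sum_(j < nu - 2) th.2 ord0 j * t ^+ j.+1
  + t ^+ nu.+1 * Rem t th.

Definition flow_box (T Istar rho : R) : set (R * R * Theta) :=
  [set y | [/\ - T <= y.1.1 <= T, `|y.1.2| < Istar & `|y.2| < rho]].

Definition box_smooth (T Istar rho : R) (f : R -> R -> Theta -> R) : Prop :=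
  smooth_on (flow_box T Istar rho) (fun y => f y.1.1 y.1.2 y.2).

End passage_coordinates.

Record prepared_passage (R : realType) (m nu : nat) := PreparedPassage {
  pT : R ; pI : R ; prho : R ; pkappa : R ;
  pa : param R m nu -> R ;
  pRem : R -> param R m nu -> R ;
  pg : R -> R -> param R m nu -> R ;
  pA : R -> R -> param R m nu -> R ;
  pBgeo : R -> R -> param R m nu -> R ;
  pB : R -> R -> param R m nu -> R ;
  (* psol th q t is I(t; q, th) *)
  psol : param R m nu -> R -> R -> R ;
  p_pos : [/\ 0 < pT, 0 < pI, 0 < prho, prho <= pI & 0 < pkappa] ;
  pa_smooth : smooth_on [set th | `|th| < prho] pa ;
  pRem_smooth : smooth_on [set y : R * param R m nu | - pT <= y.1 <= pT /\ `|y.2| < prho]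
        (fun y => pRem y.1 y.2) ;
  pa_gt0 : 0 < pa 0 ;
  pPhi_derivative : forall th t, `|th| < prho -> `|t| <= pT ->
        pkappa <= derive1n nu (contact_graph pa pRem th) t ;
  pg_smooth : box_smooth pT pI prho pg ;
  pA_smooth : box_smooth pT pI prho pA ;
  pBgeo_smooth : box_smooth pT pI prho pBgeo ;
  pg_gt0 : forall t J th, flow_box pT pI prho (t, J, th) -> 0 < pg t J th ;
  pB_C2 : Ck_on 2 (flow_box pT pI prho) (fun y => pB y.1.1 y.1.2 y.2) ;
  pB_active : forall t J th, flow_box pT pI prho (t, J, th) ->
        contact_graph pa pRem th t < J ->
        let den := 1 + pg t J th * (J - contact_graph pa pRem th t) * pA t J th in
        0 < den /\ pB t J th = pg t J th * pBgeo t J th / den ;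
  psol_solution : forall th q, `|th| < prho -> `|q| < prho ->
        [/\ psol th q (- pT) = q,
            {within `[- pT, pT], continuous (psol th q)},
            forall t, - pT <= t <= pT -> `|psol th q t| < pI &
            forall t, - pT < t < pT ->
              is_derive t (1 : R) (psol th q)
                (Num.max (psol th q t - contact_graph pa pRem th t) 0
                 * pB t (psol th q t) th)] ;
  psol_inactive : forall th q, `|th| < prho -> `|q| < prho ->
        q < contact_graph pa pRem th (- pT) /\
        psol th q pT < contact_graph pa pRem th pT
}.

Section passage_quantities.
Context {R : realType} (m nu : nat).
Variable Z : prepared_passage R m nu.

Definition Phi := contact_graph (pa Z) (pRem Z).
Definition beta0 : R := pB Z 0 0 0.
Definition Dcorr (q : R) (th : param R m nu) : R := psol Z th q (pT Z) - q.

(* psi th carries the flow box in the variables (t, I) to the phase space. *)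
Definition is_flow_box (M : surface R) (S : switching M (param R m nu))
    (psi : param R m nu -> R * R -> M) : Prop :=
  let rho := prho Z in
  let inbox th x := flow_box (pT Z) (pI Z) rho (x.1, x.2, th) in
  [/\ smooth_map_on [set y : param R m nu * (R * R) | inbox y.1 y.2]
        (fun y => psi y.1 y.2),
      forall th x x', inbox th x -> inbox th x' -> psi th x = psi th x' -> x = x',
      forall th x i, inbox th x -> cdom M i (psi th x) ->
        let f := cmap M i \o psi th in
        det2 ('D_(1, 0) f x) ('D_(0, 1) f x) != 0,
      forall th x, inbox th x ->
        seam S th (psi th x) = pg Z x.1 x.2 th * (x.2 - Phi th x.1) &
      forall th x i, inbox th x -> cdom M i (psi th x) ->
        let f := cmap M i \o psi th in
        'D_(1, 0) f x = Xminus S i th (f x) /\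
        'D_(pA Z x.1 x.2 th, pBgeo Z x.1 x.2 th) f x = Wfield S i th (f x)].

Definition box_image (M : surface R) (psi : param R m nu -> R * R -> M)
    (th : param R m nu) : set M :=
  [set z | exists2 x, flow_box (pT Z) (pI Z) (prho Z) (x.1, x.2, th)
                    & z = psi th x].

Definition box_section (M : surface R) (psi : param R m nu -> R * R -> M)
    (t : R) : xsection M (param R m nu) :=
  XSection (fun th J => psi th (t, J)) (pI Z).

End passage_quantities.

Record multiwell_return (R : realType) (m nu : nat) := MultiwellReturn {
  mw_passage :> prepared_passage R m nu ;
  mw_space : surface R ;
  mw_system : switching mw_space (param R m nu) ;
  mw_psi : param R m nu -> R * R -> mw_space ;
  mw_delta : R ;
  mw_R : param R m nu -> R -> R ;
  mw_radius : prho mw_passage <= mw_delta ;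
  mw_switching : is_switching (prho mw_passage) mw_system ;
  mw_flow_box : is_flow_box mw_passage mw_system mw_psi ;
  mw_crossing : forall th q, `|th| < prho mw_passage -> `|q| < prho mw_passage ->
        let Y := physical mw_system in
        let sin := box_section mw_passage mw_psi (- pT mw_passage) in
        let sout := box_section mw_passage mw_psi (pT mw_passage) in
        `|q + Dcorr mw_passage q th| < mw_delta /\
        exists gam tau,
          leg Y th sin sout
            (section_set sin th `|` section_set sout th
             `|` ~` box_image mw_passage mw_psi th)
            q (q + Dcorr mw_passage q th) gam tau ;
  mw_transition : regular_transition (prho mw_passage) mw_delta (physical mw_system)
        (box_section mw_passage mw_psi (pT mw_passage))
        (box_section mw_passage mw_psi (- pT mw_passage))
        (box_image mw_passage mw_psi) mw_R
}.

Section displacement.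
Context {R : realType} (m nu : nat).
Variable Z : multiwell_return R m nu.

Definition return_map (th : param R m nu) (q : R) : R :=
  mw_R Z th (q + Dcorr Z q th).

Definition Delta (q : R) (th : param R m nu) : R := return_map th q - q.

Definition Sref (q : R) (th : param R m nu) : R := mw_R Z th q - q.

Definition Gcorr (q : R) (th : param R m nu) : R :=
  mw_R Z th (q + Dcorr Z q th) - mw_R Z th q.

Lemma Delta_decomposition q th : Delta q th = Sref q th + Gcorr q th.
Proof. by rewrite addrC /Delta /Sref /Gcorr addrA subrK. Qed.

Definition coefficient_map (n : nat) (p : 'rV[R]_m) : 'rV[R]_n :=
  \row_(j < n) (derive1n j (fun q => Sref q (p, 0)) 0 / j`!%:R).

End displacement.

Record FR_data (R : realType) (m nu : nat) (P : 'rV[R]_m -> R -> R) := FRData {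
  fr_space : surface R ;
  fr_sys : switching fr_space 'rV[R]_m ;
  fr_rho : R ;
  fr_delta : R ;
  fr_z : 'rV[R]_m -> fr_space ;
  fr_Omega : set ('rV[R]_m * fr_space) ;
  fr_I : 'rV[R]_m -> fr_space -> R ;
  fr_in : xsection fr_space 'rV[R]_m ;
  fr_out : xsection fr_space 'rV[R]_m ;
  fr_D : R -> 'rV[R]_m -> R ;
  fr_R : 'rV[R]_m -> R -> R ;
  fr_pos : 0 < fr_rho /\ 0 < fr_delta ;
  fr_switching : is_switching fr_rho fr_sys ;
  fr_z_smooth : smooth_map_on [set p | `|p| < fr_rho] fr_z ;
  fr_z_seam : forall p, `|p| < fr_rho -> seam fr_sys p (fr_z p) = 0 ;
  fr_contact : forall p i, `|p| < fr_rho -> cdom fr_space i (fr_z p) ->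
        let h := seam fr_sys p \o cinv fr_space i in
        let X := Xminus fr_sys i p in
        let x := cmap fr_space i (fr_z p) in
        [/\ exists v, 'D_v h x != 0,
            X x != 0,
            forall j, (1 <= j < nu)%N -> iter j (lie X) h x = 0 &
            0 < - iter nu (lie X) h x] ;
  fr_Omega_open : open fr_Omega ;
  fr_Omega_z : forall p, `|p| < fr_rho -> fr_Omega (p, fr_z p) ;
  fr_I_smooth : forall i, smooth_on
        [set y : 'rV[R]_m * (R * R) | [/\ `|y.1| < fr_rho,
           (cmap fr_space i @` cdom fr_space i) y.2 &
           fr_Omega (y.1, cinv fr_space i y.2)]]
        (fun y => fr_I y.1 (cinv fr_space i y.2)) ;
  fr_I_first_integral : forall p i w, `|p| < fr_rho -> fr_Omega (p, w) -> cdom fr_space i w ->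
        lie (Xminus fr_sys i p) (fr_I p \o cinv fr_space i)
          (cmap fr_space i w) = 0 ;
  fr_I_z : forall p, `|p| < fr_rho -> fr_I p (fr_z p) = 0 ;
  fr_dI_z : forall p i v, `|p| < fr_rho -> cdom fr_space i (fr_z p) ->
        'D_v (fr_I p \o cinv fr_space i) (cmap fr_space i (fr_z p)) =
        'D_v (seam fr_sys p \o cinv fr_space i) (cmap fr_space i (fr_z p)) ;
  fr_transverse : forall Y sg, Y = Xminus fr_sys \/ Y = physical fr_sys ->
        sg = fr_in \/ sg = fr_out -> transverse_section fr_rho Y sg ;
  fr_coordinate : forall sg p x, sg = fr_in \/ sg = fr_out ->
        `|p| < fr_rho -> `|x| < swidth sg ->
        fr_Omega (p, scurve sg p x) /\ fr_I p (scurve sg p x) = x ;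
  fr_disjoint : forall p, `|p| < fr_rho ->
        section_set fr_in p `&` section_set fr_out p = set0 ;
  fr_excursions : forall p q, `|p| < fr_rho -> `|q| < fr_rho ->
        let K := section_set fr_in p `|` section_set fr_out p
                 `|` [set w | ~ fr_Omega (p, w)] in
        `|q + fr_D q p| < fr_delta /\
        exists x x' gam tau gam' tau',
          [/\ leg (physical fr_sys) p fr_in fr_out K q x gam tau,
              leg (Xminus fr_sys) p fr_in fr_out K q x' gam' tau',
              q = 0 -> exists2 s, 0 < s < tau' & gam' s = fr_z p &
              fr_D q p = fr_I p (gam tau) - fr_I p (gam' tau')] ;
  fr_transition : regular_transition fr_rho fr_delta (physical fr_sys) fr_out fr_in
        (section_set fr_in) fr_R ;
  fr_return : forall p q, `|p| < fr_rho -> `|q| < fr_rho ->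
        P p q = fr_R p (q + fr_D q p)
}.

Definition FR (R : realType) (m nu : nat) (P : 'rV[R]_m -> R -> R) : Prop :=
  inhabited (FR_data nu P).

Section stability.
Context {R : realType}.
Implicit Type P : R -> R.

Definition attracting P (q : R) : Prop :=
  (forall e, 0 < e -> exists2 d, 0 < d &
     forall x, `|x - q| < d -> forall k, `|iter k P x - q| < e) /\
  (exists2 d, 0 < d &
     forall x, `|x - q| < d -> (fun k => iter k P x) @ \oo --> q).

Definition repelling P (q : R) : Prop :=
  exists2 d, 0 < d &
    forall x, x != q -> `|x - q| < d -> exists k, d <= `|iter k P x - q|.

Definition alternating_stability P (s : seq R) : Prop :=
  exists b : bool, forall i, (i < size s)%N ->
    if odd i (+) b then attracting P s`_i else repelling P s`_i.

Definition simple_zero (f : R -> R) (q : R) : Prop :=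
  [/\ f q = 0, derivable f q 1 & derive1 f q != 0].

(* s lists, in increasing order, all zeros of f on (-r, r). *)
Definition zeros_listed (f : R -> R) (r : R) (s : seq R) : Prop :=
  sorted <%R s /\ forall q, (q \in s) <-> (`|q| < r /\ f q = 0).

End stability.

(* Main.v *)
Require Import Defs.
From HB Require Import structures.
From mathcomp Require Import all_boot all_order all_algebra.
From mathcomp Require Import all_classical all_reals all_analysis.
From mathcomp Require Import ring lra.

Set Implicit Arguments.
Unset Strict Implicit.
Unset Printing Implicit Defensive.

Import Order.TTheory GRing.Theory Num.Theory.
Import numFieldNormedType.Exports.

Local Open Scope classical_set_scope.
Local Open Scope ring_scope.

(** Write mu for the minimum over the box of the contact graph of the
    parameter at hand.  An orbit that enters at height at most mu never
    crosses the graph and keeps its height, so the displacement Delta equals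
    the smooth reference S to the left of mu; to the right of mu the orbit is
    pushed to the side given by the sign of beta, and so is Delta - S
    ([rests_below], [active_exit]).

    The heart of the proof is that on the right of mu the displacement is
    convex, in the direction of that sign, with a modulus as large as desired
    once the neighbourhood is small ([convex_log], [return_convex]).  For three
    orbits with entering heights q1 < q2 < q3 consider the logarithm of the
    ratio of the upper gap to the lower gap, times the sign of beta.  Its time
    derivative is the correspondingly signed difference of two consecutive slopes
    of max(I - Phi, 0) B, and this is nonnegative up to an error of the order of
    q3 - q1, because the positive part is convex.  The difference is moreover
    of order one while the graph descends through the heights between q1 and
    q3.  The graph is flat at the contact, so its speed is at most eps near
    the contact and this descent takes a time of at least (q3 - q1) / eps; as
    eps may be chosen at will, the gain beats every error.  The outgoing
    transition has derivative close to 1 and bounded second derivative, hence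
    does not spoil this.

    Counting zeros is then elementary ([zero_bound]).  Convexity leaves at most
    two zeros to the right of mu, and if there are two of them the sign of S
    at mu is known.  The zeros to the left are zeros of S, whose n-th derivative
    does not vanish, so that the mean value theorem forbids n + 1 weakly
    alternating values of S ([alternation]).  Comparing signs gives n zeros if
    cd > 0 and n + 1 if cd < 0.

    For sharpness, a coefficient map of rank n is open at 0 ([strict_open]), so
    that some arbitrarily small p on the central slice gives S the first n
    Taylor coefficients of c (q + eps) ... (q + n eps), whose zeros are
    negative.  There mu = 0, and these zeros persist as n simple zeros of Delta.
    If cd < 0, then Delta has the wrong sign at 0 and the convexity, stronger
    than S on a fixed scale, creates one more zero on the right ([active_root]).
    This zero lies where Delta is only known to be Lipschitz; Delta is
    nevertheless differentiable there because on the central slice an orbit meets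
    the graph at most twice ([two_contacts], [end_derivable]).

    Finally Delta has Lipschitz constant 1/2, so the slope of the return map is
    at least 1/2, and consecutive simple zeros of Delta have slopes of opposite
    signs: attracting and repelling orbits alternate ([alternates]). *)

(** * One-variable calculus *)

Section calculus.
Context {R : realType}.
Implicit Types (f df : R -> R) (a b : R).

Lemma is_derive_continuous f (df x : R) : is_derive x 1 f df -> {for x, continuous f}.
Proof. by move=> h; apply/differentiable_continuous/derivable1_diffP. Qed.

Lemma is_derive_within f df (A : set R) :
  (forall x, A x -> is_derive x 1 f (df x)) -> {within A, continuous f}.
Proof.
move=> h; apply: continuous_in_subspaceT => x; rewrite inE => /h.
exact: is_derive_continuous.
Qed.

Lemma within_opp f (A : set R) :
  {within A, continuous f} -> {within A, continuous (fun x => - f x)}.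
Proof. by move=> cf x; exact: (continuousN (cf x)). Qed.

Lemma within_add f (g : R -> R) (A : set R) : {within A, continuous f} ->
  {within A, continuous g} -> {within A, continuous (fun x => f x + g x)}.
Proof. by move=> cf cg x; exact: (continuousD (cf x) (cg x)). Qed.

Lemma within_sub f (g : R -> R) (A : set R) : {within A, continuous f} ->
  {within A, continuous g} -> {within A, continuous (fun x => f x - g x)}.
Proof. by move=> cf cg x; exact: (continuousB (cf x) (cg x)). Qed.

Lemma within_mul f (g : R -> R) (A : set R) : {within A, continuous f} ->
  {within A, continuous g} -> {within A, continuous (fun x => f x * g x)}.
Proof. by move=> cf cg x; exact: (continuousM (cf x) (cg x)). Qed.

Lemma within_comp f (g : R -> R) (A : set R) : {within A, continuous f} ->
  (forall x, A x -> {for f x, continuous g}) ->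
  {within A, continuous (fun x => g (f x))}.
Proof.
move=> /subspace_continuousP cf cg; apply/subspace_continuousP => x Ax.
exact: (cvg_comp _ _ (cf x Ax) (cg x Ax)).
Qed.

Lemma within_itvS f a b a' b' : a <= a' -> b' <= b ->
  {within `[a, b], continuous f} -> {within `[a', b'], continuous f}.
Proof.
move=> aa bb; apply: continuous_subspaceW => x /=; rewrite !in_itv /= => /andP[h1 h2].
by rewrite (le_trans aa h1) (le_trans h2 bb).
Qed.

Lemma mean_value f df a b : a < b ->
  (forall x, a < x < b -> is_derive x 1 f (df x)) ->
  {within `[a, b], continuous f} ->
  exists2 c, a < c < b & f b - f a = df c * (b - a).
Proof.
move=> ab dfP cf; have dfP' x : x \in `]a, b[ -> is_derive x 1 f (df x) by rewrite in_itv /=; exact: dfP.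
by have [c cab e] := MVT ab dfP' cf; exists c; rewrite // -in_itv.
Qed.

Lemma derive_ge0_le f df a b : a <= b ->
  (forall x, a < x < b -> is_derive x 1 f (df x)) ->
  (forall x, a < x < b -> 0 <= df x) ->
  {within `[a, b], continuous f} -> f a <= f b.
Proof.
rewrite le_eqVlt => /orP[/eqP<-//|ab] dfP df0 cf.
have [c cab e] := mean_value ab dfP cf.
by rewrite -subr_ge0 e mulr_ge0 ?df0// subr_ge0 ltW.
Qed.

Lemma derive_lip (h dh : R -> R) (a c A : R) : a <= c ->
  {within `[a, c], continuous h} ->
  (forall t, a < t < c -> is_derive t 1 h (dh t)) ->
  (forall t, a < t < c -> `|dh t| <= A) -> `|h c - h a| <= A * (c - a).
Proof.
rewrite le_eqVlt => /orP[/eqP->|ac] ch hdh hA; first by rewrite !subrr normr0 mulr0.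
have [xi xiac ->] := mean_value ac hdh ch.
have d : 0 <= c - a by rewrite subr_ge0 ltW.
by rewrite normrM (ger0_norm d) ler_wpM2r// hA.
Qed.

(** Rolle's theorem in a form that tolerates zeros: the mean value theorem turns a
    weak alternation of F at k + 1 points into one of F' at k points, and after k
    steps the sign of the k-th derivative is contradicted. *)
Lemma alternation (k : nat) (F : nat -> R -> R) a b (x : nat -> R) :
  (forall j t, a < t < b -> is_derive t 1 (F j) (F j.+1 t)) ->
  (forall t, a < t < b -> 0 < F k t) ->
  (forall i, (i <= k)%N -> a < x i < b) ->
  (forall i, (i < k)%N -> x i < x i.+1) ->
  (forall i, (i <= k)%N -> (-1) ^+ (k - i) * F 0%N (x i) <= 0) -> False.
Proof.
elim: k F x => [|k IH] F x dF Fpos xab xmono xalt.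
  have := xalt 0%N (leqnn _); rewrite subnn expr0 mul1r => h.
  by have := Fpos _ (xab 0%N (leqnn _)); rewrite ltNge h.
have step i : exists c, (i <= k)%N -> x i < c < x i.+1 /\
    F 0%N (x i.+1) - F 0%N (x i) = F 1%N c * (x i.+1 - x i).
  have [ik|] := leqP i k; last by exists 0.
  have /andP[ai _] := xab i (leqW ik).
  have /andP[_ bi] := xab i.+1 ik.
  have xin t : x i <= t <= x i.+1 -> a < t < b.
    by move=> /andP[h1 h2]; rewrite (lt_le_trans ai h1) (le_lt_trans h2 bi).
  have [t /andP[t1 t2]||c cx e] := @mean_value (F 0%N) (F 1%N) (x i) (x i.+1) (xmono i ik).
  - by apply/dF/xin; rewrite !ltW.
  - by apply: (@is_derive_within _ (F 1%N)) => t /=; rewrite in_itv /= => /xin; exact: dF.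
  - by exists c.
have [y yP] := choice step.
apply: (IH (fun j => F j.+1) y).
- exact: Fpos.
- move=> i ik; have [/andP[h1 h2] _] := yP i ik.
  have /andP[ai _] := xab i (leqW ik).
  have /andP[_ bi] := xab i.+1 ik.
  by rewrite (lt_trans ai h1) (lt_trans h2 bi).
- move=> i ik; have [/andP[_ h2] _] := yP i (ltnW ik).
  by have [/andP[h1 _] _] := yP i.+1 ik; rewrite (lt_trans h2 h1).
- move=> i ik; have [_ e] := yP i ik.
  have h1 := xalt i (leqW ik); have h2 := xalt i.+1 ik.
  rewrite subSS in h2; rewrite subSn// exprS in h1.
  have d0 : 0 < x i.+1 - x i by rewrite subr_gt0 xmono.
  rewrite -(pmulr_lle0 _ d0) -mulrA -e mulrBr.
  by move: h1; rewrite mulN1r mulNr oppr_le0 => h1; rewrite subr_le0 (le_trans h2 h1).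
Qed.

Lemma within_eps f a b s e : {within `[a, b], continuous f} -> a <= s <= b -> 0 < e ->
  exists2 d, 0 < d & forall t, a <= t <= b -> `|t - s| < d -> `|f t - f s| < e.
Proof.
move=> /subspace_continuousP cf sab e0.
have := cf s; rewrite /= in_itv /= => /(_ sab) /cvgrPdist_lt /(_ e e0).
rewrite /within /= => /nbhs_ballP[d /= d0 H].
exists d => // t tab ts; rewrite distrC; apply: H; last by rewrite in_itv.
by rewrite /ball /= distrC.
Qed.

Lemma first_hit f a b c : a <= b -> {within `[a, b], continuous f} ->
  c < f a -> f b <= c ->
  exists s, [/\ a < s <= b, f s = c & forall t, a <= t < s -> c < f t].
Proof.
move=> ab cf fa fb.
pose A := [set t | a <= t <= b /\ f t <= c].
have Ab : A b by split; rewrite // ab lexx.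
have Alb : lbound A a by move=> t [/andP[]].
have hA : has_inf A by split; [exists b|exists a].
pose s := inf A.
have as_ : a <= s by apply: lb_le_inf => //; exists b.
have sb : s <= b by apply: ge_inf => //; exists a.
have sab : a <= s <= b by rewrite as_.
have lts t : a <= t < s -> c < f t.
  move=> /andP[h1 h2]; rewrite ltNge; apply/negP => h.
  have : s <= t by apply: ge_inf; [exists a|split; rewrite // h1 (le_trans (ltW h2))].
  by rewrite leNgt h2.
have fs : f s <= c.
  rewrite leNgt; apply/negP => h.
  have [d d0 dP] := @within_eps f a b s (f s - c) cf sab ltac:(by rewrite subr_gt0).
  have [t [tab ft] ts] := @inf_adherent _ A d d0 hA.
  have st : s <= t by apply: ge_inf; [exists a|split].
  (* If f s > c, continuity keeps f above c next to the infimum s. *)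
  have := dP t tab; rewrite ger0_norm ?subr_ge0// ltrBlDl => /(_ ts).
  by rewrite ltr_norml => /andP[+ _]; lra.
have sa : a < s.
  by rewrite lt_def as_ andbT; apply/eqP => e; move: fa; rewrite ltNge -e fs.
exists s; split => //; first by rewrite sa.
apply/eqP; rewrite eq_le fs /= leNgt; apply/negP => h.
have [d d0 dP] := @within_eps f a b s (c - f s) cf sab ltac:(by rewrite subr_gt0).
pose t := Num.max a (s - d / 2).
have ats : a <= t < s by rewrite /t le_max lexx gt_max sa /=; lra.
have := lts _ ats; case/andP: ats => h1 h2.
have := dP t; rewrite h1 (le_trans (ltW h2) sb) => /(_ isT).
rewrite ltr0_norm ?subr_lt0// => H.
have ht : s - d / 2 <= t by rewrite /t le_max lexx orbT.
have /H : - (t - s) < d by lra.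
by rewrite ltr_norml => /andP[]; lra.
Qed.

Lemma last_hit f a b c : a <= b -> {within `[a, b], continuous f} ->
  c <= f a -> f b < c ->
  exists s, [/\ a <= s < b, f s = c & forall t, s < t <= b -> f t < c].
Proof.
move=> ab cf fa fb.
pose g t := - f (- t).
have cg : {within `[- b, - a], continuous g}.
  have cf' : {within `[- b, - a], continuous f \o -%R}.
    by apply: within_continuous_compN; rewrite !opprK.
  exact: within_opp.
have [||||s [/andP[s1 s2] s3 s4]] := @first_hit g (- b) (- a) (- c).
- by rewrite lerN2.
- exact: cg.
- by rewrite /g opprK ltrN2.
- by rewrite /g opprK lerN2.
exists (- s); split.
- by rewrite lerNr s2 ltrNl.
- by apply: oppr_inj.
- move=> t /andP[h1 h2]; have := s4 (- t); rewrite /g opprK ltrN2; apply.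
  by rewrite lerN2 h2 ltrNl.
Qed.

(** Cutting at the last time at height d before the first time at height c leaves
    an interval on which f lies between the two heights. *)
Lemma descent f a b c d : {within `[a, b], continuous f} -> a <= b ->
  c < d -> d <= f a -> f b <= c ->
  exists s' s, [/\ a <= s', s' < s, s <= b, f s' = d & f s = c] /\
    (forall t, a <= t < s -> c < f t) /\
    (forall t, s' < t <= s -> f t < d).
Proof.
move=> cf ab cd fa fb.
have [s [/andP[s1 s2] s3 s4]] := first_hit ab cf (lt_le_trans cd fa) fb.
have cf' : {within `[a, s], continuous f} by exact: within_itvS cf.
have [|s' [/andP[h1 h2] h3 h4]] := last_hit (ltW s1) cf' fa; first by rewrite s3.
by exists s', s.
Qed.

End calculus.

(** * Gronwall estimates *)

Section gronwall.
Context {R : realType}.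
Implicit Types (f df : R -> R) (a b : R).

Lemma gronwall_le f df a b (K : R) : a <= b ->
  {within `[a, b], continuous f} ->
  (forall t, a < t < b -> is_derive t 1 f (df t)) ->
  (forall t, a < t < b -> df t <= K * f t) ->
  f b <= f a * expR (K * (b - a)).
Proof.
move=> ab cf dfP hf.
have dE (t : R) : is_derive t 1 (fun t => expR (- (K * (t - a)))) (- K * expR (- (K * (t - a)))).
  have dl : is_derive t 1 (fun t => - (K * (t - a))) (- K).
    by apply: is_derive_eq; rewrite /GRing.scale /=; ring.
  have := @is_derive1_comp _ expR (fun t => - (K * (t - a))) t _ _ (is_derive_expR _) dl.
  by move=> /(@is_derive_eq _ _ _ _ _ _ _ _); apply; rewrite mulrC.
pose g t := - (f t * expR (- (K * (t - a)))).
have cg : {within `[a, b], continuous g}.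
  apply/within_opp/within_mul => //.
  by apply: continuous_subspaceT => z; exact: is_derive_continuous (dE z).
have dg t : a < t < b -> is_derive t 1 g (expR (- (K * (t - a))) * (K * f t - df t)).
  move=> tab; have h := dfP t tab; have h' := dE t.
  by apply: is_derive_eq; rewrite /GRing.scale /=; ring.
have := derive_ge0_le ab dg _ cg; rewrite /g subrr mulr0 oppr0 expR0 mulr1.
rewrite lerN2 => h.
have {h} : f b * expR (- (K * (b - a))) <= f a.
  by apply: h => x xab; rewrite mulr_ge0 ?expR_ge0// subr_ge0 hf.
by rewrite expRN -ler_pdivlMr ?invrK// invr_gt0 expR_gt0.
Qed.

Lemma gronwall_ge f df a b (K : R) : a <= b ->
  {within `[a, b], continuous f} ->
  (forall t, a < t < b -> is_derive t 1 f (df t)) ->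
  (forall t, a < t < b -> K * f t <= df t) ->
  f a * expR (K * (b - a)) <= f b.
Proof.
move=> ab cf dfP hf; rewrite -lerN2 -mulNr.
apply: (@gronwall_le (fun t => - f t) (fun t => - df t)) => //.
- exact: within_opp.
- by move=> t tab; have h := dfP t tab; apply: is_derive_eq.
- by move=> t tab; rewrite mulrN lerN2 hf.
Qed.

(** Squares avoid a discussion of the sign of f.  The lower bound says that a
    solution which starts away from zero never reaches it, the form in which
    uniqueness of solutions is used below. *)
Lemma gronwall_sqr f df a b (L : R) : a <= b ->
  {within `[a, b], continuous f} ->
  (forall t, a < t < b -> is_derive t 1 f (df t)) ->
  (forall t, a < t < b -> `|df t| <= L * `|f t|) ->
  f a ^+ 2 * expR (- (2 * L) * (b - a)) <= f b ^+ 2 /\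
  f b ^+ 2 <= f a ^+ 2 * expR ((2 * L) * (b - a)).
Proof.
move=> ab cf dfP hf.
have cf2 : {within `[a, b], continuous (fun t => f t ^+ 2)}.
  exact: within_mul.
have df2 t : a < t < b -> is_derive t 1 (fun t => f t ^+ 2) (2 * f t * df t).
  by move=> tab; have h := dfP t tab; apply: is_derive_eq; rewrite /GRing.scale /=; ring.
have bd t : a < t < b -> `|2 * f t * df t| <= 2 * L * f t ^+ 2.
  move=> tab; rewrite !normrM ger0_norm// -(real_normK (num_real (f t))).
  have := ler_wpM2l (normr_ge0 (f t)) (hf t tab); lra.
split.
- apply: gronwall_ge df2 _ => // t /bd; rewrite ler_norml => /andP[+ _].
  by rewrite !mulNr.
- by apply: gronwall_le df2 _ => // t /bd; rewrite ler_norml => /andP[].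
Qed.

End gronwall.

(** * The switching nonlinearity *)

Section kink.
Context {R : realType}.
Implicit Types x y z phi : R.

Definition kink phi x : R := Num.max (x - phi) 0.

Lemma kink_ge0 phi x : 0 <= kink phi x.
Proof. by rewrite le_max lexx orbT. Qed.

Lemma kink_slope phi x y : x < y -> 0 <= (kink phi y - kink phi x) / (y - x) <= 1.
Proof.
move=> xy; have d : 0 < y - x by rewrite subr_gt0.
rewrite ler_pdivlMr// ler_pdivrMr// mul0r mul1r /kink.
case: (leP (y - phi) 0); case: (leP (x - phi) 0) => *; lra.
Qed.

Lemma kink_lip phi x y : `|kink phi y - kink phi x| <= `|y - x|.
Proof.
wlog xy : x y / x < y.
  move=> W; case: (ltgtP x y) => [|xy|->]; first exact: W.
    by rewrite distrC [leRHS]distrC W.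
  by rewrite !subrr.
have := kink_slope phi xy; rewrite ler_pdivlMr ?ler_pdivrMr ?subr_gt0// mul0r mul1r.
by move=> /andP[h1 h2]; rewrite !ger0_norm // subr_ge0 ltW.
Qed.

Lemma kink_convex phi x y z : x < y -> y < z ->
  (kink phi y - kink phi x) / (y - x) <= (kink phi z - kink phi y) / (z - y).
Proof.
move=> xy yz; have d : 0 < y - x by rewrite subr_gt0.
have d' : 0 < z - y by rewrite subr_gt0.
rewrite ler_pdivrMr// mulrAC ler_pdivlMr// /kink.
case: (leP (y - phi) 0); case: (leP (x - phi) 0); case: (leP (z - phi) 0) => *; nra.
Qed.

(** In the product of the kink with B, pair the slope of the kink with the value of
    B at the far point and the slope of B with the value of the kink at the middle
    point.  Then B multiplies the nonnegative difference of kink slopes through the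
    single value Bx, and all the remaining terms are of the order of z - x. *)
Lemma slope_gain phi x y z (m C sigma Bx By Bz : R) :
  sigma = 1 \/ sigma = -1 -> 0 <= m -> 0 <= C -> x < y -> y < z ->
  kink phi y <= 1 -> m <= sigma * Bx -> `|Bz - Bx| <= C * (z - x) ->
  `|(Bz - By) / (z - y) - (By - Bx) / (y - x)| <= C * (z - x) ->
  m * ((kink phi z - kink phi y) / (z - y) - (kink phi y - kink phi x) / (y - x))
    - 2 * C * (z - x) <=
  sigma * ((kink phi z * Bz - kink phi y * By) / (z - y)
         - (kink phi y * By - kink phi x * Bx) / (y - x)).
Proof.
move=> hs m0 C0 xy yz k1 mB hB hb.
have d : y - x != 0 by rewrite gt_eqF// subr_gt0.
have d' : z - y != 0 by rewrite gt_eqF// subr_gt0.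
set k23 := (kink phi z - kink phi y) / (z - y).
set k12 := (kink phi y - kink phi x) / (y - x).
have -> : (kink phi z * Bz - kink phi y * By) / (z - y) =
  k23 * Bz + kink phi y * ((Bz - By) / (z - y)) by rewrite /k23; field.
have -> : (kink phi y * By - kink phi x * Bx) / (y - x) =
  k12 * Bx + kink phi y * ((By - Bx) / (y - x)) by rewrite /k12; field.
have /andP[k230 k231] := kink_slope phi yz; rewrite -/k23 in k230 k231.
have hk := kink_convex phi xy yz; rewrite -/k23 -/k12 in hk.
have k0 := kink_ge0 phi y.
set u := (Bz - By) / (z - y) in hb *; set v := (By - Bx) / (y - x) in hb *.
have -> : sigma * (k23 * Bz + kink phi y * u - (k12 * Bx + kink phi y * v)) =
  (sigma * Bx) * (k23 - k12) + sigma * (k23 * (Bz - Bx) + kink phi y * (u - v)) by ring.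
have h1 : m * (k23 - k12) <= sigma * Bx * (k23 - k12) by rewrite ler_wpM2r// subr_ge0.
suff : `|sigma * (k23 * (Bz - Bx) + kink phi y * (u - v))| <= 2 * C * (z - x).
  by rewrite ler_norml => /andP[]; lra.
have -> : `|sigma * (k23 * (Bz - Bx) + kink phi y * (u - v))| =
  `|k23 * (Bz - Bx) + kink phi y * (u - v)|.
  by rewrite normrM; case: hs => ->; rewrite ?normrN normr1 mul1r.
apply: (le_trans (ler_normD _ _)); rewrite (normrM k23) (normrM (kink phi y)) (ger0_norm k230) (ger0_norm k0).
have h2 : k23 * `|Bz - Bx| <= 1 * (C * (z - x)) by rewrite ler_pM ?normr_ge0.
have h3 : kink phi y * `|u - v| <= 1 * (C * (z - x)) by rewrite ler_pM ?normr_ge0.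
lra.
Qed.

Lemma kink_product_lip phi x y (M C Bx By : R) :
  0 <= M -> kink phi x <= 1 -> `|By| <= M -> `|By - Bx| <= C * `|y - x| ->
  `|kink phi y * By - kink phi x * Bx| <= (M + C) * `|y - x|.
Proof.
move=> M0 k1 hB hd.
have -> : kink phi y * By - kink phi x * Bx =
  (kink phi y - kink phi x) * By + kink phi x * (By - Bx) by ring.
apply: (le_trans (ler_normD _ _)); rewrite !normrM (ger0_norm (kink_ge0 phi x)).
have h2 : `|kink phi y - kink phi x| * `|By| <= `|y - x| * M.
  by rewrite ler_pM ?normr_ge0// kink_lip.
have h3 : kink phi x * `|By - Bx| <= 1 * (C * `|y - x|).
  by rewrite ler_pM ?normr_ge0 ?kink_ge0.
lra.
Qed.

(** On one side of its corner the kink is affine, hence its slopes based at x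
    coincide and only the variation of B is left. *)
Lemma slope_cauchy phi x y z (C Bx By Bz : R) :
  0 <= C -> y != x -> z != x -> kink phi x <= 1 ->
  (x <= phi /\ y <= phi /\ z <= phi) \/ (phi <= x /\ phi <= y /\ phi <= z) ->
  `|Bz - By| <= C * (`|y - x| + `|z - x|) ->
  `|(By - Bx) / (y - x) - (Bz - Bx) / (z - x)| <= C * (`|y - x| + `|z - x|) ->
  `|(kink phi y * By - kink phi x * Bx) / (y - x)
    - (kink phi z * Bz - kink phi x * Bx) / (z - x)| <= 2 * C * (`|y - x| + `|z - x|).
Proof.
move=> C0 yx zx k1 side hB hb.
have s0 : 0 <= C * (`|y - x| + `|z - x|) by rewrite mulr_ge0 ?addr_ge0.
case: side => -[h1 [h2 h3]]; rewrite /kink in k1 *.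
  rewrite !max_r ?subr_le0// !mul0r !subrr !mul0r subrr normr0; lra.
rewrite !max_l ?subr_ge0// in k1 *.
have d : y - x != 0 by rewrite subr_eq0.
have d' : z - x != 0 by rewrite subr_eq0.
have -> : ((y - phi) * By - (x - phi) * Bx) / (y - x)
  - ((z - phi) * Bz - (x - phi) * Bx) / (z - x) =
  - (Bz - By) + (x - phi) * ((By - Bx) / (y - x) - (Bz - Bx) / (z - x)) by field; rewrite ?d ?d'.
apply: (le_trans (ler_normD _ _)); rewrite normrN normrM ger0_norm ?subr_ge0//.
have : (x - phi) * `|(By - Bx) / (y - x) - (Bz - Bx) / (z - x)| <=
  1 * (C * (`|y - x| + `|z - x|)) by rewrite ler_pM ?normr_ge0 ?subr_ge0.
lra.
Qed.

End kink.

(** * Orbits through a passage *)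

(** The passage for one parameter value, with constants meant to be uniform in the
    parameter.  Outside the window of half-width tau the graph is above all orbits
    considered; inside the window it moves with speed at most eps, and B has the sign
    sigma and size at least m. *)
Record kinked_passage (R : realType) (T tau eta r m M C eps sigma : R)
    (Phi dPhi : R -> R) (B b I : R -> R -> R) : Prop := KinkedPassage {
  kp_tau : 0 < tau ;
  kp_tauT : tau <= T ;
  kp_m : 0 < m ;
  kp_M : 0 <= M ;
  kp_C : 0 <= C ;
  kp_eps : 0 < eps ;
  kp_sigma : sigma = 1 \/ sigma = -1 ;
  kp_r : r <= eta ;
  kp_Phi_cont : {within `[- T, T], continuous Phi} ;
  kp_dPhi : forall t : R, - tau < t < tau ->
    is_derive t 1 Phi (dPhi t) /\ `|dPhi t| <= eps ;
  kp_far : forall t : R, - T <= t <= T -> ~~ (- tau < t < tau) -> eta < Phi t ;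
  kp_thin : forall t x : R, - tau < t < tau -> `|x| < eta -> x - Phi t <= 1 ;
  kp_B : forall t x : R, - tau < t < tau -> `|x| < eta -> m <= sigma * B t x <= M ;
  kp_b : forall t x : R, - tau < t < tau -> `|x| < eta -> is_derive x 1 (B t) (b t x) ;
  kp_b_bound : forall t x : R, - tau < t < tau -> `|x| < eta -> `|b t x| <= C ;
  kp_b_lip : forall t x y : R, - tau < t < tau -> `|x| < eta -> `|y| < eta ->
    `|b t x - b t y| <= C * `|x - y| ;
  kp_init : forall q : R, `|q| < r -> I q (- T) = q ;
  kp_cont : forall q : R, `|q| < r -> {within `[- T, T], continuous (I q)} ;
  kp_sol : forall q t : R, `|q| < r -> - T < t < T ->
    is_derive t 1 (I q) (Num.max (I q t - Phi t) 0 * B t (I q t)) ;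
  kp_small : forall q t : R, `|q| < r -> - T <= t <= T -> `|I q t| < eta
}.

Section kinked_passage.
Context {R : realType}.
Variables (T tau eta r m M C eps sigma : R).
Variables (Phi dPhi : R -> R) (B b I : R -> R -> R).
Hypothesis kp : kinked_passage T tau eta r m M C eps sigma Phi dPhi B b I.

Let F (t x : R) := kink (Phi t) x * B t x.
Let L := M + C.

Lemma T_gt0 : 0 < T. Proof. exact: lt_le_trans (kp_tau kp) (kp_tauT kp). Qed.

Lemma near_time (t : R) : - tau < t < tau -> - T < t < T.
Proof. by have := kp_tauT kp; move=> h /andP[h1 h2]; lra. Qed.

Lemma L_ge0 : 0 <= L. Proof. by rewrite addr_ge0 ?(kp_M kp) ?(kp_C kp). Qed.

Lemma kp_B_norm (t x : R) : - tau < t < tau -> `|x| < eta -> `|B t x| <= M.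
Proof.
move=> tt xe; have := kp_B kp tt xe; have := kp_m kp.
by case: (kp_sigma kp) => -> ? /andP[? ?]; rewrite ler_norml; lra.
Qed.

Lemma between_small (x y t : R) : `|x| < eta -> `|y| < eta -> x <= t <= y -> `|t| < eta.
Proof. by rewrite !ltr_norml => /andP[? ?] /andP[? ?] /andP[? ?]; lra. Qed.

Lemma B_mvt_lt (t x y : R) : - tau < t < tau -> `|x| < eta -> `|y| < eta -> x < y ->
  exists2 xi, x < xi < y & B t y - B t x = b t xi * (y - x).
Proof.
move=> tt xe ye xy; apply: mean_value => //.
- move=> z /andP[h1 h2]; apply: (kp_b kp) => //.
  by apply: between_small xe ye _; rewrite !ltW.
- apply: (@is_derive_within _ _ (b t)) => z /=; rewrite in_itv /= => zz.
  by apply: (kp_b kp) => //; exact: between_small zz.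
Qed.

Lemma B_mvt (t x y : R) : - tau < t < tau -> `|x| < eta -> `|y| < eta -> y != x ->
  exists xi, [/\ `|xi| < eta, `|xi - x| <= `|y - x| & (B t y - B t x) / (y - x) = b t xi].
Proof.
move=> tt xe ye yx; have [xy|yx'|e] := ltgtP x y; last by rewrite e eqxx in yx.
  have [xi /andP[h1 h2] e] := B_mvt_lt tt xe ye xy.
  exists xi; split; first by apply: between_small xe ye _; rewrite !ltW.
    by rewrite !ger0_norm; lra.
  by rewrite e mulfK// subr_eq0.
have [xi /andP[h1 h2] e] := B_mvt_lt tt ye xe yx'.
exists xi; split; first by apply: between_small ye xe _; rewrite !ltW.
  by rewrite !ler0_norm; lra.
have -> : B t y - B t x = b t xi * (y - x) by lra.
by rewrite mulfK// subr_eq0.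
Qed.

Lemma B_lip (t x y : R) : - tau < t < tau -> `|x| < eta -> `|y| < eta ->
  `|B t y - B t x| <= C * `|y - x|.
Proof.
move=> tt xe ye; have [->|yx] := eqVneq y x; first by rewrite !subrr normr0 mulr0.
have [xi [h1 h2 e]] := B_mvt tt xe ye yx.
have -> : B t y - B t x = b t xi * (y - x) by rewrite -e divfK// subr_eq0.
by rewrite normrM ler_wpM2r// (kp_b_bound kp).
Qed.

Lemma B_slope_lip (t x y z : R) : - tau < t < tau -> `|x| < eta -> `|y| < eta -> `|z| < eta ->
  y != x -> z != x ->
  `|(B t y - B t x) / (y - x) - (B t z - B t x) / (z - x)| <= C * (`|y - x| + `|z - x|).
Proof.
move=> tt xe ye ze yx zx.
have [xi [h1 h2 ->]] := B_mvt tt xe ye yx.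
have [zeta [k1 k2 ->]] := B_mvt tt xe ze zx.
apply: (le_trans (kp_b_lip kp tt h1 k1)).
rewrite ler_wpM2l ?(kp_C kp)//.
have -> : xi - zeta = (xi - x) - (zeta - x) by ring.
by apply: (le_trans (ler_normB _ _)); rewrite lerD.
Qed.

Lemma kink_le1 (t x : R) : - tau < t < tau -> `|x| < eta -> kink (Phi t) x <= 1.
Proof. by move=> tt xe; rewrite ge_max ler01 (kp_thin kp). Qed.

Lemma kink_far (t x : R) : - T <= t <= T -> ~~ (- tau < t < tau) -> `|x| < eta -> kink (Phi t) x = 0.
Proof.
move=> tT tt xe; rewrite /kink max_r// subr_le0 ltW//.
by apply: lt_trans (kp_far kp tT tt); move: xe; rewrite ltr_norml => /andP[].
Qed.

Lemma F_far (t x : R) : - T <= t <= T -> ~~ (- tau < t < tau) -> `|x| < eta -> F t x = 0.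
Proof. by move=> *; rewrite /F kink_far ?mul0r. Qed.

Lemma F_lip (t x y : R) : - tau < t < tau -> `|x| < eta -> `|y| < eta ->
  `|F t y - F t x| <= L * `|y - x|.
Proof.
move=> tt xe ye; apply: kink_product_lip; rewrite ?(kp_M kp) ?kink_le1 ?kp_B_norm//.
exact: B_lip.
Qed.

(** The function h can only vary inside the window, which has length 2 tau. *)
Lemma short_change (h dh : R -> R) (A t : R) : 0 <= A ->
  {within `[- T, T], continuous h} ->
  (forall t, - T < t < T -> is_derive t 1 h (dh t)) ->
  (forall t, - tau < t < tau -> `|dh t| <= A) ->
  (forall t, - T < t < T -> ~~ (- tau < t < tau) -> dh t = 0) ->
  - T <= t <= T -> `|h t - h (- T)| <= 2 * tau * A.
Proof.
move=> A0 ch hdh hA h0 /andP[t1 t2].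
have tauT := kp_tauT kp; have tau0 := kp_tau kp.
pose s1 := Num.min t (- tau); pose s2 := Num.min t tau.
have s1T : - T <= s1 by rewrite le_min t1 /= lerN2.
have s12 : s1 <= s2 by rewrite /s1 /s2 le_min ge_min lexx ge_min; apply/orP; right; lra.
have s2t : s2 <= t by rewrite ge_min lexx.
have s1l : s1 <= - tau by rewrite ge_min lexx orbT.
have s2l : s2 <= tau by rewrite ge_min lexx orbT.
have s2d : s2 - s1 <= 2 * tau.
  by rewrite /s1 /s2; case: (leP t tau); case: (leP t (- tau)) => *; lra.
have e1 : `|h s1 - h (- T)| <= 0 * (s1 - - T).
  apply: (@derive_lip _ _ dh) => //.
  - by apply: within_itvS ch; lra.
  - by move=> x /andP[x1 x2]; apply: hdh; lra.
  - by move=> x /andP[x1 x2]; rewrite h0 ?normr0//; lra.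
have e2 : `|h s2 - h s1| <= A * (s2 - s1).
  apply: (@derive_lip _ _ dh) => //.
  - by apply: within_itvS ch; lra.
  - by move=> x /andP[x1 x2]; apply: hdh; lra.
  - move=> x /andP[x1 x2]; have [/hA//|xn] := boolP (- tau < x < tau).
    by rewrite h0 ?normr0//; lra.
have e3 : `|h t - h s2| <= 0 * (t - s2).
  apply: (@derive_lip _ _ dh) => //.
  - by apply: within_itvS ch; lra.
  - by move=> x /andP[x1 x2]; apply: hdh; lra.
  - move=> x /andP[x1 x2]; rewrite h0 ?normr0//; first lra.
    by move: x1; rewrite /s2; case: (leP t tau) => *; lra.
have -> : h t - h (- T) = (h s1 - h (- T)) + (h s2 - h s1) + (h t - h s2) by ring.
apply: (le_trans (ler_normD _ _)).
have := ler_normD (h s1 - h (- T)) (h s2 - h s1).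
have := ler_wpM2l A0 s2d; lra.
Qed.

Section pair.
Variables (q1 q2 : R).
Hypotheses (q1r : `|q1| < r) (q2r : `|q2| < r) (q12 : q1 < q2).

Let w (t : R) := I q2 t - I q1 t.
Let dw (t : R) := F t (I q2 t) - F t (I q1 t).

Lemma gap_derive (t : R) : - T < t < T -> is_derive t 1 w (dw t).
Proof.
move=> tT; have h1 := kp_sol kp q1r tT; have h2 := kp_sol kp q2r tT.
exact: is_deriveB.
Qed.

Lemma gap_cont : {within `[- T, T], continuous w}.
Proof. by apply: within_sub; apply: (kp_cont kp). Qed.

Lemma gap_bound (t : R) : - T < t < T -> `|dw t| <= L * `|w t|.
Proof.
move=> tT; have tT' : - T <= t <= T by case/andP: tT => ? ?; rewrite !ltW.
have s1 := kp_small kp q1r tT'; have s2 := kp_small kp q2r tT'.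
have [tt|tt] := boolP (- tau < t < tau); first exact: F_lip.
by rewrite /dw !F_far// subrr normr0 mulr_ge0 ?L_ge0.
Qed.

Lemma gap_far (t : R) : - T < t < T -> ~~ (- tau < t < tau) -> dw t = 0.
Proof.
move=> tT tt; have tT' : - T <= t <= T by case/andP: tT => ? ?; rewrite !ltW.
have s1 := kp_small kp q1r tT'; have s2 := kp_small kp q2r tT'.
by rewrite /dw !F_far// subrr.
Qed.

Lemma gap_init : w (- T) = q2 - q1.
Proof. by rewrite /w !(kp_init kp). Qed.

(** By the lower Gronwall bound the gap never vanishes, and it starts positive. *)
Lemma gap_gt0 (t : R) : - T <= t <= T -> 0 < w t.
Proof.
move=> /andP[t1 t2].
have nz s : - T <= s <= T -> w s != 0.
  move=> /andP[s1 s2].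
  have cw : {within `[- T, s], continuous w} by apply: within_itvS gap_cont.
  have dwP x : - T < x < s -> is_derive x 1 w (dw x).
    by move=> /andP[x1 x2]; apply: gap_derive; rewrite x1 (lt_le_trans x2).
  have wb x : - T < x < s -> `|dw x| <= L * `|w x|.
    by move=> /andP[x1 x2]; apply: gap_bound; rewrite x1 (lt_le_trans x2).
  have [h _] := gronwall_sqr s1 cw dwP wb.
  apply/eqP => e; move: h; rewrite e expr0n /= gap_init leNgt => /negP; apply.
  by rewrite mulr_gt0 ?expR_gt0// exprn_gt0// subr_gt0.
have [//|wt|e] := ltgtP 0 (w t); last by have := nz t; rewrite -e eqxx t1 t2 => /(_ isT).
have cw : {within `[- T, t], continuous w} by apply: within_itvS gap_cont.
have w0 : 0 < w (- T) by rewrite gap_init subr_gt0.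
have [s [/andP[h1 h2] h3 _]] := first_hit t1 cw w0 (ltW wt).
have : w s != 0 by apply: nz; rewrite (ltW h1) (le_trans h2).
by rewrite h3 eqxx.
Qed.

(** Logarithms turn the comparison of gaps between three orbits into a comparison
    of slopes of the right-hand side, without any derivative of the solution in its
    initial value. *)
Lemma log_gap_derive (t : R) : - T < t < T ->
  is_derive t 1 (fun t => ln (w t)) (dw t / w t).
Proof.
move=> tT; have h1 := gap_derive tT.
have w0 : 0 < w t by apply: gap_gt0; case/andP: tT => ? ?; rewrite !ltW.
have := @is_derive1_comp _ (@ln R) w t _ _ (is_derive1_ln w0) h1.
by move=> /(@is_derive_eq _ _ _ _ _ _ _ _); apply; rewrite mulrC.
Qed.

Lemma log_gap_cont : {within `[- T, T], continuous (fun t => ln (w t))}.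
Proof.
apply: within_comp; first exact: gap_cont.
by move=> t /=; rewrite in_itv /= => /gap_gt0; exact: continuous_ln.
Qed.

Lemma log_gap_bound (t : R) : - tau < t < tau -> `|dw t / w t| <= L.
Proof.
move=> /near_time tT.
have w0 : 0 < w t by apply: gap_gt0; case/andP: tT => ? ?; rewrite !ltW.
by rewrite normrM normfV ler_pdivrMr ?normr_gt0 ?gt_eqF// gap_bound.
Qed.

Lemma log_gap_far (t : R) : - T < t < T -> ~~ (- tau < t < tau) -> dw t / w t = 0.
Proof. by move=> tT tt; rewrite gap_far// mul0r. Qed.

Lemma log_gap (t : R) : - T <= t <= T -> `|ln (w t) - ln (w (- T))| <= 2 * tau * L.
Proof.
apply: (short_change L_ge0 log_gap_cont log_gap_derive log_gap_bound).
exact: log_gap_far.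
Qed.

Lemma gap_ratio (t : R) : - T <= t <= T ->
  w t <= expR (2 * tau * L) * (q2 - q1) /\ q2 - q1 <= expR (2 * tau * L) * w t.
Proof.
move=> tT; have := log_gap tT; rewrite gap_init.
have w0 := gap_gt0 tT; have q0 : 0 < q2 - q1 by rewrite subr_gt0.
rewrite ler_norml => /andP[h1 h2]; have e0 := expR_gt0 (2 * tau * L).
by split; rewrite -ler_ln ?posrE ?mulr_gt0// lnM ?posrE// expRK; lra.
Qed.
End pair.

(** As long as the graph is above q, the kink at an orbit is at most its distance to
    q, and Gronwall's estimate for this distance starts from zero. *)
Lemma rests_below (q s : R) : `|q| < r -> - T <= s <= T ->
  (forall t : R, - T <= t <= s -> q <= Phi t) -> forall t : R, - T <= t <= s -> I q t = q.
Proof.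
move=> qr /andP[s1 s2] hq t /andP[t1 t2].
have cf : {within `[- T, t], continuous (fun t => I q t - q)}.
  apply: within_sub; last by apply: continuous_subspaceT; exact: cst_continuous.
  by apply: within_itvS (kp_cont kp qr); rewrite ?(le_trans t2).
have df (x : R) : - T < x < t -> is_derive x 1 (fun t => I q t - q) (F x (I q x)).
  move=> /andP[x1 x2]; have xT : - T < x < T by rewrite x1 (lt_le_trans x2 (le_trans t2 s2)).
  have h := kp_sol kp qr xT; apply: is_derive_eq; exact: subr0.
have bf (x : R) : - T < x < t -> `|F x (I q x)| <= M * `|I q x - q|.
  move=> /andP[x1 x2]; have xT : - T <= x <= T.
    by rewrite ltW// ltW// (lt_le_trans x2 (le_trans t2 s2)).
  have sx := kp_small kp qr xT.
  have [tt|tt] := boolP (- tau < x < tau); last by rewrite F_far// normr0 mulr_ge0 ?(kp_M kp).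
  rewrite /F normrM (ger0_norm (kink_ge0 _ _)) mulrC ler_pM ?kink_ge0 ?kp_B_norm//.
  have hx : q <= Phi x by apply: hq; rewrite ltW//= ltW// (lt_le_trans x2).
  rewrite /kink ge_max normr_ge0 andbT (le_trans _ (ler_norm _))//; lra.
have [_] := gronwall_sqr t1 cf df bf.
rewrite (kp_init kp)// subrr expr0n /= mul0r => h.
by apply/eqP; rewrite -subr_eq0 -sqrf_eq0 eq_le h sqr_ge0.
Qed.

Lemma inactive_exit (q : R) : `|q| < r ->
  (forall t : R, - T <= t <= T -> q <= Phi t) -> I q T = q.
Proof.
move=> qr h; have T0 := T_gt0.
by apply: (rests_below qr _ h); rewrite lexx andbT; lra.
Qed.

Lemma drift_ge0 (q t : R) : `|q| < r -> - T < t < T -> 0 <= sigma * F t (I q t).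
Proof.
move=> qr tT; have tT' : - T <= t <= T by case/andP: tT => ? ?; rewrite !ltW.
have sx := kp_small kp qr tT'.
have [tt|tt] := boolP (- tau < t < tau); last by rewrite F_far// mulr0.
rewrite /F mulrCA mulr_ge0 ?kink_ge0//.
by have /andP[h _] := kp_B kp tt sx; rewrite (le_trans (ltW (kp_m kp))).
Qed.

Lemma drift_mono (q a c : R) : `|q| < r -> - T <= a -> a <= c -> c <= T ->
  sigma * I q a <= sigma * I q c.
Proof.
move=> qr Ta ac cT.
apply: (@derive_ge0_le _ (fun t => sigma * I q t) (fun t => sigma * F t (I q t))) => //.
- move=> t /andP[t1 t2]; have tT : - T < t < T by rewrite (le_lt_trans Ta) ?(lt_le_trans t2).
  by have h := kp_sol kp qr tT; apply: is_derive_eq.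
- by move=> t /andP[t1 t2]; apply: drift_ge0; rewrite // (le_lt_trans Ta) ?(lt_le_trans t2).
- apply: within_mul; first by apply: continuous_subspaceT; exact: cst_continuous.
  exact: within_itvS (kp_cont kp qr).
Qed.

Lemma contact_window (t0 q : R) : `|q| < r -> - T <= t0 <= T -> Phi t0 <= q -> - tau < t0 < tau.
Proof.
move=> qr tT h; apply/negPn/negP => /(kp_far kp tT); apply/negP; rewrite -leNgt (le_trans h)//.
by rewrite (le_trans _ (kp_r kp))// (le_trans (ler_norm _))// ltW.
Qed.

(** The drift is monotone, so an orbit that comes back to its initial height has
    been at rest all the time; but at time t0 its speed is nonzero. *)
Lemma active_exit (q t0 : R) : `|q| < r -> - T <= t0 <= T -> Phi t0 < q ->
  0 < sigma * (I q T - q).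
Proof.
move=> qr tT lt0; have tt := contact_window qr tT (ltW lt0).
have T0 := T_gt0; have iT := kp_init kp qr.
have s2 : sigma * sigma = 1 by case: (kp_sigma kp) => ->; ring.
rewrite ltNge; apply/negP; rewrite mulrBr subr_le0 => le0.
have cst (t : R) : - T <= t <= T -> I q t = q.
  move=> /andP[t1 t2].
  have h1 := drift_mono qr (lexx _) t1 t2; have h2 := drift_mono qr t1 t2 (lexx _).
  have : sigma * I q t = sigma * q by apply/eqP; rewrite eq_le (le_trans h2 le0) -{1}iT h1.
  by move=> /(congr1 (fun z => sigma * z)); rewrite !mulrA s2 !mul1r.
have tT' := near_time tt.
have d1 := kp_sol kp qr tT'; rewrite cst// in d1.
have d2 : is_derive t0 1 (I q) 0.
  apply: (@near_eq_is_derive _ _ _ (fun=> q)).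
  have : t0 \in `](- T), T[ by rewrite in_itv.
  move=> /near_in_itvoo; apply: filterS => t; rewrite in_itv /= => /andP[h1 h2].
  by rewrite cst// !ltW.
have := @derive_val _ _ _ _ _ _ _ d1; rewrite (@derive_val _ _ _ _ _ _ _ d2) => /esym e.
have qe : `|q| < eta by rewrite (lt_le_trans qr) ?(kp_r kp).
have /andP[mB _] := kp_B kp tt qe.
have k0 : 0 < kink (Phi t0) q by rewrite lt_max subr_gt0 lt0.
have : 0 < kink (Phi t0) q * (sigma * B t0 q) by rewrite mulr_gt0// (lt_le_trans (kp_m kp)).
by rewrite mulrCA [X in sigma * X]e mulr0 ltxx.
Qed.

End kinked_passage.

(** * Logarithmic convexity of the exit map *)

Section convexity.
Context {R : realType}.
Variables (T tau eta r m M C eps sigma : R).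
Variables (Phi dPhi : R -> R) (B b I : R -> R -> R).
Hypothesis kp : kinked_passage T tau eta r m M C eps sigma Phi dPhi B b I.

Let F (t x : R) := kink (Phi t) x * B t x.
Hypothesis ratio2 : expR (2 * tau * (M + C)) <= 2.

Section triple.
Variables (q1 q2 q3 : R).
Hypotheses (q1r : `|q1| < r) (q2r : `|q2| < r) (q3r : `|q3| < r).
Hypotheses (q12 : q1 < q2) (q23 : q2 < q3).

(** The function v is the signed logarithm of the ratio of the gaps w23 and w12; its
    linear term c0 t dominates the errors of the slope comparison and makes v
    nondecreasing.  The source of growth is kap, the difference of consecutive kink
    slopes. *)
Let w12 (t : R) := I q2 t - I q1 t.
Let w23 (t : R) := I q3 t - I q2 t.
Let c0 := 4 * C * (q3 - q1).
Let v (t : R) := sigma * (ln (w23 t) - ln (w12 t)) + c0 * t.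
Let dv (t : R) := sigma * ((F t (I q3 t) - F t (I q2 t)) / w23 t
                          - (F t (I q2 t) - F t (I q1 t)) / w12 t) + c0.
Let kap (t : R) := (kink (Phi t) (I q3 t) - kink (Phi t) (I q2 t)) / w23 t
                 - (kink (Phi t) (I q2 t) - kink (Phi t) (I q1 t)) / w12 t.

Let T0 := T_gt0 kp.

Lemma v_derive (t : R) : - T < t < T -> is_derive t 1 v (dv t).
Proof.
move=> tT; have h1 := log_gap_derive kp q1r q2r q12 tT.
have h2 := log_gap_derive kp q2r q3r q23 tT.
apply: is_derive_eq; rewrite /dv /F /GRing.scale /=; ring.
Qed.

Lemma v_cont : {within `[- T, T], continuous v}.
Proof.
have cc (k : R) : {within `[- T, T], continuous (fun=> k)}.
  by apply: continuous_subspaceT; exact: cst_continuous.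
apply: within_add; apply: within_mul => //.
- by apply: within_sub; [exact: (log_gap_cont kp q2r q3r)|exact: (log_gap_cont kp q1r q2r)].
- by apply: continuous_subspaceT => ? //; exact: cvg_id.
Qed.

Lemma c0_ge0 : 0 <= c0.
Proof.
have C0 := kp_C kp; have d : 0 <= q3 - q1 by have := q12; have := q23; lra.
by rewrite /c0 -mulrA mulr_ge0 ?mulr_ge0.
Qed.

Lemma gap_bounds (t : R) : - T <= t <= T ->
  [/\ 0 < w12 t, 0 < w23 t, w12 t <= 2 * (q2 - q1), w23 t <= 2 * (q3 - q2) &
      q2 - q1 <= 2 * w12 t /\ q3 - q2 <= 2 * w23 t].
Proof.
move=> tT; have a12 := gap_gt0 kp q1r q2r q12 tT; have a23 := gap_gt0 kp q2r q3r q23 tT.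
have [b12 c12] := gap_ratio kp q1r q2r q12 tT.
have [b23 c23] := gap_ratio kp q2r q3r q23 tT.
have d12 : 0 <= q2 - q1 by rewrite subr_ge0 ltW.
have d23 : 0 <= q3 - q2 by rewrite subr_ge0 ltW.
split => //.
- by rewrite (le_trans b12)// ler_wpM2r.
- by rewrite (le_trans b23)// ler_wpM2r.
- by split; [rewrite (le_trans c12)// ler_wpM2r// ltW|rewrite (le_trans c23)// ler_wpM2r// ltW].
Qed.

Lemma dv_near (t : R) : - tau < t < tau -> 0 <= kap t /\ m * kap t <= dv t.
Proof.
move=> tt; have tT := near_time kp tt.
have tT' : - T <= t <= T by case/andP: tT => ? ?; rewrite !ltW.
have [a12 a23 b12 b23 _] := gap_bounds tT'.
have s1 := kp_small kp q1r tT'; have s2 := kp_small kp q2r tT'; have s3 := kp_small kp q3r tT'.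
have i12 : I q1 t < I q2 t by rewrite -subr_gt0.
have i23 : I q2 t < I q3 t by rewrite -subr_gt0.
have C0 := kp_C kp.
split; first by rewrite subr_ge0 kink_convex.
have gn := @slope_gain _ (Phi t) (I q1 t) (I q2 t) (I q3 t) m C sigma (B t (I q1 t))
  (B t (I q2 t)) (B t (I q3 t)) (kp_sigma kp) (ltW (kp_m kp)) C0 i12 i23
  (kink_le1 kp tt s2).
have {}gn := gn (proj1 (andP (kp_B kp tt s1))).
have e31 : `|I q3 t - I q1 t| = I q3 t - I q1 t.
  by rewrite ger0_norm// subr_ge0 ltW// (lt_trans i12).
have h1 := B_lip kp tt s1 s3; rewrite e31 in h1.
have n32 : I q3 t != I q2 t by rewrite gt_eqF.
have n12 : I q1 t != I q2 t by rewrite lt_eqF.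
have h2 := B_slope_lip kp tt s2 s3 s1 n32 n12.
have e321 : `|I q3 t - I q2 t| + `|I q1 t - I q2 t| = I q3 t - I q1 t.
  by rewrite ger0_norm ?ltr0_norm ?subr_lt0 ?subr_ge0 ?ltW//; ring.
rewrite e321 in h2.
have es : (B t (I q1 t) - B t (I q2 t)) / (I q1 t - I q2 t) =
    (B t (I q2 t) - B t (I q1 t)) / (I q2 t - I q1 t).
  by rewrite -opprB -[I q1 t - _]opprB invrN mulrNN.
rewrite es in h2.
have {}gn := gn h1 h2.
have le31 : C * (I q3 t - I q1 t) <= C * (2 * (q3 - q1)).
  by rewrite ler_wpM2l//; move: b12 b23; rewrite /w12 /w23; lra.
rewrite /dv /c0 /F; rewrite -/(w23 t) -/(w12 t) in gn; rewrite /kap; lra.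
Qed.

Lemma dv_ge0 (t : R) : - T < t < T -> 0 <= dv t.
Proof.
move=> tT; have [tt|tt] := boolP (- tau < t < tau).
  have [k0] := dv_near tt; apply: le_trans; rewrite mulr_ge0// ltW//; exact: kp_m kp.
rewrite /dv (log_gap_far kp q1r q2r tT tt) (log_gap_far kp q2r q3r tT tt).
by rewrite subrr mulr0 add0r c0_ge0.
Qed.

Lemma v_mono (a c : R) : - T <= a -> a <= c -> c <= T -> v a <= v c.
Proof.
move=> Ta ac cT; apply: (@derive_ge0_le _ v dv) => //.
- by move=> t /andP[t1 t2]; apply: v_derive; rewrite (le_lt_trans Ta) ?(lt_le_trans t2).
- by move=> t /andP[t1 t2]; apply: dv_ge0; rewrite (le_lt_trans Ta) ?(lt_le_trans t2).
- exact: within_itvS v_cont.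
Qed.

(** Trading height for time.  If kap is at least |Phi - p| / (2 h) while the graph
    moves with speed at most eps, then v grows at least by the decrease of
    e0 (Phi - p)^2 times m / (4 h eps); the sign e0 tells whether the graph is above
    or below the reference height p. *)
Lemma slow_descent (e0 s' s p h : R) : e0 = 1 \/ e0 = - 1 -> 0 < h ->
  - T <= s' -> s' < s -> s <= T ->
  (forall t : R, s' < t < s -> - tau < t < tau) ->
  (forall t : R, s' < t < s -> 0 <= e0 * (Phi t - p) /\ e0 * (Phi t - p) <= 2 * h * kap t) ->
  v s' + e0 * m / (4 * h * eps) * (Phi s' - p) ^+ 2 <=
  v s + e0 * m / (4 * h * eps) * (Phi s - p) ^+ 2.
Proof.
move=> he h0 Ts' ss sT near bnd.
pose k := e0 * m / (4 * h * eps).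
have eps0 := kp_eps kp.
have k4 : 4 * h * eps != 0 by rewrite !mulf_neq0 ?gt_eqF.
apply: (@derive_ge0_le _ (fun t => v t + k * (Phi t - p) ^+ 2)
   (fun t => dv t + k * (2 * (Phi t - p) * dPhi t))); first exact: ltW.
- move=> t tt; have [h1 _] := kp_dPhi kp (near t tt).
  have tT : - T < t < T by case/andP: tt => ? ?; rewrite (le_lt_trans Ts') ?(lt_le_trans _ sT).
  have h2 := v_derive tT; apply: is_derive_eq; rewrite /GRing.scale /=; ring.
- move=> t tt; have [_ h1] := kp_dPhi kp (near t tt).
  have [b1 b2] := bnd t tt.
  have [k0 k1] := dv_near (near t tt).
  apply: le_trans (_ : m * kap t + k * (2 * (Phi t - p) * dPhi t) <= _); last by rewrite lerD2r.
  have -> : m * kap t + k * (2 * (Phi t - p) * dPhi t) =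
     m / (2 * h * eps) * (2 * h * kap t * eps + e0 * (Phi t - p) * dPhi t).
    by rewrite /k; field; rewrite !gt_eqF.
  have a2 : e0 * (Phi t - p) * - dPhi t <= e0 * (Phi t - p) * eps.
    by rewrite ler_wpM2l// (le_trans (ler_norm _))// normrN.
  apply: mulr_ge0; first by rewrite divr_ge0 ?ltW ?(kp_m kp)// !mulr_gt0.
  by rewrite -[X in _ + X]opprK -mulrN subr_ge0 (le_trans a2)// ler_wpM2r// ltW.
- apply: within_add; first exact: within_itvS v_cont.
  have cc (z : R) : {within `[s', s], continuous (fun=> z)}.
    by apply: continuous_subspaceT; exact: cst_continuous.
  apply: within_mul => //.
  have cP : {within `[s', s], continuous (fun t => Phi t - p)}.
    by apply: within_sub => //; apply: within_itvS (kp_Phi_cont kp).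
  exact: within_mul.
Qed.

(** The graph descends from above q3 to a height at most q1.  On its way from the midpoint p23
    of q2 and q3 to q2, the first two orbits still rest and kap is at least
    proportional to p23 - Phi.  On its way from the midpoint p12 of q1 and q2 to q1,
    the first orbit rests, the other two are active, and kap is at least
    proportional to Phi - q1.  The two descents contribute multiples of q3 - q2 and
    of q2 - q1, with the same factor m / (16 eps). *)
Lemma convex_gain (t0 : R) : - T <= t0 <= T -> Phi t0 <= q1 ->
  m / (16 * eps) * (q3 - q1) <= v T - v (- T).
Proof.
move=> /andP[t1 t2] lt0.
have TT : - T <= T by rewrite ge0_cp// ltW.
have [m0 eps0] := (kp_m kp, kp_eps kp).
have [q12' q23'] := (q12, q23).
have farT : ~~ (- tau < - T < tau).
  by have := kp_tauT kp => h; apply/negP => /andP[h1 _]; lra.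
have PT : q3 < Phi (- T).
  apply: lt_trans (kp_far kp _ farT); last by rewrite lexx.
  by rewrite (lt_le_trans _ (kp_r kp))// (le_lt_trans (ler_norm _)).
have cP : {within `[- T, t0], continuous Phi} by apply: within_itvS (kp_Phi_cont kp).
pose p23 := q2 + (q3 - q2) / 2; pose p12 := q1 + (q2 - q1) / 2.
have [u' [u [[u1 u2 u3 u4 u5] [u6 u7]]]] : exists s' s, [/\ - T <= s', s' < s, s <= t0, Phi s' = p23 & Phi s = q2] /\
    (forall t, - T <= t < s -> q2 < Phi t) /\ (forall t, s' < t <= s -> Phi t < p23).
  by apply: descent => //; rewrite /p23; lra.
have cP' : {within `[u, t0], continuous Phi} by apply: within_itvS cP => //; lra.
have [s' [s [[s1 s2 s3 s4 s5] [s6 s7]]]] : exists s' s, [/\ u <= s', s' < s, s <= t0, Phi s' = p12 & Phi s = q1] /\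
    (forall t, u <= t < s -> q1 < Phi t) /\ (forall t, s' < t <= s -> Phi t < p12).
  by apply: descent => //; rewrite /p12 ?u5; lra.
have T_u (t : R) : - T <= t <= u -> I q2 t = q2.
  move=> tu; apply: (rests_below kp q2r _ _ tu); first by lra.
  move=> x /andP[x1]; rewrite le_eqVlt => /orP[/eqP->|x2]; first by rewrite u5.
  by rewrite ltW// u6// x1.
have T_s (t : R) : - T <= t <= s -> I q1 t = q1.
  move=> tu; apply: (rests_below kp q1r _ _ tu); first by lra.
  move=> x /andP[x1]; rewrite le_eqVlt => /orP[/eqP->|x2]; first by rewrite s5.
  have [xu|ux] := ltP x u; last by rewrite ltW// s6// ux.
  by rewrite ltW// (lt_trans q12')// u6// x1.
have lown (t : R) : - T <= t <= T -> Phi t <= q3 -> - tau < t < tau by apply: (contact_window kp q3r).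
have h23 : 0 < q3 - q2 by rewrite subr_gt0.
have h12 : 0 < q2 - q1 by rewrite subr_gt0.
(* First descent, below the reference height p23. *)
have g1 : v u' + (-1) * m / (4 * (q3 - q2) * eps) * (Phi u' - p23) ^+ 2 <=
          v u + (-1) * m / (4 * (q3 - q2) * eps) * (Phi u - p23) ^+ 2.
  apply: slow_descent => //; [by right|by lra| |].
    move=> t /andP[x1 x2]; apply: lown; first by lra.
    have : Phi t < p23 by apply: u7; rewrite x1 ltW.
    by rewrite /p23; lra.
  move=> t /andP[x1 x2].
  have a1 : Phi t < p23 by apply: u7; rewrite x1 ltW.
  have a2 : q2 < Phi t by apply: u6; rewrite x2 andbT; lra.
  have tT : - T <= t <= T by lra.
  have [b1 b2 b3 b4 [b5 b6]] := gap_bounds tT.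
  have e2 : I q2 t = q2 by apply: T_u; lra.
  have e1 : I q1 t = q1 by apply: T_s; lra.
  have a3 : p23 <= I q3 t by move: b6; rewrite /w23 e2 /p23; lra.
  have -> : kap t = (I q3 t - Phi t) / w23 t.
    rewrite /kap e1 e2 /kink (@max_l _ _ (I q3 t - _)); last by lra.
    rewrite (@max_r _ _ (q2 - _)); last by lra.
    by rewrite (@max_r _ _ (q1 - _)); [ring|lra].
  split; first by lra.
  rewrite mulrA ler_pdivlMr//.
  have c1 : (p23 - Phi t) * w23 t <= (I q3 t - Phi t) * (2 * (q3 - q2)) by apply: ler_pM => //; [lra|exact: ltW|lra].
  lra.
(* Second descent, above the reference height q1. *)
have g2 : v s' + 1 * m / (4 * (q2 - q1) * eps) * (Phi s' - q1) ^+ 2 <=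
          v s + 1 * m / (4 * (q2 - q1) * eps) * (Phi s - q1) ^+ 2.
  apply: slow_descent => //; [by left|by lra|by lra| |].
    move=> t /andP[x1 x2]; apply: lown; first by lra.
    have : Phi t < p12 by apply: s7; rewrite x1 ltW.
    by rewrite /p12; lra.
  move=> t /andP[x1 x2].
  have a1 : Phi t < p12 by apply: s7; rewrite x1 ltW.
  have a2 : q1 < Phi t by apply: s6; rewrite x2 andbT; lra.
  have tT : - T <= t <= T by lra.
  have [b1 b2 b3 b4 [b5 b6]] := gap_bounds tT.
  have e1 : I q1 t = q1 by apply: T_s; lra.
  have a3 : p12 <= I q2 t by move: b5; rewrite /w12 e1 /p12; lra.
  have -> : kap t = (Phi t - q1) / w12 t.
    have n1 : w12 t != 0 by rewrite gt_eqF.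
    have n2 : w23 t != 0 by rewrite gt_eqF.
    move: n1 n2 b1 b2; rewrite /kap e1 /kink /w12 /w23 e1 => n1 n2 b1 b2.
    rewrite (@max_l _ _ (I q3 t - _)); last by lra.
    rewrite (@max_l _ _ (I q2 t - _)); last by lra.
    rewrite max_r; last by lra.
    by field; rewrite n1 n2.
  split; first by lra.
  rewrite mul1r mulrA ler_pdivlMr//.
  have c1 : (Phi t - q1) * w12 t <= (Phi t - q1) * (2 * (q2 - q1)) by rewrite ler_wpM2l//; lra.
  lra.
have m1 : v (- T) <= v u' by apply: v_mono; lra.
have m2 : v u <= v s' by apply: v_mono; lra.
have m3 : v s <= v T by apply: v_mono; lra.
have f1 : 1 * m / (4 * (q2 - q1) * eps) * (p12 - q1) ^+ 2 = m / (16 * eps) * (q2 - q1).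
  by rewrite /p12; field; rewrite !gt_eqF.
have f2 : -1 * m / (4 * (q3 - q2) * eps) * (q2 - p23) ^+ 2 = - (m / (16 * eps) * (q3 - q2)).
  by rewrite /p23; field; rewrite !gt_eqF.
move: g1 g2; rewrite u4 u5 s4 s5 !subrr f1 f2 expr0n /= !mulr0 !addr0 => g1 g2.
lra.
Qed.

Lemma convex_log (t0 : R) : - T <= t0 <= T -> Phi t0 <= q1 ->
  (m / (16 * eps) - 8 * C * T) * (q3 - q1) <=
  sigma * (ln ((I q3 T - I q2 T) / (q3 - q2)) - ln ((I q2 T - I q1 T) / (q2 - q1))).
Proof.
move=> tT lt0; have := convex_gain tT lt0.
have TT : - T <= T by rewrite ge0_cp// ltW.
have TT1 : - T <= T <= T by rewrite TT lexx.
have [b1 b2 _ _ _] := gap_bounds TT1.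
have h23 : 0 < q3 - q2 by rewrite subr_gt0.
have h12 : 0 < q2 - q1 by rewrite subr_gt0.
rewrite /v /w12 /w23 !(kp_init kp)// !ln_div ?posrE//.
rewrite -/(w12 T) -/(w23 T) /c0; lra.
Qed.

End triple.
End convexity.

(** * A priori confinement *)

Section apriori.
Context {R : realType}.

(** While |x| < eta, the kink is at most |x| + del or the orbit is below the graph,
    so x^2 + del^2 grows at most at the exponential rate 4 M; a first exit from
    |x| < eta would contradict the size of the initial value. *)
Lemma apriori (T M eta del : R) (Phi : R -> R) (B : R -> R -> R) (x : R -> R) :
  0 < T -> 0 <= M -> 0 < eta -> 0 <= del ->
  {within `[- T, T], continuous x} ->
  (forall t : R, - T < t < T -> is_derive t 1 x (Num.max (x t - Phi t) 0 * B t (x t))) ->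
  (forall t : R, - T <= t <= T -> - del <= Phi t) ->
  (forall t y : R, - T <= t <= T -> `|y| < eta -> eta <= Phi t \/ `|B t y| <= M) ->
  (x (- T) ^+ 2 + del ^+ 2) * expR (8 * M * T) < eta ^+ 2 ->
  forall t : R, - T <= t <= T -> `|x t| < eta.
Proof.
move=> T0 M0 eta0 del0 cx dx hdel hB hq t /andP[t1 t2].
pose f (t : R) := eta ^+ 2 - x t ^+ 2.
have fP (s : R) : 0 < f s -> `|x s| < eta.
  by rewrite subr_gt0 -[x s ^+ 2]real_normK ?num_real// ltr_pXn2r// ?nnegrE// ltW.
have e1 : 1 <= expR (8 * M * T) by rewrite -expR0 ler_expR !mulr_ge0// ltW.
have s0 : 0 <= x (- T) ^+ 2 + del ^+ 2 by rewrite addr_ge0 ?sqr_ge0.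
have f0 : 0 < f (- T).
  rewrite /f subr_gt0 (le_lt_trans _ hq)// (@le_trans _ _ (x (- T) ^+ 2 + del ^+ 2))//.
    by rewrite lerDl sqr_ge0.
  by rewrite ler_peMr.
apply: (fP t); rewrite ltNge; apply/negP => ft.
have cx2 : {within `[- T, T], continuous (fun t => x t ^+ 2)} by exact: within_mul.
have cc (k : R) : {within `[- T, T], continuous (fun=> k)}.
  by apply: continuous_subspaceT; exact: cst_continuous.
have cf : {within `[- T, t], continuous f}.
  by apply: within_itvS (within_sub (cc _) cx2).
have [s [/andP[h1 h2] h3 h4]] := first_hit t1 cf f0 ft.
have : x s ^+ 2 + del ^+ 2 <= (x (- T) ^+ 2 + del ^+ 2) * expR (4 * M * (s - - T)).
  apply: (@gronwall_le _ (fun t => x t ^+ 2 + del ^+ 2)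
    (fun t => 2 * x t * (Num.max (x t - Phi t) 0 * B t (x t)))); first exact: ltW.
  - by apply: within_itvS (within_add cx2 (cc _)) => //; exact: le_trans t2.
  - move=> y /andP[y1 y2]; have yT : - T < y < T by rewrite y1 (lt_le_trans y2)// (le_trans h2).
    have h := dx y yT; apply: is_derive_eq; rewrite /GRing.scale /=; ring.
  - move=> y /andP[y1 y2].
    have yT : - T <= y <= T by rewrite ltW// ltW// (lt_le_trans y2)// (le_trans h2).
    have xy : `|x y| < eta by apply/fP/h4; rewrite ltW.
    set k := Num.max _ _; have k0 : 0 <= k by rewrite /k le_max lexx orbT.
    have g0 : 0 <= 4 * M * (x y ^+ 2 + del ^+ 2) by rewrite !mulr_ge0// addr_ge0 ?sqr_ge0.
    have [hP|hb] := hB y _ yT xy.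
      have -> : k = 0 by rewrite /k max_r// subr_le0 (le_trans _ hP)// (le_trans (ler_norm _))// ltW.
      by rewrite mul0r mulr0.
    have kle : k <= `|x y| + del.
      rewrite /k ge_max addr_ge0// andbT lerD// ?ler_norm//.
      by have := hdel y yT; lra.
    apply: le_trans (ler_norm _) _; rewrite !normrM (ger0_norm k0) ger0_norm//.
    rewrite -[x y ^+ 2]real_normK ?num_real//.
    set a := `|x y| in kle *; have a0 : 0 <= a by rewrite normr_ge0.
    have : k * `|B y (x y)| <= (a + del) * M by rewrite ler_pM.
    move=> /(ler_wpM2l a0) l1.
    have l2 : a * ((a + del) * M) <= 2 * M * (a ^+ 2 + del ^+ 2).
      have := mulr_ge0 M0 (sqr_ge0 (a - del)); have := mulr_ge0 M0 (sqr_ge0 a).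
      have := mulr_ge0 M0 (sqr_ge0 del); nra.
    lra.
have -> : x s ^+ 2 = eta ^+ 2 by move: h3; rewrite /f; lra.
move=> h5; have : eta ^+ 2 < eta ^+ 2; last by rewrite ltxx.
apply: le_lt_trans hq; apply: le_trans (_ : eta ^+ 2 + del ^+ 2 <= _).
  by rewrite lerDl sqr_ge0.
apply: (le_trans h5); rewrite ler_wpM2l// ler_expR.
have := ler_wpM2l M0 (_ : s <= T); rewrite (le_trans h2 t2) => /(_ isT); lra.
Qed.
End apriori.

(** * Differentiability of the exit map *)

Lemma near_punctured (R : realType) (d : R) : 0 < d ->
  \forall h \near (0 : R)^', `|h| < d /\ h != 0.
Proof.
move=> d0; rewrite near_withinE; have := @nbhsx_ballx _ R 0 _ d0.
by apply: filterS => x; rewrite /ball /= sub0r normrN.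
Qed.

Section end_derivable.
Context {R : realType}.
Variables (T tau eta r m M C eps sigma : R).
Variables (Phi dPhi : R -> R) (B b I : R -> R -> R).
Hypothesis kp : kinked_passage T tau eta r m M C eps sigma Phi dPhi B b I.
Hypothesis ratio2 : expR (2 * tau * (M + C)) <= 2.
Let F (t x : R) := kink (Phi t) x * B t x.
Let L := M + C.

Variable q : R.
Hypothesis qr : `|q| < r.
Let rho (p t : R) := (I p t - I q t) / (p - q).
Let drho (p t : R) := (F t (I p t) - F t (I q t)) / (I p t - I q t).

Lemma rho_facts (p t : R) : `|p| < r -> p != q -> - T <= t <= T ->
  [/\ 0 < rho p t, I p t != I q t & `|I p t - I q t| <= 2 * `|p - q|].
Proof.
move=> pr pq tT.
have [h|h|e] := ltgtP p q; last by rewrite e eqxx in pq.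
- have g0 := gap_gt0 kp pr qr h tT; have [g1 _] := gap_ratio kp pr qr h tT.
  split.
  + by rewrite /rho -mulrNN -invrN !opprB divr_gt0// subr_gt0.
  + by rewrite lt_eqF// -subr_gt0.
  + have -> : `|I p t - I q t| = I q t - I p t by rewrite distrC gtr0_norm.
    have -> : `|p - q| = q - p by rewrite distrC gtr0_norm// subr_gt0.
    by rewrite (le_trans g1)// ler_wpM2r// subr_ge0 ltW.
- have g0 := gap_gt0 kp qr pr h tT; have [g1 _] := gap_ratio kp qr pr h tT.
  split.
  + by rewrite /rho divr_gt0// subr_gt0.
  + by rewrite gt_eqF// -subr_gt0.
  + have -> : `|I p t - I q t| = I p t - I q t by rewrite gtr0_norm.
    have -> : `|p - q| = p - q by rewrite gtr0_norm// subr_gt0.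
    by rewrite (le_trans g1)// ler_wpM2r// subr_ge0 ltW.
Qed.

Lemma rho_derive (p t : R) : `|p| < r -> p != q -> - T < t < T ->
  is_derive t 1 (fun t => ln (rho p t)) (drho p t).
Proof.
move=> pr pq tT; have tT' : - T <= t <= T by case/andP: tT => ? ?; rewrite !ltW.
have [r0 ne _] := rho_facts pr pq tT'.
have h1 := kp_sol kp pr tT; have h2 := kp_sol kp qr tT.
have h3 : is_derive t 1 (rho p) ((F t (I p t) - F t (I q t)) / (p - q)).
  by apply: is_derive_eq; rewrite /GRing.scale /= /F /kink; field; rewrite subr_eq0.
have := @is_derive1_comp _ (@ln R) (rho p) t _ _ (is_derive1_ln r0) h3.
move=> /(@is_derive_eq _ _ _ _ _ _ _ _); apply.
by rewrite /rho /drho; field; rewrite !subr_eq0 ne pq.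
Qed.

Lemma rho_cont (p : R) : `|p| < r -> p != q ->
  {within `[- T, T], continuous (fun t => ln (rho p t))}.
Proof.
move=> pr pq; apply: within_comp; last first.
  by move=> t /=; rewrite in_itv /= => tT; have [r0 _ _] := rho_facts pr pq tT; exact: continuous_ln.
apply: within_mul; last by apply: continuous_subspaceT; exact: cst_continuous.
by apply: within_sub; apply: (kp_cont kp).
Qed.

Lemma rho_init (p : R) : `|p| < r -> p != q -> ln (rho p (- T)) = 0.
Proof.
by move=> pr pq; rewrite /rho !(kp_init kp)// divff ?ln1// subr_eq0.
Qed.

Lemma drho_near (p t : R) : `|p| < r -> p != q -> - tau < t < tau -> `|drho p t| <= L.
Proof.
move=> pr pq tt; have tT := near_time kp tt.
have tT' : - T <= t <= T by case/andP: tT => ? ?; rewrite !ltW.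
have [r0 ne _] := rho_facts pr pq tT'.
rewrite /drho normrM normfV ler_pdivrMr ?normr_gt0 ?subr_eq0//.
by apply: (F_lip kp tt); apply: (kp_small kp).
Qed.

Lemma drho_far (p t : R) : `|p| < r -> - T < t < T -> ~~ (- tau < t < tau) -> drho p t = 0.
Proof.
move=> pr tT tt; have tT' : - T <= t <= T by case/andP: tT => ? ?; rewrite !ltW.
rewrite /drho /F (F_far kp tT' tt (kp_small kp pr tT')) (F_far kp tT' tt (kp_small kp qr tT')).
by rewrite subrr mul0r.
Qed.

Variables s1 s2 : R.
Hypothesis contact : forall t : R, - T <= t <= T -> t != s1 -> t != s2 -> I q t != Phi t.

(** Away from the two contact times the orbit keeps, by compactness, a positive
    distance to the graph. *)
Lemma contact_gap (lam : R) : 0 < lam -> exists2 d, 0 < d & forall t : R,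
  - T <= t <= T -> lam <= `|t - s1| -> lam <= `|t - s2| -> d <= `|I q t - Phi t|.
Proof.
move=> lam0.
pose A := `[- T, T]%classic `&` ([set t | lam <= `|t - s1|] `&` [set t | lam <= `|t - s2|]).
have [[t0 At0]|A0] := pselect (A !=set0); last first.
  exists 1 => // t tT h1 h2; exfalso; apply: A0; exists t.
  by split; [rewrite /= in_itv|split].
have clo (s : R) : closed [set t : R | lam <= `|t - s|].
  apply: (@preimage_closed _ _ (fun t : R => `|t - s|) [set x | lam <= x]); last exact: closed_ge.
  move=> t _; apply: cvg_norm; apply: cvgB; [exact: cvg_id|exact: cvg_cst].
have cA : compact A.
  apply: compact_closedI; first exact: segment_compact.
  exact: closedI.
have cW : {within A, continuous (fun t => `|I q t - Phi t|)}.
  apply: (@continuous_subspaceW _ _ _ `[- T, T]%classic); first by move=> t [].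
  apply: (@within_comp _ (fun t => I q t - Phi t) Num.norm).
    by apply: within_sub; [apply: (kp_cont kp)|apply: (kp_Phi_cont kp)].
  by move=> t _; exact: norm_continuous.
have [c cA' cmin] := compact_EVT_min (ex_intro _ t0 At0) cA cW.
rewrite inE in cA'; case: cA' => /=; rewrite in_itv /= => cT [c1 c2].
exists `|I q c - Phi c|.
  rewrite normr_gt0 subr_eq0; apply: contact => //.
    by apply: contraTneq c1 => ->; rewrite subrr normr0 -ltNge.
  by apply: contraTneq c2 => ->; rewrite subrr normr0 -ltNge.
move=> t tT h1 h2; apply: cmin; rewrite inE.
by split; [rewrite /= in_itv|split].
Qed.

(** Orbits closer to that of q than its distance to the graph are on the same side
    of the graph, where the right-hand side has Lipschitz slopes. *)
Lemma drho_cauchy (d p p' t : R) : `|p| < r -> p != q -> `|p'| < r -> p' != q ->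
  - tau < t < tau -> 2 * `|p - q| <= d -> 2 * `|p' - q| <= d -> d <= `|I q t - Phi t| ->
  `|drho p t - drho p' t| <= 4 * C * d.
Proof.
move=> pr pq p'r p'q tt pd p'd dW.
have tT := near_time kp tt.
have tT' : - T <= t <= T by case/andP: tT => ? ?; rewrite !ltW.
have [_ n1 b1] := rho_facts pr pq tT'; have [_ n2 b2] := rho_facts p'r p'q tT'.
have s0 := kp_small kp qr tT'; have s1' := kp_small kp pr tT'; have s2' := kp_small kp p'r tT'.
have d1 := le_trans b1 pd; have d2 := le_trans b2 p'd.
have C0 := kp_C kp.
have sum : C * (`|I p t - I q t| + `|I p' t - I q t|) <= C * (2 * d).
  by rewrite ler_wpM2l//; lra.
apply: le_trans (_ : 2 * C * (`|I p t - I q t| + `|I p' t - I q t|) <= _); last by lra.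
apply: slope_cauchy => //.
- exact: (kink_le1 kp tt s0).
- move: d1 d2 dW; have [h|h] := leP (I q t) (Phi t).
    rewrite (ler0_norm (_ : I q t - Phi t <= 0)) ?subr_le0//.
    by rewrite !ler_norml => /andP[? ?] /andP[? ?] ?; left; split; [|split]; lra.
  rewrite (gtr0_norm (_ : 0 < I q t - Phi t)) ?subr_gt0//.
  by rewrite !ler_norml => /andP[? ?] /andP[? ?] ?; right; split; [|split]; lra.
- apply: (le_trans (B_lip kp tt s1' s2')); rewrite ler_wpM2l//.
  have -> : I p' t - I p t = (I p' t - I q t) - (I p t - I q t) by ring.
  by rewrite [leRHS]addrC; exact: ler_normB.
- exact: (B_slope_lip kp tt s0 s1' s2').
Qed.

(** The derivative in t of atan ((t - s) / lam).  It is a majorant of a multiple of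
    the indicator function of |t - s| < lam whose integral is under control. *)
Let da (lam s t : R) := lam^-1 * (1 + ((t - s) / lam) ^+ 2)^-1.

Lemma atan_derive (lam s t : R) : is_derive t 1 (fun t => atan ((t - s) / lam)) (da lam s t).
Proof.
have h : is_derive t 1 (fun t => (t - s) / lam) lam^-1.
  by apply: is_derive_eq; rewrite /GRing.scale /=; ring.
have := @is_derive1_comp _ atan (fun t => (t - s) / lam) t _ _ (is_derive1_atan _) h.
by move=> /(@is_derive_eq _ _ _ _ _ _ _ _); apply; rewrite mulrC.
Qed.

Lemma da_bounds (lam s t : R) : 0 < lam ->
  0 <= da lam s t /\ (`|t - s| < lam -> 1 <= 2 * lam * da lam s t).
Proof.
move=> lam0.
have p0 : 0 < 1 + ((t - s) / lam) ^+ 2 by rewrite ltr_pwDl// sqr_ge0.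
split; first by rewrite mulr_ge0// invr_ge0 ltW.
move=> ts; have -> : 2 * lam * da lam s t = 2 / (1 + ((t - s) / lam) ^+ 2).
  by move: p0; rewrite /da; move: (((t - s) / lam) ^+ 2) => X p0; field; rewrite !gt_eqF.
rewrite ler_pdivlMr// mul1r.
have : ((t - s) / lam) ^+ 2 <= 1; last by lra.
rewrite -[_ ^+ 2]real_normK ?num_real// expr_le1// normrM normfV (gtr0_norm lam0).
by rewrite ler_pdivrMr// mul1r ltW.
Qed.

(** At times farther than lam from both contacts the slopes along two nearby orbits
    agree up to order d; at the other times they are merely bounded, but these times
    have total length of order lam.  Adding arctangents to the comparison function
    replaces the measure of these times by a monotonicity argument. *)
Lemma log_rho_cauchy (lam d p p' : R) : 0 < lam ->
  (forall t : R, - T <= t <= T -> lam <= `|t - s1| -> lam <= `|t - s2| -> d <= `|I q t - Phi t|) ->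
  `|p| < r -> p != q -> `|p'| < r -> p' != q -> 2 * `|p - q| <= d -> 2 * `|p' - q| <= d ->
  `|ln (rho p T) - ln (rho p' T)| <= 8 * C * d * T + 8 * L * lam * pi.
Proof.
move=> lam0 gapd pr pq p'r p'q pd p'd.
have C0 := kp_C kp; have L0 : 0 <= L by exact: L_ge0 kp.
have T0 := T_gt0 kp.
have TT : - T <= T by rewrite ge0_cp// ltW.
have d0 : 0 <= d by rewrite (le_trans _ pd)// mulr_ge0.
have Cd0 : 0 <= C * d by rewrite mulr_ge0.
have bound (t : R) : - T < t < T ->
    `|drho p t - drho p' t| <= 4 * C * d + 4 * L * lam * (da lam s1 t + da lam s2 t).
  move=> tT; have tT' : - T <= t <= T by case/andP: tT => ? ?; rewrite !ltW.
  have [a1 b1] := da_bounds s1 t lam0; have [a2 b2] := da_bounds s2 t lam0.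
  have La1 : 0 <= L * (lam * da lam s1 t) by apply: mulr_ge0 => //; apply: mulr_ge0 => //; exact: ltW.
  have La2 : 0 <= L * (lam * da lam s2 t) by apply: mulr_ge0 => //; apply: mulr_ge0 => //; exact: ltW.
  have [tt|tt] := boolP (- tau < t < tau); last first.
    by rewrite !drho_far// subrr normr0; lra.
  have n1 := drho_near pr pq tt; have n2 := drho_near p'r p'q tt.
  have n3 := ler_normB (drho p t) (drho p' t).
  have [h1|h1] := ltP `|t - s1| lam.
    by have := ler_wpM2l L0 (b1 h1); lra.
  have [h2|h2] := ltP `|t - s2| lam.
    by have := ler_wpM2l L0 (b2 h2); lra.
  by have := drho_cauchy pr pq p'r p'q tt pd p'd (gapd t tT' h1 h2); lra.
have cc (k : R) : {within `[- T, T], continuous (fun=> k)}.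
  by apply: continuous_subspaceT; exact: cst_continuous.
have catan (s : R) : {within `[- T, T], continuous (fun t => atan ((t - s) / lam))}.
  by apply: (@is_derive_within _ _ (da lam s)) => t _; exact: atan_derive.
have key (e0 : R) : e0 = 1 \/ e0 = - 1 ->
    e0 * (ln (rho p T) - ln (rho p' T)) <= 8 * C * d * T + 8 * L * lam * pi.
  move=> he0.
  pose g (t : R) := 4 * C * d * t + 4 * L * lam * (atan ((t - s1) / lam) + atan ((t - s2) / lam))
     - e0 * (ln (rho p t) - ln (rho p' t)).
  have : g (- T) <= g T.
    pose dg (t : R) := 4 * C * d + 4 * L * lam * (da lam s1 t + da lam s2 t)
      - e0 * (drho p t - drho p' t).
    have dgP (t : R) : - T < t < T -> is_derive t 1 g (dg t).
      move=> tT; have h1 := rho_derive pr pq tT; have h2 := rho_derive p'r p'q tT.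
      have h3 := atan_derive lam s1 t; have h4 := atan_derive lam s2 t.
      have l1 : is_derive t 1 (fun t => 4 * C * d * t) (4 * C * d).
        by apply: is_derive_eq; rewrite /GRing.scale /= mulr1.
      have l2 : is_derive t 1 (fun t => 4 * L * lam * (atan ((t - s1) / lam) + atan ((t - s2) / lam)))
          (4 * L * lam * (da lam s1 t + da lam s2 t)).
        exact: (is_deriveZ (4 * L * lam) (is_deriveD h3 h4)).
      have l3 : is_derive t 1 (fun t => e0 * (ln (rho p t) - ln (rho p' t))) (e0 * (drho p t - drho p' t)).
        exact: (is_deriveZ e0 (is_deriveB h1 h2)).
      exact: (is_deriveB (is_deriveD l1 l2) l3).
    have dg0 (t : R) : - T < t < T -> 0 <= dg t.
      move=> /bound; rewrite subr_ge0; apply: le_trans.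
      by case: he0 => ->; rewrite ?mul1r ?mulN1r ?ler_norm// -normrN ler_norm.
    apply: (derive_ge0_le TT dgP dg0).
    apply: within_sub.
      apply: within_add; first apply: within_mul.
      - exact: cc.
      - by apply: continuous_subspaceT => x; exact: cvg_id.
      - by apply: within_mul; [exact: cc|apply: within_add; exact: catan].
    apply: within_mul; first exact: cc.
    by apply: within_sub; apply: rho_cont.
  rewrite /g !rho_init// subrr mulr0 subr0.
  have := atan_ltpi2 ((T - s1) / lam); have := atan_ltpi2 ((T - s2) / lam).
  have := atan_gtNpi2 ((- T - s1) / lam); have := atan_gtNpi2 ((- T - s2) / lam).
  move=> p1 p2 p3 p4.
  have Ll : 0 <= L * lam by rewrite mulr_ge0// ltW.
  have : L * lam * ((atan ((T - s1) / lam) + atan ((T - s2) / lam))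
    - (atan ((- T - s1) / lam) + atan ((- T - s2) / lam))) <= L * lam * (2 * pi).
    by rewrite ler_wpM2l//; lra.
  lra.
rewrite ler_norml; apply/andP; split.
  by have := key (-1) (or_intror erefl); lra.
by have := key 1 (or_introl erefl); lra.
Qed.

(** The logarithms of the difference quotients satisfy Cauchy's criterion: first
    choose lam small, then d.  Working with logarithms also keeps the limit of the
    quotients away from zero. *)
Lemma end_derivable : derivable (fun p => I p T) q 1.
Proof.
have C0 := kp_C kp; have L0 : 0 <= L by exact: L_ge0 kp.
have T0 := T_gt0 kp.
have TT : - T <= T by rewrite ge0_cp// ltW.
pose f (h : R) := ln (rho (h + q) T).
have cf : cvg (f h @[h --> (0 : R)^']).
  apply: cauchy_cvg; apply: cauchy_exP => e e0.
  pose lam := e / (32 * (L + 1) * pi).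
  have pi0 := @pi_gt0 R.
  have lam0 : 0 < lam by rewrite divr_gt0// !mulr_gt0//; lra.
  have [d d0 dP] := contact_gap lam0.
  pose d' := Num.min d (e / (32 * (C + 1) * T)).
  have d'0 : 0 < d' by rewrite lt_min d0 divr_gt0// !mulr_gt0//; lra.
  (* The radius d' / 2 comes from the bound 2 |p - q| for the distance of two orbits. *)
  pose rr := Num.min (d' / 2) (r - `|q|).
  have rr0 : 0 < rr by rewrite lt_min divr_gt0//= subr_gt0.
  have dP' (t : R) : - T <= t <= T -> lam <= `|t - s1| -> lam <= `|t - s2| -> d' <= `|I q t - Phi t|.
    by move=> h1 h2 h3; rewrite (le_trans _ (dP t h1 h2 h3))// ge_min lexx.
  have ok (h : R) : `|h| < rr -> h != 0 -> [/\ `|h + q| < r, h + q != q & 2 * `|h + q - q| <= d'].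
    rewrite lt_min => /andP[h1 h2] h0; split.
    - by rewrite (le_lt_trans (ler_normD _ _))// -ltrBrDr.
    - by rewrite -subr_eq0 addrK.
    - by rewrite addrK mulrC -ler_pdivlMr// ltW.
  have h1 : `|rr / 2| < rr by rewrite gtr0_norm; lra.
  have [a1 a2 a3] := ok _ h1 (lt0r_neq0 (divr_gt0 rr0 (ltr0n _ 2))).
  exists (f (rr / 2)).
  apply: filterS (near_punctured rr0) => h [hr h0].
  have [b1 b2 b3] := ok h hr h0.
  rewrite /ball /= /f (le_lt_trans (log_rho_cauchy lam0 dP' a1 a2 b1 b2 a3 b3))//.
  have e1 : 8 * L * lam * pi <= e / 4.
    have -> : e / 4 = 8 * (L + 1) * lam * pi by rewrite /lam; field; rewrite !gt_eqF//; lra.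
    have := mulr_ge0 (ltW lam0) (ltW pi0); lra.
  have e2 : 8 * C * d' * T <= e / 4.
    have : d' <= e / (32 * (C + 1) * T) by rewrite ge_min lexx orbT.
    rewrite ler_pdivlMr ?mulr_gt0//; last by lra.
    have := mulr_ge0 (ltW d'0) (ltW T0); lra.
  lra.
move: cf => /cvg_ex[l hl].
apply/cvg_ex; exists (expR l).
have := cvg_comp _ _ hl (@continuous_expR R l).
apply: cvg_trans; apply: near_eq_cvg.
have rr0 : 0 < r - `|q| by rewrite subr_gt0.
apply: filterS (near_punctured rr0) => h [hr h0].
have a1 : `|h + q| < r by rewrite (le_lt_trans (ler_normD _ _))// -ltrBrDr.
have a2 : h + q != q by rewrite -subr_eq0 addrK.
have TT' : - T <= T <= T by rewrite TT lexx.
have [r0 _ _] := rho_facts a1 a2 TT'.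
by rewrite /= /f lnK ?posrE// /rho addrK [h%:A]mulr1 [RHS]mulrC.

Qed.

End end_derivable.

(** * Counting zeros *)

Section finite_sets.
Context {R : realType}.

(** A longest duplicate-free list of points of A exhausts A. *)
Lemma few_points (A : set R) (N : nat) :
  (forall s : seq R, uniq s -> (forall q, q \in s -> A q) -> (size s <= N)%N) ->
  (A #<= `I_N)%card /\ exists2 s : seq R, uniq s & forall q, A q <-> q \in s.
Proof.
move=> bnd.
pose P (k : nat) := `[< exists s : seq R, [/\ uniq s, forall q, q \in s -> A q & size s = k] >].
have P0 : exists k, P k by exists 0%N; apply/asboolP; exists [::]; split.
have PN k : P k -> (k <= N)%N by move=> /asboolP[s [us As <-]]; exact: bnd.
have [k /asboolP[s [us As sk]] kmax] := ex_maxnP P0 PN.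
have sP q : A q <-> q \in s.
  split; last exact: As.
  move=> Aq; apply/negPn/negP => qs.
  have : P k.+1.
    apply/asboolP; exists (q :: s); split; rewrite /= ?qs ?sk//.
    by move=> p; rewrite inE => /predU1P[->|/As].
  by move=> /kmax; rewrite ltnn.
split; last by exists s.
have -> : A = nth 0 s @` `I_k.
  apply/seteqP; split => [q /sP qs|_ [i /= ik <-]].
    by exists (index q s); [rewrite /= -sk index_mem|rewrite nth_index].
  by apply/sP; rewrite mem_nth// sk.
apply: card_le_trans (card_image_le _ _) _; rewrite card_le_II; apply: PN.
by apply/asboolP; exists s.
Qed.

Lemma near_notin (s : seq R) (q : R) : \forall x \near q^', x \notin s.
Proof.
elim: s => [|a s IH]; first by apply: nearW.
have h : \forall x \near q^', x != a.
  have [->|aq] := eqVneq a q; first exact: nbhs_dnbhs_neq.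
  apply: nbhs_dnbhs; have d0 : 0 < `|q - a| by rewrite normr_gt0 subr_eq0 eq_sym.
  have := @nbhsx_ballx _ R q _ d0; apply: filterS => x; rewrite /ball /=.
  by apply: contraTneq => ->; rewrite ltxx.
by apply: filterS2 h IH => x; rewrite inE negb_or => -> ->.
Qed.

End finite_sets.

Lemma step_mono (R : realType) (x : nat -> R) (N : nat) :
  (forall i, (i < N)%N -> x i < x i.+1) ->
  forall i j, (i <= j)%N -> (j <= N)%N -> x i <= x j.
Proof.
move=> xm i; elim=> [|j IH]; first by rewrite leqn0 => /eqP->.
rewrite leq_eqVlt => /orP[/eqP->//|ij] jN.
by apply: (le_trans (IH ij (ltnW jN))); rewrite ltW// xm.
Qed.

(** All that the counting of zeros has to know about the return: S j is the j-th
    derivative of the smooth reference, and mu is the threshold beyond which the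
    orbit is active. *)
Record displacement (R : realType) (r mu sigma : R) (S : nat -> R -> R) (Delta : R -> R) : Prop :=
  Displacement {
  dis_sigma : sigma = 1 \/ sigma = - 1 ;
  dis_S : forall j (q : R), - r < q < r -> is_derive q 1 (S j) (S j.+1 q) ;
  dis_inactive : forall q : R, `|q| < r -> q <= mu -> Delta q = S 0%N q ;
  dis_active : forall q : R, `|q| < r -> mu < q -> 0 < sigma * (Delta q - S 0%N q) ;
  dis_convex : forall q1 q2 q3 : R, `|q1| < r -> `|q2| < r -> `|q3| < r ->
    mu <= q1 -> q1 < q2 -> q2 < q3 ->
    0 < sigma * ((Delta q3 - Delta q2) / (q3 - q2) - (Delta q2 - Delta q1) / (q2 - q1))
}.

Section counting.
Context {R : realType}.
Variables (r mu sigma : R) (S : nat -> R -> R) (Delta : R -> R) (n : nat) (ec : R).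
Hypothesis dis : displacement r mu sigma S Delta.
Hypothesis n2 : (2 <= n)%N.
Hypothesis ec1 : ec = 1 \/ ec = - 1.
Hypothesis top : forall q : R, - r < q < r -> 0 < ec * S n q.

Lemma chainZ (k : R) j (q : R) : - r < q < r ->
  is_derive q 1 (fun x => k * S j x) (k * S j.+1 q).
Proof. by move=> qr; have h := dis_S dis j qr; apply: is_derive_eq. Qed.

Lemma no_alternation (y : nat -> R) :
  (forall i, (i <= n)%N -> `|y i| < r) ->
  (forall i, (i < n)%N -> y i < y i.+1) ->
  (forall i, (i <= n)%N -> (-1) ^+ (n - i) * (ec * S 0 (y i)) <= 0) -> False.
Proof.
move=> yr ymono yalt.
apply: (@alternation _ n (fun j q => ec * S j q) (- r) r y) => //.
- by move=> j t tr; exact: chainZ.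
- by move=> i /yr; rewrite ltr_norml.
Qed.

(** For ec the sign of c and sigma the sign of d, the test decides whether cd > 0. *)
Definition max_zeros := if ec == sigma then n else n.+1.

Lemma active_zero_sign (q : R) : `|q| < r -> mu < q -> Delta q = 0 -> sigma * S 0 q < 0.
Proof. by move=> qr mq z; have := dis_active dis qr mq; rewrite z sub0r mulrN oppr_gt0. Qed.

(** Three zeros at or beyond mu would contradict strict convexity there. *)
Lemma three_zeros (q1 q2 q3 : R) : `|q1| < r -> `|q2| < r -> `|q3| < r ->
  q1 < q2 -> q2 < q3 -> Delta q1 = 0 -> Delta q2 = 0 -> Delta q3 = 0 -> q1 < mu.
Proof.
move=> r1 r2 r3 q12 q23 z1 z2 z3; rewrite ltNge; apply/negP => mq.
by have := dis_convex dis r1 r2 r3 mq q12 q23; rewrite z1 z2 z3 !subrr !mul0r subrr mulr0 ltxx.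
Qed.

(** A strictly convex function with two zeros beyond mu is positive at mu. *)
Lemma two_active_zeros (q1 q2 : R) : `|mu| < r -> `|q1| < r -> `|q2| < r ->
  mu < q1 -> q1 < q2 -> Delta q1 = 0 -> Delta q2 = 0 -> 0 < sigma * S 0 mu.
Proof.
move=> rm r1 r2 mq q12 z1 z2.
have := dis_convex dis rm r1 r2 (lexx _) mq q12; rewrite z1 z2 subrr mul0r !sub0r.
rewrite (dis_inactive dis rm)// mulNr opprK mulrA pmulr_lgt0// invr_gt0 subr_gt0//.
Qed.

(** All but the last two of the points are zeros of S.  If at most one is active, the
    list itself alternates weakly.  If the last two are active, the sign of S at mu is
    sigma.  When ec = sigma, insert mu after the inactive
    zeros and follow it by one active zero, where S has the sign - sigma; when
    ec = - sigma, follow the inactive zeros by mu alone.  In each case S alternates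
    weakly at n + 1 points, against the sign of its n-th derivative. *)
Lemma zero_bound (x : nat -> R) :
  (forall i, (i <= max_zeros)%N -> `|x i| < r) ->
  (forall i, (i < max_zeros)%N -> x i < x i.+1) ->
  (forall i, (i <= max_zeros)%N -> Delta (x i) = 0) -> False.
Proof.
rewrite /max_zeros; case: eqVneq => [es|ens] xr xm xz.
- have Sle i : (i <= n)%N -> x i <= mu -> S 0 (x i) = 0.
    by move=> h1 h2; rewrite -(dis_inactive dis (xr i h1) h2) xz.
  have last_neg i : (i <= n)%N -> ec * S 0 (x i) <= 0.
    move=> il; have [h|h] := leP (x i) mu; first by rewrite Sle// mulr0.
    by rewrite es ltW// active_zero_sign// ?xr ?xz.
  have xmono := step_mono xm.
  case: n n2 xr xm xz Sle last_neg xmono no_alternation => [//|[//|k]] _ xr xm xz Sle last_neg xmono noalt.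
  have b1 : (k.+1 <= k.+2)%N by [].
  have b0 : (k <= k.+2)%N by exact: leq_trans b1.
  have x0 : x k < mu.
    by apply: (@three_zeros (x k) (x k.+1) (x k.+2)); rewrite ?xr ?xm ?xz.
  have [h|h] := leP (x k.+1) mu.
    apply: (noalt x) => // i; rewrite leq_eqVlt => /orP[/eqP->|ik].
      by rewrite subnn expr0 mul1r last_neg.
    by rewrite Sle ?mulr0// 1?ltnW// (le_trans _ h)// xmono.
  have rmu : `|mu| < r.
    have := xr k; have := xr k.+1; rewrite !ltr_norml => /(_ b1)/andP[? ?] /(_ b0)/andP[? ?].
    by apply/andP; split; lra.
  have Smu : 0 < ec * S 0 mu.
    by rewrite es; apply: (@two_active_zeros (x k.+1) (x k.+2)); rewrite ?xr ?xm ?xz.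
  pose y i := if (i <= k)%N then x i else if i == k.+1 then mu else x k.+1.
  apply: (noalt y).
  + by move=> i ik; rewrite /y; case: ifP => _; [exact: xr|case: ifP => _ //; exact: xr].
  + move=> i; rewrite ltnS => ik; have [lt|gt|->] := ssrnat.ltngtP i k.
    * by rewrite /y (ltnW lt) lt; apply: xm; rewrite (leq_trans lt).
    * have -> : i = k.+1 by apply/eqP; rewrite eqn_leq ik.
      by rewrite /y ltnn eqxx ltnNge leqnSn /= gtn_eqF.
    * by rewrite /y leqnn ltnn eqxx.
  + move=> i; rewrite leq_eqVlt => /orP[/eqP->|].
      by rewrite subnn expr0 mul1r /y ltnNge leqnSn /= gtn_eqF// last_neg.
    rewrite ltnS leq_eqVlt => /orP[/eqP->|ik].
      by rewrite subSnn expr1 mulN1r oppr_le0 /y ltnn eqxx ltW.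
    rewrite ltnS in ik; rewrite /y ik Sle ?mulr0 ?(leq_trans ik)//.
    by rewrite (le_trans _ (ltW x0))// xmono.
- have Sle i : (i <= n.+1)%N -> x i <= mu -> S 0 (x i) = 0.
    by move=> h1 h2; rewrite -(dis_inactive dis (xr i h1) h2) xz.
  have esN : ec = - sigma.
    by move: ens; case: ec1 => ->; case: (dis_sigma dis) => ->; rewrite ?eqxx// ?opprK.
  have xmono := step_mono xm.
  case: n n2 xr xm xz Sle xmono no_alternation => [//|k] _ xr xm xz Sle xmono noalt.
  have b1 : (k.+1 <= k.+2)%N by [].
  have b0 : (k <= k.+2)%N by exact: leq_trans b1.
  have x0 : x k < mu.
    by apply: (@three_zeros (x k) (x k.+1) (x k.+2)); rewrite ?xr ?xm ?xz.
  have [h|h] := leP (x k.+1) mu.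
    apply: (noalt x).
    + by move=> i ik; apply: xr; rewrite leqW.
    + by move=> i ik; apply: xm; rewrite leqW.
    + move=> i ik; have xle : x i <= mu by rewrite (le_trans _ h)// xmono.
      by rewrite Sle ?mulr0// leqW.
  have rmu : `|mu| < r.
    have := xr k; have := xr k.+1; rewrite !ltr_norml => /(_ b1)/andP[? ?] /(_ b0)/andP[? ?].
    by apply/andP; split; lra.
  have Smu : 0 < sigma * S 0 mu.
    by apply: (@two_active_zeros (x k.+1) (x k.+2)); rewrite ?xr ?xm ?xz.
  pose y i := if (i <= k)%N then x i else mu.
  apply: (noalt y).
  + by move=> i ik; rewrite /y; case: ifP => _ //; apply: xr; rewrite leqW.
  + move=> i; rewrite ltnS /y => ik; rewrite ik; case: ltnP => [ik'|ki].
      by apply: xm; rewrite !leqW.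
    by have -> : i = k by apply/eqP; rewrite eqn_leq ik.
  + move=> i; rewrite leq_eqVlt => /orP[/eqP->|ik].
      by rewrite subnn expr0 mul1r /y ltnn esN mulNr oppr_le0 ltW.
    rewrite ltnS in ik; rewrite /y ik Sle ?mulr0 ?(leq_trans ik)//.
    by rewrite (le_trans _ (ltW x0))// xmono.
Qed.

Lemma zero_count (s : seq R) : uniq s ->
  (forall q, q \in s -> `|q| < r /\ Delta q = 0) -> (size s <= max_zeros)%N.
Proof.
move=> us sz; rewrite leqNgt; apply/negP => big.
pose x i := nth 0 (sort <=%R s) i.
have xin i : (i <= max_zeros)%N -> x i \in s.
  by move=> im; rewrite -(mem_sort <=%R) mem_nth// size_sort (leq_ltn_trans im).
apply: (@zero_bound x).
- by move=> i /xin /sz[].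
- move=> i im; have ss : sorted <%R (sort <=%R s) by rewrite sort_lt_sorted.
  apply: (sorted_ltn_nth lt_trans 0 ss); rewrite // inE size_sort.
    by rewrite (ltn_trans im).
  by rewrite (leq_ltn_trans im).
- by move=> i /xin /sz[].
Qed.

Lemma zeros_few_isolated :
  ([set q | `|q| < r /\ Delta q = 0%R] #<= `I_max_zeros)%card /\
  (forall q, `|q| < r -> Delta q = 0 -> \forall x \near q^', Delta x != 0).
Proof.
have [h [s us sP]] := few_points (A := [set q | `|q| < r /\ Delta q = 0%R]) zero_count.
split=> // q qr zq.
have hr : \forall x \near q^', `|x| < r.
  apply: nbhs_dnbhs; have d0 : 0 < r - `|q| by rewrite subr_gt0.
  have := @nbhsx_ballx _ R q _ d0; apply: filterS => x; rewrite /ball /= => hx.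
  have -> : x = q - (q - x) by ring.
  by rewrite (le_lt_trans (ler_normB _ _))// addrC -ltrBrDr.
apply: filterS2 hr (near_notin s q) => x xr; apply: contra => /eqP zx.
by apply/sP.
Qed.

End counting.

(** * Stability of simple zeros *)

Section stability_of_zeros.
Context {R : realType}.
Implicit Types (f P : R -> R) (q : R).

Lemma derive1_eps f q (e : R) : derivable f q 1 -> 0 < e ->
  exists2 d, 0 < d & forall x, x != q -> `|x - q| < d ->
    `|(f x - f q) / (x - q) - derive1 f q| < e.
Proof.
move=> df e0; have := df; rewrite /derivable => /cvgP.
have -> : lim ((h^-1 *: ((f \o shift q) (h *: 1) - f q)) @[h --> 0^']) = derive1 f q.
  by rewrite derive1E.
move=> /cvgrPdist_lt /(_ e e0).
rewrite near_withinE => /nbhs_ballP[d /= d0 H].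
exists d => // x xq xd.
have := H (x - q); rewrite /ball /= sub0r normrN => /(_ xd).
rewrite subr_eq0 => /(_ xq); rewrite distrC /GRing.scale /= mulr1 subrK mulrC.
by [].
Qed.

Lemma contracts_attracting P q (lam d : R) : 0 <= lam < 1 -> 0 < d ->
  (forall x, `|x - q| < d -> `|P x - q| <= lam * `|x - q|) -> attracting P q.
Proof.
move=> /andP[l0 l1] d0 H.
have it k x : `|x - q| < d -> `|iter k P x - q| <= lam ^+ k * `|x - q|.
  move=> xd; elim: k => [|k IH]; first by rewrite expr0 mul1r.
  have small : `|iter k P x - q| < d.
    by rewrite (le_lt_trans IH)// (le_lt_trans _ xd)// ler_piMl// exprn_ile1// ltW.
  by rewrite iterS (le_trans (H _ small))// exprS -mulrA ler_wpM2l.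
split.
  move=> e e0; exists (Num.min d e); first by rewrite lt_min d0.
  move=> x; rewrite lt_min => /andP[xd xe] k; rewrite (le_lt_trans (it k x xd))//.
  by rewrite (le_lt_trans _ xe)// ler_piMl// exprn_ile1// ltW.
exists d => // x xd; apply/cvgrPdist_le => e e0.
have hl : `|lam| < 1 by rewrite ger0_norm.
have := cvg_geometric (`|x - q|) hl; move=> /cvgrPdist_le /(_ e e0).
apply: filterS => k; rewrite sub0r normrN /geometric /= => hk.
rewrite distrC (le_trans (it k x xd))// (le_trans _ hk)// mulrC ler_norm//.
Qed.

Lemma bernoulli (h : R) k : 0 <= h -> 1 + k%:R * h <= (1 + h) ^+ k.
Proof.
move=> h0; elim: k => [|k IH]; first by rewrite mul0r addr0 expr0.
rewrite exprS -natr1.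
have : (1 + h) * (1 + k%:R * h) <= (1 + h) * (1 + h) ^+ k by rewrite ler_wpM2l// addr_ge0.
by have := mulr_ge0 (ler0n R k) (mulr_ge0 h0 h0); lra.
Qed.

(** If the orbit stayed within d of q its distance would grow geometrically, and by
    Bernoulli's inequality without bound. *)
Lemma expands_repelling P q (h d : R) : 0 < h -> 0 < d ->
  (forall x, `|x - q| < d -> (1 + h) * `|x - q| <= `|P x - q|) -> repelling P q.
Proof.
move=> h0 d0 H; exists d => // x xq xd.
apply: contrapT => /forallNP no.
have small k : `|iter k P x - q| < d by rewrite ltNge; apply/negP; exact: no.
have it k : (1 + h) ^+ k * `|x - q| <= `|iter k P x - q|.
  elim: k => [|k IH]; first by rewrite expr0 mul1r.
  rewrite iterS (le_trans _ (H _ (small k)))// exprS -mulrA ler_wpM2l//; lra.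
have a0 : 0 < `|x - q| by rewrite normr_gt0 subr_eq0.
pose k := Num.bound (d / (h * `|x - q|)).
have bk : d / (h * `|x - q|) < k%:R.
  by apply: archi_boundP; rewrite divr_ge0 ?mulr_ge0// ltW.
have := small k; apply/negP; rewrite -leNgt (le_trans _ (it k))//.
have := ler_wpM2r (ltW a0) (bernoulli k (ltW h0)); apply: le_trans.
move: bk; rewrite ltr_pdivrMr ?mulr_gt0// => bk; lra.
Qed.

Lemma lip_within f (r a b : R) :
  (forall x y, `|x| < r -> `|y| < r -> `|f x - f y| <= 2^-1 * `|x - y|) ->
  - r < a -> b < r -> {within `[a, b], continuous f}.
Proof.
move=> lip ra br; apply: continuous_in_subspaceT => x; rewrite inE /= in_itv /= => /andP[ax xb].
have xr : `|x| < r by rewrite ltr_norml (lt_le_trans ra ax) (le_lt_trans xb br).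
apply/cvgrPdist_le => e e0.
have d0 : 0 < Num.min e (r - `|x|) by rewrite lt_min e0 subr_gt0.
have := @nbhsx_ballx _ R x _ d0; apply: filterS => y; rewrite /ball /= lt_min => /andP[h1 h2].
have yr : `|y| < r.
  have -> : y = x - (x - y) by ring.
  by rewrite (le_lt_trans (ler_normB _ _))// addrC -ltrBrDr.
by have := lip _ _ xr yr; have := normr_ge0 (x - y); lra.
Qed.

Variables (P : R -> R) (r : R).
Let Delta x := P x - x.
Hypothesis lip : forall x y, `|x| < r -> `|y| < r -> `|Delta x - Delta y| <= 2^-1 * `|x - y|.

(** The Lipschitz constant 1/2 keeps the multiplier at least 1/2, so that a negative
    slope of Delta makes P a contraction near q. *)
Lemma simple_attracting q : `|q| < r -> simple_zero Delta q ->
  derive1 Delta q < 0 -> attracting P q.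
Proof.
move=> qr [zq dq _] neg; set D := derive1 Delta q in neg.
have e0 : 0 < - D / 2 by lra.
have [d d0 dP] := derive1_eps dq e0; rewrite -/D zq in dP.
have r0 : 0 < r - `|q| by rewrite subr_gt0.
have inr x : `|x - q| < r - `|q| -> `|x| < r.
  move=> h; have -> : x = (x - q) + q by ring.
  by rewrite (le_lt_trans (ler_normD _ _))// -ltrBrDr.
have slope x : x != q -> `|x - q| < Num.min d (r - `|q|) ->
    Delta x / (x - q) < D / 2 /\ - 2^-1 <= Delta x / (x - q).
  move=> xq; rewrite lt_min => /andP[xd /inr xr].
  have := dP x xq xd; rewrite subr0 ltr_norml => /andP[_ h]; split; first by lra.
  have := lip xr qr; rewrite zq subr0 -ler_pdivrMr ?normr_gt0 ?subr_eq0//.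
  by rewrite -normfV -normrM ler_norml => /andP[].
have [D1 D2] : - 2^-1 <= D / 2 /\ D / 2 < 0.
  split; last by lra.
  pose x := q + Num.min d (r - `|q|) / 2.
  have m0 : 0 < Num.min d (r - `|q|) by rewrite lt_min d0.
  have e : x - q = Num.min d (r - `|q|) / 2 by rewrite /x; ring.
  have [] := slope x; rewrite ?e; [|by rewrite gtr0_norm; lra|by lra].
  by rewrite -subr_eq0 e gt_eqF// divr_gt0.
apply: (@contracts_attracting P q (1 + D / 2) (Num.min d (r - `|q|))).
- by apply/andP; split; lra.
- by rewrite lt_min d0.
- move=> x xd; have [->|xq] := eqVneq x q.
    have -> : P q = q by apply/eqP; rewrite -subr_eq0; apply/eqP.
    by rewrite subrr normr0 mulr0.
  have [s1 s2] := slope x xq xd.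
  have -> : P x - q = (1 + Delta x / (x - q)) * (x - q).
    by rewrite /Delta; field; rewrite subr_eq0.
  by rewrite normrM ler_wpM2r// ger0_norm; lra.
Qed.

Lemma simple_repelling q : simple_zero Delta q ->
  0 < derive1 Delta q -> repelling P q.
Proof.
move=> [zq dq _] pos; set D := derive1 Delta q in pos.
have e0 : 0 < D / 2 by lra.
have [d d0 dP] := derive1_eps dq e0; rewrite -/D zq in dP.
apply: (@expands_repelling P q (D / 2) d) => // x xd.
have [->|xq] := eqVneq x q; first by rewrite subrr normr0 mulr0.
have := dP x xq xd; rewrite subr0 ltr_norml => /andP[h _].
have -> : P x - q = (1 + Delta x / (x - q)) * (x - q).
  by rewrite /Delta; field; rewrite subr_eq0.
by rewrite normrM ler_wpM2r// ger0_norm; lra.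
Qed.

(** With slopes of the same sign, Delta would change sign between two consecutive
    zeros. *)
Lemma consecutive_slopes (e0 q q' : R) : `|q| < r -> `|q'| < r -> q < q' ->
  simple_zero Delta q -> simple_zero Delta q' ->
  (forall x, q < x < q' -> Delta x != 0) ->
  0 < e0 * derive1 Delta q -> 0 < e0 * derive1 Delta q' -> False.
Proof.
move=> qr q'r qq [zq dq _] [zq' dq' _] noz p p'.
have half (z : R) : derivable Delta z 1 -> Delta z = 0 -> 0 < e0 * derive1 Delta z ->
    exists2 d, 0 < d & forall x, x != z -> `|x - z| < d -> 0 < e0 * (Delta x / (x - z)).
  move=> dz zz pz.
  have en : e0 != 0 by apply: contraTneq pz => ->; rewrite mul0r ltxx.
  have ep : 0 < e0 * derive1 Delta z / `|e0| by rewrite divr_gt0// normr_gt0.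
  have [d d0 dP] := derive1_eps dz ep; exists d => // x xz xd.
  have := dP x xz xd; rewrite zz subr0 ltr_pdivlMr ?normr_gt0// -normrM ltr_norml => /andP[+ _].
  by lra.
have [d d0 dP] := half q dq zq p; have [d' d'0 dP'] := half q' dq' zq' p'.
pose x := q + Num.min (d / 2) ((q' - q) / 3).
pose y := q' - Num.min (d' / 2) ((q' - q) / 3).
have m1 : 0 < Num.min (d / 2) ((q' - q) / 3) by rewrite lt_min !divr_gt0// subr_gt0.
have m2 : 0 < Num.min (d' / 2) ((q' - q) / 3) by rewrite lt_min !divr_gt0// subr_gt0.
have m3 : Num.min (d / 2) ((q' - q) / 3) <= (q' - q) / 3 by rewrite ge_min lexx orbT.
have m4 : Num.min (d' / 2) ((q' - q) / 3) <= (q' - q) / 3 by rewrite ge_min lexx orbT.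
have m5 : Num.min (d / 2) ((q' - q) / 3) <= d / 2 by rewrite ge_min lexx.
have m6 : Num.min (d' / 2) ((q' - q) / 3) <= d' / 2 by rewrite ge_min lexx.
have xq : q < x by rewrite /x; lra.
have yq : y < q' by rewrite /y; lra.
have xy : x < y by rewrite /x /y; lra.
have px : 0 < e0 * Delta x.
  have := dP x (negbT (gt_eqF xq)); rewrite gtr0_norm ?subr_gt0// => /(_ _).
  by rewrite mulrA pmulr_lgt0 ?invr_gt0 ?subr_gt0//; apply; rewrite /x; lra.
have py : e0 * Delta y < 0.
  have := dP' y (negbT (lt_eqF yq)); rewrite ltr0_norm ?subr_lt0// => /(_ _).
  by rewrite mulrA nmulr_lgt0 ?invr_lt0 ?subr_lt0//; apply; rewrite /y; lra.
move: qr q'r; rewrite !ltr_norml => /andP[qr _] /andP[_ q'r].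
have cD : {within `[x, y], continuous (fun z => e0 * Delta z)}.
  apply: within_mul; first by apply: continuous_subspaceT; exact: cst_continuous.
  by apply: (lip_within lip); [exact: lt_trans xq|exact: lt_trans q'r].
have [s [/andP[s1 s2] s3 _]] := first_hit (ltW xy) cD px (ltW py).
have /eqP := s3; rewrite mulf_eq0 => /orP[/eqP e|].
  by move: px; rewrite e mul0r ltxx.
by apply/negP/noz; rewrite (lt_trans xq s1) (le_lt_trans s2 yq).
Qed.

Lemma alternates (s : seq R) : zeros_listed Delta r s ->
  (forall q, q \in s -> simple_zero Delta q) -> alternating_stability P s.
Proof.
move=> [ss sz] simp.
pose D i := derive1 Delta s`_i.
have sin i : (i < size s)%N -> s`_i \in s by exact: mem_nth.
have Dn i : (i < size s)%N -> D i != 0 by move=> /sin /simp[].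
have sr i : (i < size s)%N -> `|s`_i| < r by move=> /sin /sz[].
exists (D 0%N < 0).
have main i : (i < size s)%N -> odd i (+) (D 0%N < 0) = (D i < 0).
  elim: i => [|i IH] il; first by [].
  have il' := ltnW il.
  rewrite /= addNb (IH il').
  have slt : s`_i < s`_i.+1 by apply: (sorted_ltn_nth lt_trans 0 ss).
  have noz x : s`_i < x < s`_i.+1 -> Delta x != 0.
    move=> /andP[x1 x2]; apply/eqP => zx.
    have xs : x \in s.
      apply/sz; split=> //; have := sr i il'; have := sr _ il; rewrite !ltr_norml.
      by move=> /andP[_ h1] /andP[h2 _]; rewrite (lt_trans h2 x1) (lt_trans x2 h1).
    have xi : (index x s < size s)%N by rewrite index_mem.
    rewrite -(nth_index 0 xs) in x1 x2.
    rewrite !(lt_sorted_ltn_nth 0 ss)// in x1 x2.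
    by move: (leq_trans x1 x2); rewrite ltnNge leqnn.
  have si := simp _ (sin i il'); have si' := simp _ (sin _ il).
  have := Dn i il'; have := Dn _ il.
  rewrite !neq_lt => /orP[a|a] /orP[b|b].
  - exfalso; apply: (@consecutive_slopes (-1) _ _ (sr _ il') (sr _ il) slt si si' noz);
      by rewrite mulN1r oppr_gt0.
  - by rewrite a ltNge (ltW b).
  - by rewrite b ltNge (ltW a).
  - exfalso; apply: (@consecutive_slopes 1 _ _ (sr _ il') (sr _ il) slt si si' noz);
      by rewrite mul1r.
move=> i il; rewrite main//; have := Dn i il; case: ltP => [h _|h0 hn].
  exact: simple_attracting (sr i il) (simp _ (sin i il)) h.
apply: simple_repelling (simp _ (sin i il)) _.
by rewrite lt_def hn.
Qed.

End stability_of_zeros.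

(** * Openness from a Jacobian of full rank *)

Lemma is_derive_slice (R : realType) (V W : normedModType R) (f : V -> W) (v q : V) (s : R) (d : W) :
  is_derive (s *: v + q) v f d -> is_derive s 1 (fun s => f (s *: v + q)) d.
Proof.
move=> [df dfE].
have e : (fun h : R => h^-1 *: (((fun s => f (s *: v + q)) \o shift s) (h *: 1) - f (s *: v + q)))
       = (fun h : R => h^-1 *: ((f \o shift (s *: v + q)) (h *: v) - f (s *: v + q))).
  apply/funext => h /=.
  have -> : h *: (1 : R) = h by rewrite /GRing.scale /= mulr1.
  by rewrite scalerDl addrA.
apply: DeriveDef; first by rewrite /derivable e.
by rewrite -dfE /derive e.
Qed.

Section row_vectors.
Context {R : realType}.

Lemma rv_norm_le n (x : 'rV[R]_n) (e : R) : 0 <= e -> (forall j, `|x ord0 j| <= e) -> `|x| <= e.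
Proof.
move=> e0 h; rewrite /Num.Def.normr /= mx_normrE; apply/bigmax_leP; split => // -[i j] _ /=.
by rewrite (ord1 i).
Qed.

Lemma rv_coord_le n (x : 'rV[R]_n) j : `|x ord0 j| <= `|x|.
Proof.
rewrite [leRHS]/Num.Def.normr /= mx_normrE.
by apply/bigmax_geP; right; exists (ord0, j).
Qed.

Lemma rv_norm_lt n (x : 'rV[R]_n) (e : R) : 0 < e -> (forall j, `|x ord0 j| < e) -> `|x| < e.
Proof.
move=> e0 h; rewrite /Num.Def.normr /= mx_normrE; apply/bigmax_ltP; split => // -[i j] _ /=.
by rewrite (ord1 i).
Qed.

(** Strict differentiability at 0: the linear approximation is uniform in both points.
    Unlike differentiability at the point, this is enough for f to be open at 0. *)
Definition strict_diff0 m n (f : 'rV[R]_m -> 'rV[R]_n) (A : 'M[R]_(m, n)) :=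
  forall e : R, 0 < e -> exists2 rho : R, 0 < rho & forall x y, `|x| < rho -> `|y| < rho ->
    `|f y - f x - (y - x) *m A| <= e * `|y - x|.

(** Change one coordinate at a time and apply the mean value theorem in each
    coordinate. *)
Lemma partials_strict m (f : 'rV[R]_m -> R) (g : 'I_m -> 'rV[R]_m -> R) (e : R) :
  (\forall z \near (0 : 'rV[R]_m), forall i, is_derive z (delta_mx 0 i) f (g i z)) ->
  (forall i, {for 0, continuous (g i)}) -> 0 < e ->
  exists2 rho : R, 0 < rho & forall x y, `|x| < rho -> `|y| < rho ->
    `|f y - f x - \sum_i (y ord0 i - x ord0 i) * g i 0| <= e * `|y - x|.
Proof.
move=> hd hc e0.
pose e' := e / m.+1%:R.
have e'0 : 0 < e' by rewrite divr_gt0.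
have hc1 i : \forall z \near (0 : 'rV[R]_m), `|g i z - g i 0| < e'.
  by have /cvgrPdist_lt /(_ e' e'0) := hc i; apply: filterS => z; rewrite distrC.
have hc' := @filter_forall 'rV[R]_m 'I_m (fun i z => `|g i z - g i 0| < e') (nbhs (0 : 'rV[R]_m)) (nbhs_filter _) hc1.
have [rho /= rho0 H] := (iffLR (nbhs_ballP _ _)) (filterI hd hc').
have inb (z : 'rV[R]_m) : `|z| < rho -> ball (0 : 'rV[R]_m) rho z.
  by move=> zr; rewrite -ball_normE /= sub0r normrN.
exists rho => // x y xr yr.
pose p (k : nat) : 'rV[R]_m := \row_i (if (i < k)%N then y ord0 i else x ord0 i).
have p0 : p 0%N = x by apply/rowP => i; rewrite mxE.
have pm : p m = y by apply/rowP => i; rewrite mxE ltn_ord.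
have step (k : 'I_m) : exists2 xi, `|xi| < rho &
    f (p k.+1) - f (p k) = g k xi * (y ord0 k - x ord0 k).
  pose q : 'rV[R]_m := p k - x ord0 k *: delta_mx 0 k.
  have seg (s : R) i : (s *: delta_mx 0 k + q) ord0 i = if i == k then s else p k ord0 i.
    rewrite !mxE eqxx /=; case: eqVneq => [->|_]; last by rewrite !mulr0 oppr0 addr0 add0r.
    by rewrite ltnn !mulr1 subrr addr0.
  have ex : x ord0 k *: delta_mx 0 k + q = p k by rewrite /q addrC subrK.
  have ey : y ord0 k *: delta_mx 0 k + q = p k.+1.
    apply/rowP => i; rewrite seg [RHS]mxE ltnS leq_eqVlt -(inj_eq val_inj) /=.
    by case: eqP => [/val_inj->//|_]; rewrite mxE.
  have small (s : R) : `|s| < rho -> `|s *: delta_mx 0 k + q| < rho.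
    move=> sr; apply: rv_norm_lt => // i; rewrite seg mxE; case: ifP => // _.
    by case: ifP => _; apply: le_lt_trans (rv_coord_le _ _) _.
  have xk : `|x ord0 k| < rho by apply: le_lt_trans (rv_coord_le _ _) _.
  have yk : `|y ord0 k| < rho by apply: le_lt_trans (rv_coord_le _ _) _.
  have dphi (s : R) : `|s| < rho ->
      is_derive s 1 (fun s => f (s *: delta_mx 0 k + q)) (g k (s *: delta_mx 0 k + q)).
    move=> sr; apply: is_derive_slice.
    by have [hh _] := H _ (inb _ (small s sr)); exact: hh.
  rewrite -ex -ey.
  have btw (a b s : R) : `|a| < rho -> `|b| < rho -> a <= s <= b -> `|s| < rho.
    by rewrite !ltr_norml => /andP[? ?] /andP[? ?] /andP[? ?]; lra.
  have mvt (a b : R) : `|a| < rho -> `|b| < rho -> a < b -> exists2 xi, `|xi| < rho &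
      f (b *: delta_mx 0 k + q) - f (a *: delta_mx 0 k + q) = g k xi * (b - a).
    move=> ar br ab.
    have df t : a < t < b -> is_derive t 1 (fun s => f (s *: delta_mx 0 k + q)) (g k (t *: delta_mx 0 k + q)).
      by move=> /andP[t1 t2]; apply/dphi/(btw a b) => //; rewrite !ltW.
    have cf : {within `[a, b], continuous (fun s => f (s *: delta_mx 0 k + q))}.
      apply: (@is_derive_within _ _ (fun t => g k (t *: delta_mx 0 k + q))) => t /=.
      by rewrite in_itv /= => tab; apply/dphi/(btw a b).
    have [c /andP[c1 c2] ce] := mean_value ab df cf.
    by exists (c *: delta_mx 0 k + q) => //; apply/small/(btw a b) => //; rewrite !ltW.
  have [lt|gt|->] := ltgtP (x ord0 k) (y ord0 k).
  - exact: mvt.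
  - by have [xi xir e1] := mvt _ _ yk xk gt; exists xi => //; lra.
  - by exists 0; rewrite ?normr0// !subrr mulr0.
have [xi xiP] := choice (fun k : 'I_m => (ex2_ind (fun a b c => ex_intro _ a (conj b c)) (step k))).
have -> : f y - f x = \sum_(k < m) g k (xi k) * (y ord0 k - x ord0 k).
  rewrite -p0 -pm -(telescope_sumr (fun k => f (p k)) (leq0n m)) big_mkord pm p0.
  by apply: eq_bigr => k _; have [_ ->] := xiP k.
rewrite -sumrB (le_trans (ler_norm_sum _ _ _))//.
have -> : e * `|y - x| = \sum_(k < m.+1) e' * `|y - x|.
  by rewrite sumr_const card_ord -mulr_natr mulrAC divfK// pnatr_eq0.
rewrite big_ord_recr /=; apply: ler_wpDr; first by rewrite mulr_ge0// ltW.
apply: ler_sum => k _.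
have -> : g k (xi k) * (y ord0 k - x ord0 k) - (y ord0 k - x ord0 k) * g k 0
  = (g k (xi k) - g k 0) * (y - x) ord0 k by rewrite !mxE; ring.
rewrite normrM; apply: ler_pM; rewrite ?rv_coord_le//; apply: ltW.
have [xr' _] := xiP k.
by have [_ hh] := H _ (inb _ xr'); exact: hh.
Qed.

Lemma rv_mulmx_le m n (v : 'rV[R]_m) (A : 'M[R]_(m, n)) (K : R) :
  (forall i j, `|A i j| <= K) -> 0 <= K -> `|v *m A| <= m%:R * K * `|v|.
Proof.
move=> AK K0; apply: rv_norm_le => [|j]; first by rewrite !mulr_ge0.
rewrite mxE (le_trans (ler_norm_sum _ _ _))//.
have -> : m%:R * K * `|v| = \sum_(i < m) K * `|v|.
  by rewrite sumr_const card_ord -[RHS]mulr_natl mulrA.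
by apply: ler_sum => i _; rewrite normrM mulrC ler_pM ?rv_coord_le.
Qed.

Lemma matrix_bound m n (A : 'M[R]_(m, n)) : exists2 K, 0 <= K & forall i j, `|A i j| <= K.
Proof.
exists `|A|; rewrite ?normr_ge0// => i j; rewrite [leRHS]/Num.Def.normr /= mx_normrE.
by apply/bigmax_geP; right; exists (i, j).
Qed.

Lemma strict_diff0_jacobian m n (f : 'rV[R]_m -> 'rV[R]_n) (A : 'M[R]_(m, n)) :
  strict_diff0 f A -> 'J f 0 = A.
Proof.
move=> sd.
have [K K0 AK] := matrix_bound A.
have cA : continuous (mulmxr A : 'rV[R]_m -> 'rV[R]_n).
  apply: bounded_linear_continuous; apply/linear_boundedP.
  near=> r.
  have hr : m%:R * K <= r by near: r; apply: nbhs_pinfty_ge; exact: num_real.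
  by move=> x /=; rewrite (le_trans (rv_mulmx_le _ AK K0))// ler_wpM2r.
have dE : 'd f 0 = mulmxr A :> ('rV[R]_m -> 'rV[R]_n).
  apply: diff_unique => //; apply/eqaddoP => e e0.
  have [rho rho0 H] := sd e e0.
  apply/nbhs_ballP; exists rho => //= x; rewrite -ball_normE /= sub0r normrN => xr.
  have := H 0 x; rewrite normr0 subr0 => /(_ rho0 xr).
  apply: le_trans.
  by rewrite -[X in X <= _]/(`|f (x + 0) - (f 0 + x *m A)|) addr0 opprD addrA.
by apply/matrixP => i j; rewrite /jacobian mxE dE /= -rowE mxE.
Unshelve. all: end_near. Qed.

(** Let B A = 1.  Near 0, z |-> f (z B) differs from the identity by a map with Lipschitz
    constant 1/2.  At a minimum of the residual |f (z B) - y| over a closed ball,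
    the step z' = z - (f (z B) - y) would halve the residual, so it is zero. *)
Lemma strict_open m n (f : 'rV[R]_m -> 'rV[R]_n) (A : 'M[R]_(m, n)) (e : R) :
  strict_diff0 f A -> f 0 = 0 -> \rank A = n -> 0 < e ->
  exists2 d : R, 0 < d & forall y, `|y| <= d -> exists2 x, `|x| < e & f x = y.
Proof.
move=> sd f0 rA e0.
have [B BA] : exists B, B *m A = 1%:M by apply/row_fullP; rewrite /row_full rA.
have [K K0 BK] := matrix_bound B.
pose k := n%:R * K + 1.
have k0 : 0 < k by rewrite ltr_wpDl// mulr_ge0.
have Bk (z : 'rV[R]_n) : `|z *m B| <= k * `|z|.
  by rewrite (le_trans (rv_mulmx_le _ BK K0))// ler_wpM2r// lerDl.
have [rho rho0 H] := sd (2 * k)^-1 ltac:(by rewrite invr_gt0 mulr_gt0).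
pose s := Num.min rho e / (2 * k).
have s0 : 0 < s by rewrite divr_gt0 ?mulr_gt0// lt_min rho0.
have sB (z : 'rV[R]_n) : `|z| <= s -> `|z *m B| < Num.min rho e.
  move=> zs; rewrite (le_lt_trans (Bk z))//.
  have := ler_wpM2l (ltW k0) zs; rewrite /s => h.
  have m0 : 0 < Num.min rho e by rewrite lt_min rho0.
  have e1 : k * (Num.min rho e / (2 * k)) = Num.min rho e / 2 by field; rewrite gt_eqF.
  by rewrite (le_lt_trans h)// e1; lra.
have contr (z z' : 'rV[R]_n) : `|z| <= s -> `|z'| <= s ->
    `|(z' - z) - (f (z' *m B) - f (z *m B))| <= 2^-1 * `|z' - z|.
  move=> zs zs'.
  have := sB z zs; rewrite lt_min => /andP[zr _]; have := sB z' zs'; rewrite lt_min => /andP[zr' _].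
  have := H _ _ zr zr'; rewrite -mulmxBl -mulmxA BA mulmx1 distrC => h.
  rewrite (le_trans h)//.
  have k2 : 0 <= (2 * k)^-1 by rewrite invr_ge0 ltW// mulr_gt0.
  have h2 := ler_wpM2l k2 (Bk (z' - z)).
  rewrite (le_trans h2)//.
  have -> : (2 * k)^-1 * (k * `|z' - z|) = 2^-1 * `|z' - z| by field; rewrite gt_eqF.
  by [].
exists (s / 2); first by rewrite divr_gt0.
move=> y ys.
pose D := [set z : 'rV[R]_n | `|z| <= s].
have D0 : D !=set0 by exists 0; rewrite /D /= normr0 ltW.
have cD : compact D.
  apply: bounded_closed_compact.
    by exists s; split; [exact: num_real|move=> M sM z /= zs; rewrite (le_trans zs)// ltW].
  apply: (@preimage_closed _ _ (fun z : 'rV[R]_n => `|z|) [set x | x <= s]); last exact: closed_le.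
  by move=> z _; exact: norm_continuous.
pose phi (z : 'rV[R]_n) := `|f (z *m B) - y|.
have lipf (z z' : 'rV[R]_n) : `|z| <= s -> `|z'| <= s -> `|f (z' *m B) - f (z *m B)| <= 2 * `|z' - z|.
  move=> zs zs'; have h := contr z z' zs zs'.
  have := ler_normB (z' - z) ((z' - z) - (f (z' *m B) - f (z *m B))).
  by rewrite subKr; have := normr_ge0 (z' - z); lra.
have cphi : {within D, continuous phi}.
  apply/subspace_continuousP => z Dz; apply/cvgrPdist_le => eps eps0.
  have eps2 : 0 < eps / 2 by rewrite divr_gt0.
  rewrite near_withinE; have := @nbhsx_ballx _ 'rV[R]_n z _ eps2.
  apply: filterS => z'; rewrite -ball_normE /= => zz Dz'.
  have := lipf z' z Dz' Dz; rewrite /phi.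
  have := ler_dist_dist (f (z *m B) - y) (f (z' *m B) - y).
  have -> : f (z *m B) - y - (f (z' *m B) - y) = f (z *m B) - f (z' *m B).
    by rewrite opprB addrA subrK.
  by have := normr_ge0 (z - z'); lra.
have [z Dz zmin] := compact_EVT_min D0 cD cphi.
rewrite inE in Dz.
pose z' := z - (f (z *m B) - y).
have Dz' : `|z'| <= s.
  have h1 := contr 0 z ltac:(by rewrite normr0 ltW) Dz.
  rewrite subr0 mul0mx f0 subr0 in h1.
  have -> : z' = (z - f (z *m B)) + y by rewrite /z' opprB addrA addrAC.
  apply: (le_trans (ler_normD _ _)).
  by have := normr_ge0 z; move: Dz; rewrite /D /=; lra.
exists (z *m B); first by have := sB z Dz; rewrite lt_min => /andP[].
apply/eqP; rewrite -subr_eq0 -normr_le0.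
have := zmin z'; rewrite inE => /(_ Dz'); rewrite /phi.
have h2 := contr z z' Dz Dz'.
have e1 : z' - z = - (f (z *m B) - y) by rewrite /z' addrC addKr.
have e2 : (z' - z) - (f (z' *m B) - f (z *m B)) = - (f (z' *m B) - y).
  by rewrite e1 !opprB addrA subrK.
rewrite e2 e1 !normrN in h2.
have := normr_ge0 (f (z *m B) - y); lra.
Qed.

End row_vectors.

(** * Iterated directional derivatives *)

Section along.
Context {R : realType}.

Lemma is_derive_along (V W X : normedModType R) (f : W -> X) (i : V -> W) (v z : V) (w : W) (d : X) :
  (forall h : R, i (h *: v + z) = h *: w + i z) ->
  is_derive (i z) w f d -> is_derive z v (fun x => f (i x)) d.
Proof.
move=> iE [df dfE].
have e : (fun h : R => h^-1 *: (((fun x => f (i x)) \o shift z) (h *: v) - f (i z)))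
       = (fun h : R => h^-1 *: ((f \o shift (i z)) (h *: w) - f (i z))).
  by apply/funext => h /=; rewrite iE.
apply: DeriveDef; first by rewrite /derivable e.
by rewrite -dfE /derive e.
Qed.

Lemma chain_derive1n (F : nat -> R -> R) (g : R -> R) (O : set R) : open O ->
  (forall x, O x -> g x = F 0%N x) ->
  (forall j x, O x -> is_derive x 1 (F j) (F j.+1 x)) ->
  forall j x, O x -> derive1n j g x = F j x.
Proof.
move=> oO g0 dF; elim=> [|j IH] x Ox; first exact: g0.
rewrite derive1nS derive1E.
have h : \near x, derive1n j g x = F j x.
  by have := open_nbhs_nbhs (conj oO Ox); apply: filterS => y; exact: IH.
rewrite (near_eq_derive _ h); have hd := dF j x Ox; exact: derive_val.
Qed.
End along.

Section ck.
Context {R : realType}.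
Variables (V W : normedModType R).
Implicit Types (U : set V) (f : V -> W).

Lemma Ck_continuous k U f x : Ck k U f -> U x -> {for x, continuous f}.
Proof. by case: k => [[h _]|k [h _]]; exact: h. Qed.

Lemma Ck_derive k U f v x : Ck k.+1 U f -> U x -> is_derive x v f ('D_v f x).
Proof. by move=> [_ /(_ v)[h _]] Ux; apply: derivableP; exact: h. Qed.

Lemma Ck_D k U f v : Ck k.+1 U f -> Ck k U (fun x => 'D_v f x).
Proof. by move=> [_ /(_ v)[_]]. Qed.

Definition iterD v j f : V -> W := iter j (fun g x => 'D_v g x) f.

Lemma Ck_iterD v U f : (forall k, Ck k U f) -> forall j k, Ck k U (iterD v j f).
Proof. by move=> h; elim=> [//|j IH] k; apply: Ck_D; exact: IH. Qed.

Lemma iterD_derive v U f j x : (forall k, Ck k U f) -> U x ->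
  is_derive x v (iterD v j f) (iterD v j.+1 f x).
Proof. by move=> h Ux; apply: (@Ck_derive 0) Ux; exact: (Ck_iterD v h j 1). Qed.

Lemma iterD_continuous v U f j x : (forall k, Ck k U f) -> U x ->
  {for x, continuous (iterD v j f)}.
Proof. by move=> h; apply: (@Ck_continuous 0); exact: Ck_iterD. Qed.

End ck.

Section near_zero.
Context {R : realType}.

Lemma near_pair (V W : normedModType R) (v : V) (w : W) (P : V * W -> Prop) :
  (\forall y \near (v, w), P y) ->
  exists2 e : R, 0 < e & forall x y, `|x - v| < e -> `|y - w| < e -> P (x, y).
Proof.
move=> /nbhs_ballP[e /= e0 H]; exists e => // x y xe ye; apply: H.
by split; rewrite /= -ball_normE /= distrC.
Qed.

Lemma continuous_lt (V : normedModType R) (f : V -> R) (x : V) (e : R) :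
  {for x, continuous f} -> 0 < e -> \forall y \near x, `|f y - f x| < e.
Proof.
by move=> /cvgrPdist_lt h e0; have := h e e0; apply: filterS => y; rewrite distrC.
Qed.

(** Repeated mean values carry the sign of the k-th derivative down to F, one factor t
    at a time. *)
Lemma zero_order (F : nat -> R -> R) (T : R) k :
  (forall j (t : R), - T <= t <= T -> is_derive t 1 (F j) (F j.+1 t)) ->
  (forall j, (j < k)%N -> F j 0 = 0) ->
  (forall t : R, - T <= t <= T -> 0 < F k t) ->
  forall t : R, - T <= t <= T -> t != 0 -> 0 < t ^+ k * F 0%N t.
Proof.
elim: k F => [|k IH] F dF F0 Fk t tT t0; first by rewrite expr0 mul1r Fk.
have [xi [xiT xi0 sgn e]] : exists xi, [/\ - T <= xi <= T, xi != 0, 0 < xi * t & F 0%N t = F 1%N xi * t].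
  case/andP: tT => t1 t2.
  have T0 : 0 <= T by lra.
  have cF : forall a b : R, - T <= a -> b <= T -> {within `[a, b], continuous (F 0%N)}.
    move=> a b aT bT; apply: (@is_derive_within _ _ (F 1%N)) => x /=; rewrite in_itv /= => /andP[x1 x2].
    by apply: dF; rewrite (le_trans aT x1) (le_trans x2 bT).
  have [lt|gt|e] := ltgtP 0 t; last by rewrite -e eqxx in t0.
  - have df (x : R) : 0 < x < t -> is_derive x 1 (F 0%N) (F 1%N x) by move=> /andP[? ?]; apply: dF; lra.
    have Tn : - T <= 0 by lra.
    have [c /andP[c1 c2]] := mean_value lt df (cF 0 t Tn t2).
    rewrite (F0 0%N)// !subr0 => e; exists c; split => //; [lra|by rewrite gt_eqF|by rewrite mulr_gt0].
  - have df (x : R) : t < x < 0 -> is_derive x 1 (F 0%N) (F 1%N x) by move=> /andP[? ?]; apply: dF; lra.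
    have [c /andP[c1 c2]] := mean_value gt df (cF t 0 t1 T0).
    rewrite (F0 0%N)// !sub0r => e; exists c; split => //; [lra|by rewrite lt_eqF|by rewrite nmulr_rgt0|lra].
have h : 0 < xi ^+ k * F 1%N xi.
  apply: (IH (fun j => F j.+1)) => //.
  by move=> j jk; exact: F0.
rewrite e exprSr.
have p2 : 0 < t ^+ k * xi ^+ k by rewrite -exprMn exprn_gt0// mulrC.
have xk : xi ^+ k != 0 by rewrite expf_neq0.
have t2 : 0 < t * t by rewrite -expr2 exprn_even_gt0.
have -> : t ^+ k * t * (F 1%N xi * t) =
  (t ^+ k * xi ^+ k) * (xi ^+ k * F 1%N xi) * (t * t) * (xi ^+ k)^-2 by field.
apply: mulr_gt0; last by rewrite invr_gt0 exprn_even_gt0.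
by apply: mulr_gt0 => //; exact: mulr_gt0.
Qed.

(** Leibniz' formula for the j-th derivative of t F(t).  At j = 0 the index j.-1 is
    harmless since its coefficient vanishes. *)
Definition mulX_chain (F : nat -> R -> R) (j : nat) (t : R) : R :=
  t * F j t + j%:R * F j.-1 t.

Lemma mulX_chain_derive (F : nat -> R -> R) (O : set R) :
  (forall j t, O t -> is_derive t 1 (F j) (F j.+1 t)) ->
  forall j t, O t -> is_derive t 1 (mulX_chain F j) (mulX_chain F j.+1 t).
Proof.
move=> dF j t Ot; have h1 := dF j t Ot.
case: j h1 => [|j] h1.
  by apply: is_derive_eq; rewrite /mulX_chain /GRing.scale /=; ring.
have h2 := dF j t Ot.
by apply: is_derive_eq; rewrite /mulX_chain /GRing.scale /= -(natr1 j.+1); ring.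
Qed.

Lemma mulX_chain_order (F : nat -> R -> R) k : (forall j, (j < k)%N -> F j 0 = 0) ->
  forall j, (j < k.+1)%N -> mulX_chain F j 0 = 0.
Proof.
move=> F0 [|j] jk; rewrite /mulX_chain mul0r add0r ?mul0r//.
by rewrite F0 ?mulr0.
Qed.

Lemma iter_mulX (F : nat -> R -> R) (O : set R) k :
  (forall j t, O t -> is_derive t 1 (F j) (F j.+1 t)) ->
  exists G : nat -> R -> R, [/\ forall t, G 0%N t = t ^+ k * F 0%N t,
    forall j t, O t -> is_derive t 1 (G j) (G j.+1 t) &
    forall j, (j < k)%N -> G j 0 = 0].
Proof.
move=> dF; elim: k => [|k [G [G0 dG Gz]]].
  by exists F; split => // t; rewrite expr0 mul1r.
exists (mulX_chain G); split.
- by move=> t; rewrite /mulX_chain mul0r addr0 G0 exprS mulrA.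
- exact: mulX_chain_derive.
- exact: mulX_chain_order.
Qed.

(** The tube lemma over the compact time interval. *)
Lemma uniform_near (Th : normedModType R) (f : R -> Th -> R) (T e : R) :
  (forall t : R, - T <= t <= T -> {for (t, 0), continuous (fun y : R * Th => f y.1 y.2)}) ->
  0 < e -> exists2 rho : R, 0 < rho & forall th, `|th| < rho ->
    forall t : R, - T <= t <= T -> `|f t th - f t 0| < e.
Proof.
move=> cf e0; have e2 : 0 < e / 2 by rewrite divr_gt0.
have /compact_near_coveringP cov := @segment_compact R (- T) T.
have H : \forall th \near (0 : Th), `[- T, T]%classic `<=` (fun t => `|f t th - f t 0| < e).
  apply: cov => t /=; rewrite in_itv /= => tT.
  have /near_pair[d d0 dP] := continuous_lt (cf t tT) e2.
  have b1 := @nbhsx_ballx _ R t d d0; have b2 := @nbhsx_ballx _ Th 0 d d0.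
  exists (ball t d, ball 0 d) => //= -[t' th] /= [bt bth].
  have tt : `|t' - t| < d by rewrite distrC.
  have th0 : `|th - 0| < d by move: bth; rewrite -ball_normE /= distrC.
  have h1 := dP t' th tt th0; have h2 := dP t' 0 tt (_ : `|0 - 0| < d).
  rewrite subrr normr0 /= in h2; have {}h2 := h2 d0.
  have -> : f t' th - f t' 0 = (f t' th - f t 0) - (f t' 0 - f t 0) by ring.
  by apply: le_lt_trans (ler_normB _ _) _; move: h1 h2 => /=; lra.
have /nbhs_ballP[rho /= rho0 HP] := H.
exists rho => // th thr t tT; apply: HP; last by rewrite /= in_itv.
by rewrite -ball_normE /= sub0r normrN.
Qed.

End near_zero.

(** * The contact graph and the active coefficient *)

Section pointwise_continuity.
Context {R : realType} {T : topologicalType}.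
Implicit Types (f g : T -> R) (x : T).

Lemma continuous_at_add f g x : {for x, continuous f} -> {for x, continuous g} ->
  {for x, continuous (fun y => f y + g y)}.
Proof. by move=> cf cg; exact: (continuousD cf cg). Qed.

Lemma continuous_at_mul f g x : {for x, continuous f} -> {for x, continuous g} ->
  {for x, continuous (fun y => f y * g y)}.
Proof. by move=> cf cg; exact: (continuousM cf cg). Qed.

Lemma continuous_at_exp f x k : {for x, continuous f} -> {for x, continuous (fun y => f y ^+ k)}.
Proof.
move=> cf; elim: k => [|k IH]; first exact: cvg_cst.
have -> : (fun y => f y ^+ k.+1) = (fun y => f y * f y ^+ k) by apply/funext => y; rewrite exprS.
exact: continuous_at_mul.
Qed.

Lemma continuous_at_sum n (f : 'I_n -> T -> R) x : (forall i, {for x, continuous (f i)}) ->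
  {for x, continuous (fun y => \sum_(i < n) f i y)}.
Proof.
elim: n f => [|n IH] f cf.
  have -> : (fun y => \sum_(i < 0) f i y) = (fun=> 0) by apply/funext => y; rewrite big_ord0.
  exact: cvg_cst.
have -> : (fun y => \sum_(i < n.+1) f i y) =
    (fun y => \sum_(i < n) f (widen_ord (leqnSn n) i) y + f ord_max y).
  by apply/funext => y; rewrite big_ord_recr.
by apply: continuous_at_add => //; apply: IH.
Qed.

End pointwise_continuity.

Lemma ball0_norm (R : realType) (V : normedModType R) (z : V) (e : R) :
  `|z| < e -> ball (0 : V) e z.
Proof. by move=> ze; rewrite -ball_normE /= sub0r normrN. Qed.

Section passage_facts.
Context {R : realType} (m nu : nat).
Variable Z : prepared_passage R m nu.
Notation Theta := (param R m nu).

Lemma zero_theta : `|0 : Theta| < prho Z.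
Proof. by rewrite normr0; case: (p_pos Z). Qed.

(** Two continuous derivatives give B an I-derivative that is bounded and Lipschitz
    on a common box. *)
Lemma B_local : beta0 Z != 0 -> exists eta C (b : R -> R -> Theta -> R),
  [/\ 0 < eta, 0 <= C,
    (forall t x th, `|t| < eta -> `|x| < eta -> `|th| < eta ->
      [/\ `|pB Z t x th - beta0 Z| < `|beta0 Z| / 2,
          is_derive x 1 (fun x => pB Z t x th) (b t x th) & `|b t x th| <= C]) &
    (forall t x y th, `|t| < eta -> `|x| < eta -> `|y| < eta -> `|th| < eta ->
      `|b t x th - b t y th| <= C * `|x - y|)].
Proof.
move=> beta_n0.
have [U [oU sU cU]] := pB_C2 Z.
pose f (y : R * R * Theta) := pB Z y.1.1 y.1.2 y.2.
pose v : R * R * Theta := (0, 1, 0).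
pose b := fun x => 'D_v f x; pose bb := fun x => 'D_v b x.
have U0 : U (0, 0, 0).
  by apply: sU; have [T0 I0 r0 _ _] := p_pos Z; split => /=; rewrite ?normr0// oppr_le0 !ltW.
have c0 : {for (0, 0, 0), continuous f} by exact: Ck_continuous cU U0.
have cb : {for (0, 0, 0), continuous b} by exact: Ck_continuous (Ck_D v cU) U0.
have cbb : {for (0, 0, 0), continuous bb} by exact: Ck_continuous (Ck_D v (Ck_D v cU)) U0.
have n0 : \forall y \near ((0, 0, 0) : R * R * Theta),
    [/\ U y, `|f y - f (0, 0, 0)| < `|beta0 Z| / 2, `|b y - b (0, 0, 0)| < 1 & `|bb y - bb (0, 0, 0)| < 1].
  have h1 := open_nbhs_nbhs (conj oU U0).
  have h2 := continuous_lt c0 (_ : 0 < `|beta0 Z| / 2).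
  rewrite divr_gt0 ?normr_gt0// in h2; have {}h2 := h2 isT.
  have h3 := continuous_lt cb ltr01; have h4 := continuous_lt cbb ltr01.
  apply: filterS (filterI h1 (filterI h2 (filterI h3 h4))) => y [y1 [y2 [y3 y4]]].
  by split.
have /nbhs_ballP[eta /= eta0 H] := n0.
have inb t x th : `|t| < eta -> `|x| < eta -> `|th| < eta ->
    [/\ U (t, x, th), `|f (t, x, th) - f (0, 0, 0)| < `|beta0 Z| / 2,
      `|b (t, x, th) - b (0, 0, 0)| < 1 & `|bb (t, x, th) - bb (0, 0, 0)| < 1].
  by move=> h1 h2 h3; apply: H; split; [split|]; exact: ball0_norm.
have sl (t x h : R) (th : Theta) : (t, h *: (1 : R) + x, th) = h *: v + (t, x, th).
  congr (_, _, _) => /=; by rewrite scaler0 add0r.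
pose C := `|b (0, 0, 0)| + `|bb (0, 0, 0)| + 1.
have bC t x th : `|t| < eta -> `|x| < eta -> `|th| < eta ->
    `|b (t, x, th)| <= C /\ `|bb (t, x, th)| <= C.
  move=> h1 h2 h3; have [_ _ h4 h5] := inb t x th h1 h2 h3.
  have bound (p q r : R) : 0 <= r -> `|p - q| < 1 -> `|p| <= `|q| + r + 1.
    move=> r0 pq; have := ler_normD (p - q) q; rewrite subrK.
    by move: r0 pq; lra.
  split; first exact: bound.
  by rewrite /C [`|b _| + _]addrC; exact: bound.
exists eta, C, (fun t x th => b (t, x, th)); split; first exact: eta0.
- by rewrite /C !addr_ge0.
- move=> t x th h1 h2 h3; have [Uy fy _ _] := inb t x th h1 h2 h3.
  have df : is_derive (t, x, th) v f (b (t, x, th)) by exact: Ck_derive cU Uy.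
  have [bx _] := bC t x th h1 h2 h3.
  split; [exact: fy| |exact: bx].
  have := @is_derive_along R R (R * R * Theta)%type R f (fun x : R => (t, x, th)) 1 x v _ (fun h => sl t x h th) df.
  exact.
- move=> t x y th h1 h2 h3 h4.
  have db (z : R) : `|z| < eta -> is_derive z 1 (fun z => b (t, z, th)) (bb (t, z, th)).
    move=> h5; have [Uy _ _ _] := inb t z th h1 h5 h4.
    have df : is_derive (t, z, th) v b (bb (t, z, th)) by exact: Ck_derive (Ck_D v cU) Uy.
    have := @is_derive_along R R (R * R * Theta)%type R b (fun x : R => (t, x, th)) 1 z v _ (fun h => sl t z h th) df.
    exact.
  wlog xy : x y h2 h3 / x <= y.
    by move=> W; have [/W->//|/ltW/W h] := leP x y; rewrite distrC [`|x - y|]distrC h.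
  rewrite distrC [`|x - y|]distrC [`|y - x|]ger0_norm ?subr_ge0//.
  have btw (z : R) : x <= z <= y -> `|z| < eta.
    by move: h2 h3; rewrite !ltr_norml => /andP[? ?] /andP[? ?] /andP[? ?]; lra.
  have db' (z : R) : x < z < y -> is_derive z 1 (fun z => b (t, z, th)) (bb (t, z, th)).
    by move=> /andP[z1 z2]; apply/db/btw; rewrite !ltW.
  have cb' : {within `[x, y], continuous (fun z => b (t, z, th))}.
    by apply: (@is_derive_within _ _ (fun z => bb (t, z, th))) => z /=; rewrite in_itv /= => /btw/db.
  have bd (z : R) : x < z < y -> `|bb (t, z, th)| <= C.
    move=> /andP[z1 z2]; have zs : `|z| < eta by apply: btw; rewrite !ltW.
    by have [] := bC t z th h1 zs h4.
  exact: (@derive_lip _ (fun z => b (t, z, th)) (fun z => bb (t, z, th))).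
Qed.

Let Remf (y : R * Theta) := pRem Z y.1 y.2.
Let e1 : R * Theta := (1, 0).

Definition dRem (t : R) (th : Theta) : R := 'D_e1 Remf (t, th).

Definition dPhi (t : R) (th : Theta) : R :=
  pa Z th * (nu%:R * t ^+ nu.-1) + \sum_(j < nu - 2) th.2 ord0 j * (j.+1%:R * t ^+ j)
  + (nu.+1%:R * t ^+ nu * pRem Z t th + t ^+ nu.+1 * dRem t th).

Lemma Rem_facts (t : R) (th : Theta) : - pT Z <= t <= pT Z -> `|th| < prho Z ->
  [/\ {for (t, th), continuous Remf},
      {for (t, th), continuous (fun y : R * Theta => dRem y.1 y.2)} &
      is_derive t 1 (fun t => pRem Z t th) (dRem t th)].
Proof.
move=> tT thr; have [U [oU sU cU]] := pRem_smooth Z.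
have Ut : U (t, th) by apply: sU.
split.
- exact: Ck_continuous (cU 0) Ut.
- have -> : (fun y : R * Theta => dRem y.1 y.2) = (fun y => 'D_e1 Remf y).
    by apply/funext => -[].
  exact: Ck_continuous (Ck_D e1 (cU 1%N)) Ut.
- apply: (@is_derive_along _ _ _ _ Remf (fun t => (t, th)) _ _ e1).
    by move=> h; congr (_, _) => /=; rewrite scaler0 add0r.
  exact: Ck_derive (cU 1%N) Ut.
Qed.

Lemma continuous_at_fst (y : R * Theta) : {for y, continuous (fun y : R * Theta => y.1)}.
Proof. exact: cvg_fst. Qed.

Lemma continuous_at_coord (y : R * Theta) j :
  {for y, continuous (fun y : R * Theta => y.2.2 ord0 j)}.
Proof.
have c1 : {for y, continuous (fun y : R * Theta => y.2.2)}.
  exact: (cvg_comp _ _ (@cvg_snd _ _ _ _ _) (@cvg_snd _ _ _ _ _)).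
have c2 : {for y.2.2, continuous (fun u : 'rV[R]_(nu - 2) => u ord0 j)}.
  exact: coord_continuous.
exact: (@continuous_comp _ _ _ (fun y : R * Theta => y.2.2) _ y c1 c2).
Qed.

Lemma continuous_at_a (y : R * Theta) : `|y.2| < prho Z ->
  {for y, continuous (fun y : R * Theta => pa Z y.2)}.
Proof.
move=> yr; have [U [oU sU cU]] := pa_smooth Z.
have c1 : {for y.2, continuous (pa Z)} by apply: Ck_continuous (cU 0) _; exact: sU.
have c2 : {for y, continuous (fun y : R * Theta => y.2)} by exact: cvg_snd.
exact: (@continuous_comp _ _ _ (fun y : R * Theta => y.2) _ y c2 c1).
Qed.

Lemma continuous_at_cst (y : R * Theta) (k : R) : {for y, continuous (fun _ : R * Theta => k)}.
Proof. exact: cvg_cst. Qed.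

Lemma continuous_at_Phi (t : R) (th : Theta) : - pT Z <= t <= pT Z -> `|th| < prho Z ->
  {for (t, th), continuous (fun y : R * Theta => Phi Z y.2 y.1)}.
Proof.
move=> tT thr; have [cR _ _] := Rem_facts tT thr.
apply: continuous_at_add; first apply: continuous_at_add.
- by apply: continuous_at_mul; [exact: continuous_at_a|apply/continuous_at_exp/continuous_at_fst].
- by apply: continuous_at_sum => j; apply: continuous_at_mul; [exact: continuous_at_coord|apply/continuous_at_exp/continuous_at_fst].
- by apply: continuous_at_mul => //; apply/continuous_at_exp/continuous_at_fst.
Qed.

Lemma continuous_at_dPhi (t : R) (th : Theta) : - pT Z <= t <= pT Z -> `|th| < prho Z ->
  {for (t, th), continuous (fun y : R * Theta => dPhi y.1 y.2)}.
Proof.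
move=> tT thr; have [cR cdR _] := Rem_facts tT thr.
apply: continuous_at_add; first apply: continuous_at_add.
- apply: continuous_at_mul; first exact: continuous_at_a.
  by apply: continuous_at_mul; [exact: continuous_at_cst|apply/continuous_at_exp/continuous_at_fst].
- apply: continuous_at_sum => j; apply: continuous_at_mul; first exact: continuous_at_coord.
  by apply: continuous_at_mul; [exact: continuous_at_cst|apply/continuous_at_exp/continuous_at_fst].
- apply: continuous_at_add; apply: continuous_at_mul => //; last by apply/continuous_at_exp/continuous_at_fst.
  by apply: continuous_at_mul; [exact: continuous_at_cst|apply/continuous_at_exp/continuous_at_fst].
Qed.

Lemma Phi_derive (t : R) (th : Theta) : - pT Z <= t <= pT Z -> `|th| < prho Z ->
  is_derive t 1 (Phi Z th) (dPhi t th).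
Proof.
move=> tT thr; have [_ _ dR] := Rem_facts tT thr.
have dX (k : nat) : is_derive t 1 (fun t : R => t ^+ k) (k%:R * t ^+ k.-1).
  elim: k => [|k IH]; first by rewrite mul0r; exact: is_derive_cst.
  have -> : (fun t : R => t ^+ k.+1) = (fun t => t * t ^+ k) by apply/funext => s; rewrite exprS.
  apply: is_derive_eq; rewrite /GRing.scale /= mulr1 -(natr1 k) mulrDl mul1r; congr (_ + _).
  by case: (k) => [|k']; rewrite ?mul0r ?mulr0// exprS mulrCA.
have d1 : is_derive t 1 (fun t => pa Z th * t ^+ nu) (pa Z th * (nu%:R * t ^+ nu.-1)).
  by have h := dX nu; apply: is_derive_eq.
have d2 : is_derive t 1 (fun t => \sum_(j < nu - 2) th.2 ord0 j * t ^+ j.+1)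
    (\sum_(j < nu - 2) th.2 ord0 j * (j.+1%:R * t ^+ j)).
  have -> : (fun t => \sum_(j < nu - 2) th.2 ord0 j * t ^+ j.+1) =
      \sum_(j < nu - 2) (fun t : R => th.2 ord0 j * t ^+ j.+1).
    by apply/funext => s; rewrite fct_sumE.
  by apply: is_derive_sum => j; have h := dX j.+1; apply: is_derive_eq.
have d3 : is_derive t 1 (fun t => t ^+ nu.+1 * pRem Z t th)
    (nu.+1%:R * t ^+ nu * pRem Z t th + t ^+ nu.+1 * dRem t th).
  have h := dX nu.+1; apply: is_derive_eq; rewrite /GRing.scale /=; ring.
exact: is_deriveD.
Qed.

Lemma dPhi0 : (2 <= nu)%N -> dPhi 0 0 = 0.
Proof.
move=> nu2; rewrite /dPhi !expr0n -subn1.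
have -> : (nu - 1 == 0)%N = false by apply/negbTE; rewrite subn_eq0 -ltnNge.
have -> : (nu == 0)%N = false by apply/negbTE; rewrite -lt0n (leq_trans _ nu2).
rewrite !mulr0 !mul0r addr0 add0r addr0 big1// => j _.
by rewrite mxE mul0r.
Qed.

Lemma Phi_central (t : R) (p : 'rV[R]_m) :
  Phi Z (p, 0) t = t ^+ nu * (pa Z (p, 0) + t * pRem Z t (p, 0)).
Proof.
rewrite /Phi /contact_graph /= big1; last by move=> j _; rewrite mxE mul0r.
by rewrite addr0 exprS; ring.
Qed.

Lemma dPhi_central (t : R) (p : 'rV[R]_m) : (0 < nu)%N ->
  t * dPhi t (p, 0) = t ^+ nu * (nu%:R * pa Z (p, 0) + nu.+1%:R * t * pRem Z t (p, 0)
    + t ^+ 2 * dRem t (p, 0)).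
Proof.
move=> nu0; rewrite /dPhi /= big1; last by move=> j _; rewrite mxE mul0r.
rewrite addr0.
have e : t ^+ nu = t * t ^+ nu.-1 by rewrite -exprS prednK.
rewrite [t ^+ nu.+1]exprS !e; move: (t ^+ nu.-1) (dRem _ _) (pRem Z _ _) (pa Z _) => u dr pr a.
by ring.
Qed.

(** On the central slice the graph is t^nu times a function that is positive near the
    origin, and nu is even. *)
Lemma Phi_central_local : (2 <= nu)%N -> ~~ odd nu -> exists2 eta : R, 0 < eta &
  forall (t : R) (p : 'rV[R]_m), `|t| < eta -> `|p| < eta ->
    0 <= Phi Z (p, 0) t /\ (t != 0 -> 0 < t * dPhi t (p, 0)).
Proof.
move=> nu2 nu_even; have nu0 : (0 < nu)%N by exact: leq_trans nu2.
have [T0 I0 r0 _ _] := p_pos Z.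
have T0' : - pT Z <= (0 : R) <= pT Z by rewrite oppr_le0 !ltW.
have [cR cdR _] := Rem_facts T0' zero_theta.
have ca := @continuous_at_a (0, 0) zero_theta.
have a0 := pa_gt0 Z.
pose g1 (y : R * Theta) := pa Z y.2 + y.1 * Remf y.
pose g2 (y : R * Theta) := nu%:R * pa Z y.2 + nu.+1%:R * y.1 * Remf y + y.1 ^+ 2 * dRem y.1 y.2.
have cg1 : {for (0, 0), continuous g1}.
  apply: (continuous_at_add ca); apply: continuous_at_mul; [exact: continuous_at_fst|exact: cR].
have cg2 : {for (0, 0), continuous g2}.
  apply: continuous_at_add; first apply: continuous_at_add.
  - by apply: continuous_at_mul; [exact: continuous_at_cst|exact: ca].
  - by apply: continuous_at_mul; [apply: continuous_at_mul; [exact: continuous_at_cst|exact: continuous_at_fst]|exact: cR].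
  - by apply: continuous_at_mul; [apply/continuous_at_exp/continuous_at_fst|exact: cdR].
have p1 : 0 < g1 (0, 0) by rewrite /g1 /= mul0r addr0.
have p2 : 0 < g2 (0, 0).
  by rewrite /g2 /= mulr0 mul0r expr0n mul0r !addr0 mulr_gt0// ltr0n.
have n1 : \forall y \near (0 : R, 0 : Theta), 0 < g1 y /\ 0 < g2 y.
  have h1 := continuous_lt cg1 p1; have h2 := continuous_lt cg2 p2.
  apply: filterS (filterI h1 h2) => y []; rewrite !ltr_norml => /andP[? _] /andP[? _].
  by split; lra.
have [eta eta0 H] := near_pair n1.
exists eta => // t p te pe.
have pe' : `|((p, 0) : Theta) - 0| < eta.
  by rewrite subr0 prod_normE /= normr0 gt_max pe.
have te' : `|t - 0| < eta by rewrite subr0.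
have [h1 h2] := H t (p, 0) te' pe'.
split; first by rewrite Phi_central mulr_ge0 ?exprn_even_ge0// ltW.
by move=> t0; rewrite dPhi_central// mulr_gt0// exprn_even_gt0// t0 orbT.
Qed.

(** At the central parameter the graph vanishes to order nu at t = 0, so the lower
    bound for its nu-th derivative gives its sign on the whole box. *)
Lemma Phi0_gt0 : ~~ odd nu -> forall t : R, - pT Z <= t <= pT Z -> t != 0 -> 0 < Phi Z 0 t.
Proof.
move=> nu_even t tT t0.
have [T0 I0 r0 _ k0] := p_pos Z.
have [U [oU sU cU]] := pRem_smooth Z.
pose O := [set t : R | U (t, 0)].
have oO : open O.
  rewrite openE => s Os; rewrite /interior.
  have /nbhs_ballP[d /= d0 H] := open_nbhs_nbhs (conj oU Os).
  apply/nbhs_ballP; exists d => // s' ss'; apply: H; split => //=; exact: ballxx.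
have TO (s : R) : - pT Z <= s <= pT Z -> O s by move=> sT; apply: sU; split; rewrite //= normr0.
pose F (j : nat) (t : R) := iterD e1 j Remf (t, 0).
have dF j (s : R) : O s -> is_derive s 1 (F j) (F j.+1 s).
  move=> Os; apply: (@is_derive_along _ _ _ _ (iterD e1 j Remf) (fun t => (t, 0)) _ _ e1).
    by move=> h; congr (_, _) => /=; rewrite scaler0 add0r.
  exact: iterD_derive cU Os.
pose H (j : nat) (t : R) := mulX_chain F j t + (if j == 0%N then pa Z 0 else 0).
have dH j (s : R) : O s -> is_derive s 1 (H j) (H j.+1 s).
  by move=> Os; have h := mulX_chain_derive dF j Os; apply: is_derive_eq.
have [G [G0 dG Gz]] := iter_mulX nu dH.
have Phi_G (s : R) : O s -> Phi Z 0 s = G 0%N s.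
  by move=> _; rewrite (Phi_central s 0) G0 /H /mulX_chain mul0r addr0 /= [pa Z _ + _]addrC.
have dPhiG := chain_derive1n oO Phi_G dG.
have /(_ _ tT t0) : forall t : R, - pT Z <= t <= pT Z -> t != 0 -> 0 < t ^+ nu * G 0%N t.
  apply: zero_order => // [j s sT|s sT]; first exact/dG/TO.
  rewrite -dPhiG; last exact: TO.
  have := @pPhi_derivative _ _ _ Z 0 s zero_theta; rewrite ler_norml => /(_ sT).
  exact: lt_le_trans.
rewrite -Phi_G; last exact: TO.
by rewrite pmulr_rgt0// exprn_even_gt0// t0 orbT.
Qed.

End passage_facts.

(** * Uniform constants for the passage *)

Section germ.
Context {R : realType} (m nu : nat).
Variable Z : prepared_passage R m nu.
Notation Theta := (param R m nu).
Hypotheses (nu2 : (2 <= nu)%N) (nu_even : ~~ odd nu) (beta_n0 : beta0 Z != 0).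

Lemma expR_le_9_8 (x : R) : x <= 9^-1 -> expR x <= 9 / 8.
Proof.
move=> x9; have h := expR_ge1Dx (- x).
have e0 := expR_gt0 x; have : expR x * expR (- x) = 1 by rewrite -expRD subrr expR0.
have : expR x * (8 / 9) <= expR x * expR (- x) by rewrite ler_wpM2l ?(ltW e0)//; lra.
lra.
Qed.

(** The order of the choices matters.  First eps, small enough for m / (16 eps) to
    exceed any prescribed modulus; then tau, with |Phi'| < eps in the window, possible
    because the graph is flat at the central contact; then eta, below the height of
    the central graph outside the window; and only then the radius r of the parameter
    ball and of the entering heights. *)
Lemma kinked_germ (etamax K : R) : 0 < etamax -> 0 < K ->
  exists (tau eta r mm M C eps sigma : R) (b : R -> R -> Theta -> R),
  [/\ [/\ 0 < r, r <= prho Z, 0 < eta, eta <= etamax & 0 < sigma * beta0 Z],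
      expR (2 * tau * (M + C)) <= 9 / 8,
      K <= mm / (16 * eps) - 8 * C * pT Z,
      (forall th, `|th| < r ->
        kinked_passage (pT Z) tau eta r mm M C eps sigma (Phi Z th) (fun t => dPhi Z t th)
          (fun t x => pB Z t x th) (fun t x => b t x th) (psol Z th)) &
      forall p : 'rV[R]_m, `|p| < r ->
        (forall t : R, - pT Z <= t <= pT Z -> 0 <= Phi Z (p, 0) t) /\
        (forall t : R, - tau < t < tau -> t != 0 -> 0 < t * dPhi Z t (p, 0))].
Proof.
move=> em0 K0.
have [T0 I0 rho0 rhoI k0] := p_pos Z.
set T := pT Z in T0 *.
have [eta0 [C [b [eta00 C0 Bl bl]]]] := B_local beta_n0.
have ab0 : 0 < `|beta0 Z| by rewrite normr_gt0.
pose sigma : R := if 0 < beta0 Z then 1 else -1.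
have hsig : sigma = 1 \/ sigma = -1 by rewrite /sigma; case: ifP; [left|right].
have sb : sigma * beta0 Z = `|beta0 Z|.
  rewrite /sigma; case: ltP => h; first by rewrite mul1r gtr0_norm.
  by rewrite mulN1r ler0_norm.
pose mm := `|beta0 Z| / 2; pose M := 2 * `|beta0 Z|.
have mm0 : 0 < mm by rewrite divr_gt0.
have M0 : 0 <= M by rewrite mulr_ge0.
have CT0 : 0 <= 8 * C * T by rewrite !mulr_ge0// ltW.
have den0 : 0 < K + 8 * C * T by rewrite ltr_wpDr.
pose eps := mm / (16 * (K + 8 * C * T)).
have eps0 : 0 < eps by rewrite divr_gt0// mulr_gt0.
have T0' : - T <= (0 : R) <= T by rewrite oppr_le0 !ltW.
have r00 : `|0 : Theta| < prho Z by exact: zero_theta.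
have [eta1 eta10 dP] : exists2 e : R, 0 < e & forall (t : R) (th : Theta), `|t| < e -> `|th| < e ->
    `|dPhi Z t th| < eps.
  have [e e0 H] := near_pair (continuous_lt (continuous_at_dPhi T0' r00) eps0).
  exists e; first exact: e0.
  by move=> t th te the; have := H t th; rewrite !subr0 /= dPhi0// subr0; apply.
have [eta2 eta20 cP] := Phi_central_local Z nu2 nu_even.
have MC : 0 < 18 * (M + C + 1) by rewrite mulr_gt0// ltr_wpDl// addr_ge0.
have iMC : 0 < (18 * (M + C + 1))^-1 by rewrite invr_gt0.
pose tau := Num.min (Num.min eta0 eta1) (Num.min eta2 (Num.min T (18 * (M + C + 1))^-1)).
have [tau0 tl0 tl1 tl2 [tlT tlL]] : [/\ 0 < tau, tau <= eta0, tau <= eta1, tau <= eta2 & tau <= T /\ tau <= (18 * (M + C + 1))^-1].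
  by rewrite /tau !lt_min !ge_min !lexx !orbT eta00 eta10 eta20 T0 iMC.
have ratio : expR (2 * tau * (M + C)) <= 9 / 8.
  apply: expR_le_9_8.
  have : tau * (18 * (M + C + 1)) <= 1 by rewrite -ler_pdivlMr// mul1r.
  by have := mulr_ge0 (ltW tau0) (addr_ge0 M0 C0); lra.
have [m0 m00 m0P] : exists2 m0 : R, 0 < m0 & forall t : R, - T <= t <= T -> ~~ (- tau < t < tau) -> m0 <= Phi Z 0 t.
  pose A := `[- T, T]%classic `&` ~` [set t : R | - tau < t < tau].
  have cA : compact A.
    apply: compact_closedI; first exact: segment_compact.
    apply: open_closedC.
    have -> : [set t : R | - tau < t < tau] = `]- tau, tau[%classic.
      by apply/seteqP; split => t /=; rewrite in_itv.
    exact: interval_open.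
  have A0 : A !=set0.
    exists T; split; first by rewrite /= in_itv /= lexx andbT; lra.
    by apply/negP; rewrite negb_and -!leNgt tlT orbT.
  have cPhi : {within A, continuous (Phi Z 0)}.
    apply: (@is_derive_within _ _ (fun t => dPhi Z t 0)) => t [/=]; rewrite in_itv /= => tT _.
    exact: Phi_derive.
  have [c cA' cmin] := compact_EVT_min A0 cA cPhi.
  rewrite inE in cA'; case: cA' => /=; rewrite in_itv /= => cT cn.
  exists (Phi Z 0 c).
    apply: Phi0_gt0 => //; apply/eqP => c0; apply: cn.
    by rewrite c0 oppr_lt0 tau0.
  move=> t tT tn; apply: cmin; rewrite inE; split; first by rewrite /= in_itv.
  exact/negP.
have m02 : 0 < m0 / 2 by rewrite divr_gt0.
have h2 : (0 : R) < 2^-1 by rewrite invr_gt0.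
pose eta := Num.min (Num.min etamax eta0) (Num.min (m0 / 2) 2^-1).
have [e0 ee1 ee2 ee3 ee4] : [/\ 0 < eta, eta <= etamax, eta <= eta0, eta <= m0 / 2 & eta <= 2^-1].
  by rewrite /eta !lt_min !ge_min !lexx !orbT em0 eta00 m02 h2.
have MT : 0 <= M * T by rewrite mulr_ge0// ltW.
pose del := eta * expR (- (4 * M * T)) / 2.
have del0 : 0 < del by rewrite divr_gt0// mulr_gt0// expR_gt0.
have del_eta : del <= eta / 2.
  by rewrite ler_wpM2r// ler_piMr ?(ltW e0)// -expR0 ler_expR oppr_le0 -mulrA mulr_ge0.
have del_sq : (del ^+ 2 + del ^+ 2) * expR (8 * M * T) < eta ^+ 2.
  have -> : (del ^+ 2 + del ^+ 2) * expR (8 * M * T) = eta ^+ 2 / 2 *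
     (expR (- (4 * M * T)) * expR (- (4 * M * T)) * expR (8 * M * T)) by rewrite /del; field.
  rewrite -!expRD.
  have -> : - (4 * M * T) + - (4 * M * T) + 8 * M * T = 0 by ring.
  by rewrite expR0 mulr1; have := exprn_gt0 2 e0; lra.
have [rho1 rho10 unif] := @uniform_near R Theta (fun t th => Phi Z th t) T del
  (fun t tT => continuous_at_Phi tT r00) del0.
pose r := Num.min (Num.min del (prho Z)) (Num.min (Num.min rho1 eta0) (Num.min eta1 eta2)).
have [r0 r1 r2 r3 [r4 [r5 r6]]] : [/\ 0 < r, r <= del, r <= prho Z, r <= rho1 & r <= eta0 /\ r <= eta1 /\ r <= eta2].
  by rewrite /r !lt_min !ge_min !lexx !orbT del0 rho0 rho10 eta00 eta10 eta20.
have Phi0_ge0 (t : R) : - T <= t <= T -> 0 <= Phi Z 0 t.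
  move=> tT; have [->|t0] := eqVneq t 0; last by rewrite ltW// Phi0_gt0.
  by rewrite (Phi_central Z 0 0) expr0n gtn_eqF ?mul0r// (leq_trans _ nu2).
have near_abs (t : R) : - tau < t < tau -> `|t| < tau by rewrite ltr_norml.
have Bm (t x : R) th : - tau < t < tau -> `|x| < eta -> `|th| < r -> mm <= sigma * pB Z t x th <= M.
  move=> tt xe thr.
  have [h1 _ _] := Bl t x th (lt_le_trans (near_abs t tt) tl0) (lt_le_trans xe ee2) (lt_le_trans thr r4).
  have : `|sigma * (pB Z t x th - beta0 Z)| < `|beta0 Z| / 2.
    by rewrite normrM; case: hsig => ->; rewrite ?normrN normr1 mul1r.
  rewrite mulrBr sb ltr_norml /mm /M => /andP[a1 a2].
  by clear -a1 a2; lra.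
have far (t : R) th : - T <= t <= T -> `|th| < r -> ~~ (- tau < t < tau) -> eta < Phi Z th t.
  move=> tT thr tn; have := unif th (lt_le_trans thr r3) t tT; rewrite ltr_norml => /andP[h _].
  have := m0P t tT tn; move: h ee3 del_eta e0.
  by move: (Phi Z th t) (Phi Z 0 t) => u v; clear; lra.
have low (t : R) th : - T <= t <= T -> `|th| < r -> - del <= Phi Z th t.
  move=> tT thr; have := unif th (lt_le_trans thr r3) t tT; rewrite ltr_norml => /andP[h _].
  have := Phi0_ge0 t tT; move: h.
  by move: (Phi Z th t) (Phi Z 0 t) => u v; clear; lra.
have nT (t : R) : - tau < t < tau -> - T <= t <= T.
  by move=> /andP[t1 t2]; move: t1 t2 tlT; clear; lra.
exists tau, eta, r, mm, M, C, eps, sigma, b; split.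
- by split; rewrite // sb.
- exact: ratio.
- rewrite le_eqVlt; apply/orP; left; apply/eqP; rewrite /eps -/T.
  by move: (den0) (mm0) => d0' mm0'; field; rewrite !gt_eqF.
- move=> th thr.
  have thrho : `|th| < prho Z by exact: lt_le_trans r2.
  have small q : `|q| < r -> forall t : R, - T <= t <= T -> `|psol Z th q t| < eta.
    move=> qr; have [h1 h2' _ h4] := psol_solution thrho (lt_le_trans qr r2).
    apply: (@apriori _ T M eta del (Phi Z th) (fun t x => pB Z t x th) _ T0 M0 e0 (ltW del0) h2' h4).
    * by move=> s sT; exact: low.
    * move=> s y sT ye; have [st|st] := boolP (- tau < s < tau); last by left; exact/ltW/far.
      right; have /andP[] := Bm s y th st ye thr; move: mm0.
      by case: hsig => ->; rewrite ler_norml ?mul1r ?mulN1r; move: (pB _ _ _ _); clear => *; lra.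
    * rewrite h1; apply: le_lt_trans del_sq; rewrite ler_wpM2r ?expR_ge0// lerD2r.
      rewrite -[q ^+ 2]real_normK ?num_real// ler_pXn2r ?nnegrE ?normr_ge0 ?(ltW del0)//.
      exact: ltW (lt_le_trans qr r1).
  have Bl' (t x : R) : - tau < t < tau -> `|x| < eta ->
      is_derive x 1 (fun x => pB Z t x th) (b t x th) /\ `|b t x th| <= C.
    move=> tt xe.
    by have [] := Bl t x th (lt_le_trans (near_abs t tt) tl0) (lt_le_trans xe ee2) (lt_le_trans thr r4).
  constructor.
  + exact: tau0.
  + exact: tlT.
  + exact: mm0.
  + exact: M0.
  + exact: C0.
  + exact: eps0.
  + exact: hsig.
  + by move: r1 del_eta e0; clear; lra.
  + apply: (@is_derive_within _ _ (fun t => dPhi Z t th)) => t /=; rewrite in_itv /= => tT.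
    exact: Phi_derive.
  + move=> t tt; split; first by apply: Phi_derive => //; exact: nT.
    by apply/ltW/dP; [exact: lt_le_trans (near_abs t tt) tl1|exact: lt_le_trans r5].
  + by move=> t tT; exact: far.
  + move=> t x tt; have := low t th (nT t tt) thr; rewrite ltr_norml => h /andP[_ h'].
    by move: h h' del_eta ee4; move: (Phi Z th t); clear => u; lra.
  + by move=> t x tt xe; exact: Bm.
  + by move=> t x tt xe; have [] := Bl' t x tt xe.
  + by move=> t x tt xe; have [] := Bl' t x tt xe.
  + move=> t x y tt xe ye; apply: bl.
    * exact: lt_le_trans (near_abs t tt) tl0.
    * exact: lt_le_trans ee2.
    * exact: lt_le_trans ee2.
    * exact: lt_le_trans r4.
  + by move=> q qr; have [] := psol_solution thrho (lt_le_trans qr r2).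
  + by move=> q qr; have [] := psol_solution thrho (lt_le_trans qr r2).
  + move=> q t qr tT; have [_ _ _ h] := psol_solution thrho (lt_le_trans qr r2).
    exact: h.
  + by move=> q t qr; exact: small.
- move=> p pr; split => [t tT|t tt t0].
    have [tt|tt] := boolP (- tau < t < tau).
      by have [] := cP t p (lt_le_trans (near_abs t tt) tl2) (lt_le_trans pr r6).
    have pr' : `|((p, 0) : Theta)| < r by rewrite prod_normE /= normr0 gt_max pr.
    by rewrite ltW// (lt_trans e0)// far.
  have [_ h] := cP t p (lt_le_trans (near_abs t tt) tl2) (lt_le_trans pr r6).
  exact: h.
Qed.

End germ.

(** * Contacts on the central slice *)

Section logarithm_and_crossings.
Context {R : realType}.

Lemma log_gap_le (a b : R) : 0 < a -> 0 < b -> b * (ln a - ln b) <= a - b.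
Proof.
move=> a0 b0; have h := expR_ge1Dx (ln a - ln b).
rewrite expRD expRN !lnK ?posrE// in h.
have := ler_wpM2l (ltW b0) h; have -> : b * (a / b) = a by field; rewrite gt_eqF.
lra.
Qed.

(** Between two upcrossings there is a first zero after a positive value, and W cannot
    cross upwards there. *)
Lemma upcrossing_unique (W dW : R -> R) (z1 z2 : R) : z1 < z2 ->
  {within `[z1, z2], continuous W} -> W z1 = 0 -> W z2 = 0 ->
  (forall z, z1 <= z <= z2 -> W z = 0 -> is_derive z 1 W (dW z) /\ 0 < dW z) -> False.
Proof.
move=> z12 cW W1 W2 dWP.
have sgn (z : R) : z1 <= z <= z2 -> W z = 0 ->
    exists2 d, 0 < d & forall x, x != z -> `|x - z| < d -> 0 < W x / (x - z).
  move=> zz Wz; have [dz pz] := dWP z zz Wz.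
  have e : derive1 W z = dW z by rewrite derive1E; exact: derive_val.
  have [d d0 dP] := derive1_eps (@ex_derive _ _ _ _ _ _ _ dz) pz.
  exists d => // x xz xd; have := dP x xz xd.
  by rewrite e Wz subr0 ltr_norml => /andP[h _]; lra.
have z11 : z1 <= z1 <= z2 by rewrite lexx ltW.
have [d d0 dP] := sgn z1 z11 W1.
pose x := z1 + Num.min (d / 2) ((z2 - z1) / 2).
have m1 : 0 < Num.min (d / 2) ((z2 - z1) / 2) by rewrite lt_min !divr_gt0// subr_gt0.
have m2 : Num.min (d / 2) ((z2 - z1) / 2) <= d / 2 by rewrite ge_min lexx.
have m3 : Num.min (d / 2) ((z2 - z1) / 2) <= (z2 - z1) / 2 by rewrite ge_min lexx orbT.
have ex : x - z1 = Num.min (d / 2) ((z2 - z1) / 2) by rewrite /x; ring.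
have Wx : 0 < W x.
  have := dP x; rewrite -subr_eq0 ex gtr0_norm// gt_eqF// => /(_ isT) h.
  have {}h := h ltac:(lra).
  by rewrite pmulr_lgt0 ?invr_gt0// in h.
have xz2 : x < z2 by move: ex; lra.
have z1x : z1 <= x by move: ex; lra.
have cW' : {within `[x, z2], continuous W} by apply: within_itvS cW.
have [s [/andP[s1 s2] s3 s4]] := first_hit (ltW xz2) cW' Wx (ltac:(by rewrite W2) : W z2 <= 0).
have ss : z1 <= s <= z2 by rewrite s2 (le_trans z1x)// ltW.
have [d' d'0 dP'] := sgn s ss s3.
pose y := s - Num.min (d' / 2) ((s - x) / 2).
have n1 : 0 < Num.min (d' / 2) ((s - x) / 2) by rewrite lt_min !divr_gt0// subr_gt0.
have n2 : Num.min (d' / 2) ((s - x) / 2) <= d' / 2 by rewrite ge_min lexx.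
have n3 : Num.min (d' / 2) ((s - x) / 2) <= (s - x) / 2 by rewrite ge_min lexx orbT.
have ey : y - s = - Num.min (d' / 2) ((s - x) / 2) by rewrite /y; ring.
have Wy : 0 < W y by apply: s4; move: ey; lra.
have yl : y - s < 0 by rewrite ey oppr_lt0.
have := dP' y; rewrite -subr_eq0 lt_eqF// => /(_ isT) h.
have yd : `|y - s| < d' by rewrite ltr0_norm// ey opprK; lra.
have := h yd; rewrite nmulr_lgt0 ?invr_lt0// => h'.
by have := lt_trans h' Wy; rewrite ltxx.
Qed.

End logarithm_and_crossings.

Section central_contact.
Context {R : realType}.
Variables (T tau eta r m M C eps sigma : R).
Variables (Phi dPhi : R -> R) (B b I : R -> R -> R).
Hypothesis kp : kinked_passage T tau eta r m M C eps sigma Phi dPhi B b I.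
Hypothesis Phi_ge0 : forall t : R, - T <= t <= T -> 0 <= Phi t.
Hypothesis Phi00 : Phi 0 = 0.
Hypothesis dPhi_sign : forall t : R, - tau < t < tau -> t != 0 -> 0 < t * dPhi t.

Variable q : R.
Hypotheses (qr : `|q| < r) (q0 : 0 < q).
Let W (t : R) := I q t - Phi t.

Lemma contact_time (t : R) : - T <= t <= T -> W t = 0 -> - tau < t < tau.
Proof.
move=> tT Wt; apply/negPn/negP => /(kp_far kp tT).
have := kp_small kp qr tT; rewrite ltr_norml => /andP[_ h1] h2.
by move: Wt; rewrite /W => /eqP; rewrite subr_eq0 => /eqP e; move: h2; rewrite -e ltNge ltW.
Qed.

(** The orbit of the height 0 rests until time 0 and stays below that of q. *)
Lemma center_active : 0 < W 0.
Proof.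
have T0 := T_gt0 kp; have r0 : `|0 : R| < r by rewrite normr0 (le_lt_trans _ qr).
have z0 : - T <= (0 : R) <= T by rewrite oppr_le0 !ltW.
rewrite /W Phi00 subr0.
have := gap_gt0 kp r0 qr q0 z0; rewrite (rests_below kp r0 _ (s := 0) _)//.
- by rewrite subr0.
- by move=> t /andP[t1 t2]; apply: Phi_ge0; rewrite t1 (le_trans t2)// ltW.
- by case/andP: z0 => -> _ /=.
Qed.

(** At a contact the orbit has speed zero, hence only the slope of the graph matters. *)
Lemma contact_derive (t : R) : - T <= t <= T -> W t = 0 ->
  is_derive t 1 W (- dPhi t).
Proof.
move=> tT Wt; have tt := contact_time tT Wt.
have h1 := kp_sol kp qr (near_time kp tt); have [h2 _] := kp_dPhi kp tt.
have h3 := is_deriveB h1 h2; rewrite -/(W t) Wt maxxx mul0r sub0r in h3.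
exact: h3.
Qed.

Lemma W_within (a c : R) : - T <= a -> c <= T -> {within `[a, c], continuous W}.
Proof.
move=> aT cT; apply: (within_itvS aT cT); apply: within_sub.
  by apply: (kp_cont kp).
exact: kp_Phi_cont kp.
Qed.

Lemma contact_left (z1 z2 : R) : - T <= z1 -> z1 < z2 -> z2 < 0 -> W z1 = 0 -> W z2 = 0 -> False.
Proof.
move=> Tz z12 z20 W1 W2; have T0 := T_gt0 kp.
apply: (@upcrossing_unique _ W (fun t => - dPhi t) z1 z2) => //.
  by apply: W_within => //; lra.
move=> z /andP[h1 h2] Wz; have zT : - T <= z <= T by lra.
split; first exact: contact_derive.
have zn : z < 0 by lra.
have := dPhi_sign (contact_time zT Wz) (negbT (lt_eqF zn)).
by rewrite nmulr_rgt0// oppr_gt0.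
Qed.

Lemma contact_right (z1 z2 : R) : 0 < z1 -> z1 < z2 -> z2 <= T -> W z1 = 0 -> W z2 = 0 -> False.
Proof.
move=> z10 z12 zT W1 W2; have T0 := T_gt0 kp.
apply: (@upcrossing_unique _ (fun t => - W t) (fun t => dPhi t) z1 z2) => //.
- by apply/within_opp/W_within => //; lra.
- by rewrite W1 oppr0.
- by rewrite W2 oppr0.
- move=> z /andP[h1 h2] /eqP; rewrite oppr_eq0 => /eqP Wz; have zT' : - T <= z <= T by lra.
  have zp : 0 < z by lra.
  split; first by have := is_deriveN (contact_derive zT' Wz); rewrite opprK.
  have := dPhi_sign (contact_time zT' Wz) (negbT (gt_eqF zp)).
  by rewrite pmulr_rgt0.
Qed.

(** The central graph falls before time 0 and rises afterwards, so I - Phi only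
    crosses zero upwards before time 0 and downwards afterwards: at most one contact on
    each side. *)
Lemma two_contacts : exists s1 s2 : R, forall t : R, - T <= t <= T ->
  t != s1 -> t != s2 -> I q t != Phi t.
Proof.
have [s1 h1] : exists s1, forall t : R, - T <= t <= T -> t < 0 -> t != s1 -> W t != 0.
  have [[s [sT s0 Ws]]|no] := pselect (exists s : R, [/\ - T <= s, s < 0 & W s = 0]).
    exists s => t /andP[tT _] t0 ts; apply/eqP => Wt.
    have [lt|gt|e] := ltgtP t s; last by rewrite e eqxx in ts.
      exact: (contact_left tT lt s0 Wt Ws).
    exact: (contact_left sT gt t0 Ws Wt).
  by exists 0 => t /andP[tT _] t0 _; apply/eqP => Wt; apply: no; exists t.
have [s2 h2] : exists s2, forall t : R, - T <= t <= T -> 0 < t -> t != s2 -> W t != 0.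
  have [[s [sT s0 Ws]]|no] := pselect (exists s : R, [/\ s <= T, 0 < s & W s = 0]).
    exists s => t /andP[_ tT] t0 ts; apply/eqP => Wt.
    have [lt|gt|e] := ltgtP t s; last by rewrite e eqxx in ts.
      exact: (contact_right t0 lt sT Wt Ws).
    exact: (contact_right s0 gt tT Ws Wt).
  by exists 0 => t /andP[_ tT] t0 _; apply/eqP => Wt; apply: no; exists t.
exists s1, s2 => t tT ts1 ts2; rewrite -subr_eq0 -/(W t).
have [lt|gt|e] := ltgtP t 0; [exact: h1|exact: h2|].
by rewrite e gt_eqF// center_active.
Qed.

End central_contact.

(** * The outgoing transition *)

Section transition_map.
Context {R : realType} (m nu : nat).
Variable Z : multiwell_return R m nu.
Notation Theta := (param R m nu).

Let Rf (y : Theta * R) := mw_R Z y.1 y.2.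
Let v : Theta * R := (0, 1).

Definition Rchain (j : nat) (th : Theta) (q : R) : R := iterD v j Rf (th, q).

(** The successive q-derivatives of the reference displacement R_theta (q) - q. *)
Definition Schain (j : nat) (th : Theta) (q : R) : R :=
  match j with
  | 0 => Rchain 0 th q - q
  | 1 => Rchain 1 th q - 1
  | _ => Rchain j th q
  end.

Lemma transition_smooth_set : exists U : set (Theta * R), [/\ open U,
  (forall (th : Theta) (q : R), `|th| < prho Z -> `|q| < mw_delta Z -> U (th, q)) &
  forall k, Ck k U Rf].
Proof.
have [[U [oU sU cU]] _ _] := mw_transition Z.
by exists U; split => // th q h1 h2; apply: sU.
Qed.

Lemma delta_gt0 : 0 < mw_delta Z.
Proof. by case: (p_pos Z) => _ _ h _ _; exact: lt_le_trans (mw_radius Z). Qed.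

Lemma Rchain_derive j (th : Theta) (q : R) : `|th| < prho Z -> `|q| < mw_delta Z ->
  is_derive q 1 (Rchain j th) (Rchain j.+1 th q).
Proof.
move=> h1 h2; have [U [oU sU cU]] := transition_smooth_set.
have df : is_derive (th, q) v (iterD v j Rf) (iterD v j.+1 Rf (th, q)).
  by apply: iterD_derive cU _; exact: sU.
have iE (h : R) : (th, h *: (1 : R) + q) = h *: v + (th, q).
  by congr (_, _) => /=; rewrite scaler0 add0r.
have := @is_derive_along R R (Theta * R)%type R (iterD v j Rf) (fun q : R => (th, q)) 1 q v _ iE df.
exact.
Qed.

Lemma Rchain_continuous j (th : Theta) (q : R) : `|th| < prho Z -> `|q| < mw_delta Z ->
  {for (th, q), continuous (fun y : Theta * R => Rchain j y.1 y.2)}.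
Proof.
move=> h1 h2; have [U [oU sU cU]] := transition_smooth_set.
have -> : (fun y : Theta * R => Rchain j y.1 y.2) = iterD v j Rf by apply/funext => -[].
by apply: iterD_continuous cU _; exact: sU.
Qed.

Lemma Schain_derive j (th : Theta) (q : R) : `|th| < prho Z -> `|q| < mw_delta Z ->
  is_derive q 1 (Schain j th) (Schain j.+1 th q).
Proof.
move=> h1 h2; have dR k := Rchain_derive k h1 h2.
case: j => [|[|j]].
- have h := is_deriveB (dR 0%N) (is_derive_id q (1 : R)); exact: h.
- have h := is_deriveB (dR 1%N) (is_derive_cst (1 : R) q 1); rewrite subr0 in h; exact: h.
- exact: dR.
Qed.

Lemma Sref_derive1n j (th : Theta) (q : R) : `|th| < prho Z -> `|q| < mw_delta Z ->
  derive1n j (fun q => Sref Z q th) q = Schain j th q.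
Proof.
move=> h1 h2.
apply: (@chain_derive1n _ (fun j => Schain j th) _ [set q | `|q| < mw_delta Z]) => //.
- have -> : [set q : R | `|q| < mw_delta Z] = `](- mw_delta Z), (mw_delta Z)[%classic.
    by apply/seteqP; split => x /=; rewrite in_itv /= ltr_norml.
  exact: interval_open.
- by move=> i x xd; exact: Schain_derive.
Qed.

Hypotheses (nu2 : (2 <= nu)%N) (nu_even : ~~ odd nu) (beta_n0 : beta0 Z != 0).
Variable n : nat.
Hypothesis S1 : Schain 1 0 0 = 0.

Lemma return_psol (th : Theta) (q : R) : return_map Z th q = mw_R Z th (psol Z th q (pT Z)).
Proof. by rewrite /return_map /Dcorr addrC subrK. Qed.

(** The reference displacement has a zero of order at least two at the origin, so the
    transition has derivative 1 there. *)
Lemma transition_germ (kap : R) : 0 < kap -> exists eta CR : R, [/\ 0 < eta, eta <= prho Z, 0 <= CR &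
  forall (th : Theta) (q : R), `|th| < eta -> `|q| < eta ->
    [/\ `|Rchain 1 th q - 1| < 8^-1, `|Rchain 2 th q| <= CR & `|Schain n th q - Schain n 0 0| < kap]].
Proof.
move=> kap0.
have z0 : `|0 : Theta| < prho Z by exact: zero_theta.
have z1 : `|0 : R| < mw_delta Z by rewrite normr0 delta_gt0.
have c1 := Rchain_continuous (j := 1%N) z0 z1; have c2 := Rchain_continuous (j := 2%N) z0 z1.
have cn : {for (0, 0), continuous (fun y : Theta * R => Schain n y.1 y.2)}.
  case: (n) => [|[|k]]; last exact: Rchain_continuous.
  - have h : {for ((0, 0) : Theta * R), continuous (fun y : Theta * R => y.2)} by exact: cvg_snd.
    exact: (continuousB (Rchain_continuous (j := 0%N) z0 z1) h).
  - have h : {for ((0, 0) : Theta * R), continuous (fun y : Theta * R => (1 : R))} by exact: cvg_cst.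
    exact: (continuousB c1 h).
have e8 : (0 : R) < 8^-1 by rewrite invr_gt0.
have h1 := continuous_lt c1 e8; have h2 := continuous_lt c2 ltr01; have h3 := continuous_lt cn kap0.
have [eta eta0 H] := near_pair (filterI h1 (filterI h2 h3)).
exists (Num.min eta (prho Z)), (`|Rchain 2 0 0| + 1); split.
- by rewrite lt_min eta0; case: (p_pos Z).
- by rewrite ge_min lexx orbT.
- by rewrite addr_ge0.
- move=> th q; rewrite !lt_min => /andP[t1 _] /andP[q1 _].
  have t1' : `|th - 0| < eta by rewrite subr0.
  have q1' : `|q - 0| < eta by rewrite subr0.
  have [k1 [k2 k3]] := H th q t1' q1'; move: k1 k2 k3; rewrite /=.
  have -> : Rchain 1 0 0 = 1 by apply/eqP; rewrite -subr_eq0; apply/eqP.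
  move=> k1 k2 k3; split => //.
  move: k2; move: (Rchain 2 th q) (Rchain 2 0 0) => a b k2.
  by have := ler_normD (a - b) b; rewrite subrK; move: k2; lra.
Qed.

Section transition_at.
Variables (th : Theta) (eta CR : R).
Hypothesis thr : `|th| < prho Z.
Hypothesis etar : eta <= prho Z.
Hypothesis bnd : forall q : R, `|q| < eta ->
  `|Rchain 1 th q - 1| < 8^-1 /\ `|Rchain 2 th q| <= CR.

Lemma R_mvt (x y : R) : `|x| < eta -> `|y| < eta -> x < y ->
  exists2 xi, x < xi < y & mw_R Z th y - mw_R Z th x = Rchain 1 th xi * (y - x).
Proof.
move=> xe ye xy.
have dl : forall t : R, x <= t <= y -> is_derive t 1 (mw_R Z th) (Rchain 1 th t).
  move=> t txy; apply: (@Rchain_derive 0); first exact: thr.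
  by apply: (@lt_le_trans _ _ eta); [exact: between_small txy|exact: le_trans (mw_radius Z)].
apply: mean_value; first exact: xy.
- by move=> t /andP[t1 t2]; apply: dl; rewrite !ltW.
- by apply: (@is_derive_within _ _ (Rchain 1 th)) => t /=; rewrite in_itv.
Qed.

Lemma R1_lip (x y : R) : `|x| < eta -> `|y| < eta -> x <= y ->
  `|Rchain 1 th y - Rchain 1 th x| <= CR * (y - x).
Proof.
move=> xe ye xy.
have dl : forall t : R, x <= t <= y -> `|t| < eta /\ is_derive t 1 (Rchain 1 th) (Rchain 2 th t).
  move=> t txy; have te : `|t| < eta by exact: between_small txy.
  split; [exact: te|apply: Rchain_derive; [exact: thr|]].
  by apply: (lt_le_trans te); exact: le_trans (mw_radius Z).
apply: (@derive_lip _ (Rchain 1 th) (Rchain 2 th)); first exact: xy.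
- by apply: (@is_derive_within _ _ (Rchain 2 th)) => t /=; rewrite in_itv /= => /dl[].
- by move=> t /andP[t1 t2]; have [|_ h] := dl t; rewrite ?ltW.
- by move=> t /andP[t1 t2]; have [|h _] := dl t; [rewrite !ltW|have [] := bnd h].
Qed.

Lemma R1_bounds (x : R) : `|x| < eta -> 7 / 8 <= Rchain 1 th x <= 9 / 8.
Proof. by move=> /bnd[+ _]; rewrite ltr_norml => /andP[? ?]; apply/andP; split; lra. Qed.

Lemma R_sign (sg x y : R) : sg = 1 \/ sg = -1 -> `|x| < eta -> `|y| < eta ->
  0 < sg * (y - x) -> 0 < sg * (mw_R Z th y - mw_R Z th x).
Proof.
move=> hs xe ye.
have up (a b : R) : `|a| < eta -> `|b| < eta -> a < b -> 0 < mw_R Z th b - mw_R Z th a.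
  move=> ae be ab; have [xi /andP[h1 h2] ->] := R_mvt ae be ab.
  have xie : `|xi| < eta by apply: between_small ae be _; rewrite !ltW.
  have /andP[p _] := R1_bounds xie.
  by rewrite mulr_gt0 ?subr_gt0// (lt_le_trans _ p)//; lra.
case: hs => ->; rewrite ?mul1r ?mulN1r ?oppr_gt0 ?subr_gt0 ?subr_lt0.
  by move=> xy; rewrite -subr_gt0; exact: up.
by move=> yx; rewrite -subr_gt0; exact: up.
Qed.

Variables (sg K1 : R) (Q : R -> R) (r : R).
Hypothesis hs : sg = 1 \/ sg = -1.
Hypothesis K10 : 0 < K1.
Hypothesis Qe : forall q : R, `|q| < r -> `|Q q| < eta.
Hypothesis Qratio : forall q1 q2 : R, `|q1| < r -> `|q2| < r -> q1 < q2 ->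
  8 / 9 <= (Q q2 - Q q1) / (q2 - q1) <= 9 / 8.

Lemma Q_mono (q1 q2 : R) : `|q1| < r -> `|q2| < r -> q1 < q2 -> Q q1 < Q q2.
Proof.
move=> h1 h2 h3; have /andP[+ _] := Qratio h1 h2 h3.
have d : 0 < q2 - q1 by rewrite subr_gt0.
by rewrite ler_pdivlMr// -[Q q1 < _]subr_gt0; lra.
Qed.

Lemma slope_factor (q1 q2 : R) : `|q1| < r -> `|q2| < r -> q1 < q2 ->
  exists2 xi, Q q1 < xi < Q q2 &
  (mw_R Z th (Q q2) - mw_R Z th (Q q1)) / (q2 - q1) = Rchain 1 th xi * ((Q q2 - Q q1) / (q2 - q1)).
Proof.
move=> h1 h2 h3; have [xi hx e] := R_mvt (Qe h1) (Qe h2) (Q_mono h1 h2 h3).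
by exists xi => //; rewrite e mulrA.
Qed.

(** The slope of the return is a product of a factor in [7/8, 9/8] and a factor in
    [8/9, 9/8], hence within 1/2 of 1. *)
Lemma return_lip (x y : R) : `|x| < r -> `|y| < r ->
  `|(mw_R Z th (Q x) - x) - (mw_R Z th (Q y) - y)| <= 2^-1 * `|x - y|.
Proof.
wlog xy : x y / x < y.
  move=> W xr yr; case: (ltgtP x y) => [h|h|->]; first exact: W.
    by rewrite distrC [`|x - y|]distrC; exact: W.
  by rewrite !subrr normr0 mulr0.
move=> xr yr; have [xi /andP[x1 x2] e] := slope_factor xr yr xy.
have d : 0 < y - x by rewrite subr_gt0.
have xie : `|xi| < eta by apply: between_small (Qe xr) (Qe yr) _; rewrite !ltW.
have /andP[a1 a2] := R1_bounds xie; have /andP[b1 b2] := Qratio xr yr xy.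
set a := Rchain 1 th xi in a1 a2 e; set rho := (Q y - Q x) / (y - x) in b1 b2 e.
have -> : (mw_R Z th (Q x) - x) - (mw_R Z th (Q y) - y) = - ((a * rho - 1) * (y - x)).
  by rewrite -e; field; rewrite gt_eqF.
rewrite normrN normrM [`|x - y|]distrC ler_wpM2r// ler_norml.
have p1 : 7 / 8 * (8 / 9) <= a * rho by apply: ler_pM => //; lra.
have p2 : a * rho <= 9 / 8 * (9 / 8) by apply: ler_pM => //; lra.
by apply/andP; split; lra.
Qed.

(** A slope of the composition is R'(x) times a slope of Q.  The first factor varies by
    at most the order of q3 - q1, with the constant CR; the second grows at a
    rate close to K1, as log-convexity controls ratios and the slopes are close to 1. *)
Lemma return_convex (q1 q2 q3 : R) : `|q1| < r -> `|q2| < r -> `|q3| < r ->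
  q1 < q2 -> q2 < q3 -> 0 <= CR ->
  K1 * (q3 - q1) <= sg * (ln ((Q q3 - Q q2) / (q3 - q2)) - ln ((Q q2 - Q q1) / (q2 - q1))) ->
  (7 / 9 * K1 - 2 * CR) * (q3 - q1) <=
  sg * ((mw_R Z th (Q q3) - mw_R Z th (Q q2)) / (q3 - q2)
      - (mw_R Z th (Q q2) - mw_R Z th (Q q1)) / (q2 - q1)).
Proof.
move=> r1 r2 r3 q12 q23 CR0 hlog.
have [x /andP[x1 x2] ex] := slope_factor r1 r2 q12.
have [y /andP[y1 y2] ey] := slope_factor r2 r3 q23.
have xe : `|x| < eta by apply: between_small (Qe r1) (Qe r2) _; rewrite !ltW.
have ye : `|y| < eta by apply: between_small (Qe r2) (Qe r3) _; rewrite !ltW.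
have /andP[a1 a2] := R1_bounds xe; have /andP[b1 b2] := R1_bounds ye.
have /andP[c1 c2] := Qratio r1 r2 q12; have /andP[d1 d2] := Qratio r2 r3 q23.
have lip := R1_lip xe ye (ltW (lt_trans x2 y1)).
have q13 : q1 < q3 by exact: lt_trans q23.
have w : y - x <= 9 / 8 * (q3 - q1).
  have /andP[_] := Qratio r1 r3 q13; rewrite ler_pdivrMr ?subr_gt0//.
  by move: x1 y2; lra.
rewrite ex ey; move: c1 c2 d1 d2 hlog.
set A := Rchain 1 th x in a1 a2 lip *; set A' := Rchain 1 th y in b1 b2 lip *.
set rho := (Q q2 - Q q1) / (q2 - q1); set rho' := (Q q3 - Q q2) / (q3 - q2).
move=> c1 c2 d1 d2 hlog.
have d13 : 0 < q3 - q1 by rewrite subr_gt0.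
have rho0 : 0 < rho by apply: lt_le_trans c1.
have rho'0 : 0 < rho' by apply: lt_le_trans d1.
have U0 : 0 <= K1 * (q3 - q1) by rewrite mulr_ge0// ltW.
have gap : 8 / 9 * (K1 * (q3 - q1)) <= sg * (rho' - rho).
  have := log_gap_le rho'0 rho0; have := log_gap_le rho0 rho'0.
  set l := ln rho in hlog *; set l' := ln rho' in hlog *.
  move: hlog; case: hs => ->; rewrite ?mul1r ?mulN1r ?opprB => hlog g1 g2.
    have h : 8 / 9 * (K1 * (q3 - q1)) <= rho * (l' - l).
      by apply: ler_pM => //.
    by move: h g2; lra.
  have h : 8 / 9 * (K1 * (q3 - q1)) <= rho' * (l - l').
    by apply: ler_pM => //.
  by move: h g1; lra.
have -> : sg * (A' * rho' - A * rho) = A' * (sg * (rho' - rho)) + sg * ((A' - A) * rho) by ring.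
have m1 : 7 / 8 * (8 / 9 * (K1 * (q3 - q1))) <= A' * (sg * (rho' - rho)).
  by apply: ler_pM => //; rewrite mulr_ge0.
have m2 : `|sg * ((A' - A) * rho)| <= CR * (9 / 8 * (q3 - q1)) * (9 / 8).
  have -> : `|sg * ((A' - A) * rho)| = `|A' - A| * rho.
    by rewrite (normrM sg) (normrM (A' - A)) (gtr0_norm rho0); case: hs => ->; rewrite ?normrN normr1 mul1r.
  apply: ler_pM => //; first exact: ltW.
  by apply: (le_trans lip); rewrite ler_wpM2l.
have m3 := mulr_ge0 CR0 (ltW d13).
move: m2; rewrite ler_norml => /andP[m2 _].
by move: m1 m2 m3; lra.
Qed.

End transition_at.
End transition_map.

(** * Local form of the displacement *)

Section local_form.
Context {R : realType} (m nu : nat).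
Variable Z : multiwell_return R m nu.
Notation Theta := (param R m nu).
Hypotheses (nu2 : (2 <= nu)%N) (nu_even : ~~ odd nu) (beta_n0 : beta0 Z != 0).
Variable n : nat.
Hypothesis S1 : Schain Z 1 0 0 = 0.

(** The threshold mu is the minimum of the contact graph.  The modulus K and the
    oscillation kap of the n-th derivative are prescribed; the neighbourhood follows. *)
Lemma local_form (K kap : R) : 0 < K -> 0 < kap ->
  exists r sg : R, [/\ 0 < r, r <= prho Z, 0 < sg * beta0 Z &
  forall th : Theta, `|th| < r -> exists mu : R,
    [/\ displacement r mu sg (fun j => Schain Z j th) (fun q => Delta Z q th),
        (forall q1 q2 q3 : R, `|q1| < r -> `|q2| < r -> `|q3| < r ->
           mu <= q1 -> q1 < q2 -> q2 < q3 ->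
           K * (q3 - q1) <= sg * ((Delta Z q3 th - Delta Z q2 th) / (q3 - q2)
             - (Delta Z q2 th - Delta Z q1 th) / (q2 - q1))),
        (forall x y : R, `|x| < r -> `|y| < r ->
           `|Delta Z x th - Delta Z y th| <= 2^-1 * `|x - y|),
        (forall q : R, `|q| < r -> `|Schain Z n th q - Schain Z n 0 0| < kap) &
        forall p : 'rV[R]_m, th = (p, 0) -> mu = 0 /\
          forall q : R, 0 < q -> q < r -> derivable (fun q => Delta Z q th) q 1]].
Proof.
move=> K0 kap0.
have [etaR [CR [etaR0 etaRr CR0 bndR]]] := transition_germ n S1 kap0.
pose K1 := 9 / 7 * (K + 2 * CR).
have K10 : 0 < K1 by rewrite mulr_gt0// ltr_wpDr// mulr_ge0.
have [tau [eta [r [mm [M [C [eps [sg [b [[r0 rrho eta0 etaR' sb] ratio gain kpth cent]]]]]]]]]] :=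
  kinked_germ nu2 nu_even beta_n0 etaR0 K10.
have [T0 _ _ _ _] := p_pos Z.
set T := pT Z in T0 gain kpth cent.
have TT : - T <= T by rewrite ge0_cp// ltW.
have TT1 : - T <= T <= T by rewrite TT lexx.
have ratio2 : expR (2 * tau * (M + C)) <= 2 by apply: (le_trans ratio); lra.
have kp00 := kpth 0 (ltac:(by rewrite normr0)).
have rR : r <= etaR by exact: le_trans (kp_r kp00) etaR'.
exists r, sg; split => // th thr.
have kp := kpth th thr.
have hsg := kp_sigma kp.
have thrho : `|th| < prho Z by exact: lt_le_trans rrho.
have thR : `|th| < etaR by exact: lt_le_trans rR.
have bnd (q : R) : `|q| < etaR -> `|Rchain Z 1 th q - 1| < 8^-1 /\ `|Rchain Z 2 th q| <= CR.
  by move=> qe; have [] := bndR th q thR qe.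
pose Q (q : R) := psol Z th q T.
have DeltaE (q : R) : Delta Z q th = mw_R Z th (Q q) - q by rewrite /Delta return_psol.
have Qe (q : R) : `|q| < r -> `|Q q| < etaR.
  by move=> qr; apply: lt_le_trans etaR'; apply: (kp_small kp qr).
have Qratio (q1 q2 : R) : `|q1| < r -> `|q2| < r -> q1 < q2 -> 8 / 9 <= (Q q2 - Q q1) / (q2 - q1) <= 9 / 8.
  move=> h1 h2 h3; have d : 0 < q2 - q1 by rewrite subr_gt0.
  have [g1 g2] := gap_ratio kp h1 h2 h3 TT1; have g0 := gap_gt0 kp h1 h2 h3 TT1.
  have g1' := le_trans g1 (ler_wpM2r (ltW d) ratio); have g2' := le_trans g2 (ler_wpM2r (ltW g0) ratio).
  rewrite ler_pdivlMr// ler_pdivrMr//; apply/andP; split; last exact: g1'.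
  by move: g2'; rewrite -/(Q q1) -/(Q q2); move: (Q q1) (Q q2) => u w; lra.
have [c cT cmin] : exists2 c : R, - T <= c <= T & forall t : R, - T <= t <= T -> Phi Z th c <= Phi Z th t.
  have [c + h] := EVT_min TT (kp_Phi_cont kp); rewrite in_itv /= => cT.
  by exists c => // t tT; apply: h; rewrite in_itv.
pose mu := Phi Z th c.
have conv (q1 q2 q3 : R) : `|q1| < r -> `|q2| < r -> `|q3| < r ->
    mu <= q1 -> q1 < q2 -> q2 < q3 ->
    K * (q3 - q1) <= sg * ((Delta Z q3 th - Delta Z q2 th) / (q3 - q2)
      - (Delta Z q2 th - Delta Z q1 th) / (q2 - q1)).
  move=> h1 h2 h3 mq q12 q23.
  have d13 : 0 <= q3 - q1 by rewrite subr_ge0 ltW// (lt_trans q12).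
  have hl := convex_log kp ratio2 h1 h2 h3 q12 q23 cT mq.
  have hl' := le_trans (ler_wpM2r d13 gain) hl.
  have := return_convex thrho etaRr bnd hsg K10 Qe Qratio h1 h2 h3 q12 q23 CR0 hl'.
  have -> : 7 / 9 * K1 - 2 * CR = K by rewrite /K1; field.
  have d : q2 - q1 != 0 by rewrite subr_eq0 gt_eqF.
  have d' : q3 - q2 != 0 by rewrite subr_eq0 gt_eqF.
  rewrite !DeltaE; move: (mw_R Z th (Q q1)) (mw_R Z th (Q q2)) (mw_R Z th (Q q3)) => x1 x2 x3.
  have -> : (x3 - q3 - (x2 - q2)) / (q3 - q2) - (x2 - q2 - (x1 - q1)) / (q2 - q1) =
    (x3 - x2) / (q3 - q2) - (x2 - x1) / (q2 - q1) by field; rewrite d d'.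
  by [].
exists mu; split.
- split.
  + exact: hsg.
  + move=> j q; rewrite -ltr_norml => qr; apply: Schain_derive; first exact: thrho.
    by apply: lt_le_trans (mw_radius Z); exact: lt_le_trans rrho.
  + move=> q qr qmu; rewrite DeltaE /Q (inactive_exit kp qr)// => t tT.
    by apply: (le_trans qmu); exact: cmin.
  + move=> q qr muq; rewrite DeltaE.
    have h := active_exit kp qr cT muq.
    have qe : `|q| < etaR by exact: lt_le_trans rR.
    have := R_sign thrho etaRr bnd hsg qe (Qe q qr) h.
    have -> : mw_R Z th (Q q) - q - Schain Z 0 th q = mw_R Z th (Q q) - mw_R Z th q.
      by rewrite /Schain /Rchain /iterD /=; ring.
    by [].
  + move=> q1 q2 q3 h1 h2 h3 mq q12 q23; apply: lt_le_trans (conv q1 q2 q3 h1 h2 h3 mq q12 q23).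
    by rewrite mulr_gt0// subr_gt0 (lt_trans q12).
- exact: conv.
- by move=> x y xr yr; rewrite !DeltaE; exact: (return_lip thrho etaRr bnd Qe Qratio xr yr).
- by move=> q qr; have [] := bndR th q thR (lt_le_trans qr rR).
- move=> p thp.
  have pr : `|p| < r.
    by move: thr; rewrite thp prod_normE /= normr0 gt_max => /andP[].
  have [cent1 cent2] := cent p pr; rewrite -thp in cent1 cent2.
  have Phi00 : Phi Z th 0 = 0.
    by rewrite thp Phi_central expr0n gtn_eqF ?mul0r// (leq_trans _ nu2).
  have T00 : - T <= (0 : R) <= T by rewrite oppr_le0 !ltW.
  split.
    apply/eqP; rewrite eq_le; apply/andP; split; first by rewrite /mu -Phi00 cmin.
    exact: cent1.
  move=> q q0 qr.
  have qr' : `|q| < r by rewrite gtr0_norm.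
  have [s1 [s2 contact]] := two_contacts kp cent1 Phi00 cent2 qr' q0.
  have dQ := end_derivable kp ratio2 qr' contact.
  have dR : is_derive (Q q) 1 (mw_R Z th) (Rchain Z 1 th (Q q)).
    apply: (@Rchain_derive _ _ _ Z 0 th (Q q) thrho).
    by apply: (lt_le_trans (Qe q qr')); exact: le_trans (mw_radius Z).
  have -> : (fun q => Delta Z q th) = (fun q => mw_R Z th (Q q) - q).
    by apply/funext => x; exact: DeltaE.
  have h1 := is_derive1_comp dR (derivableP dQ).
  exact: (@ex_derive _ _ _ _ _ _ _ (is_deriveB h1 (is_derive_id q 1))).
Qed.

End local_form.

(** * The model polynomial *)

Section model_polynomial.
Context {R : realType}.
Implicit Types (n k : nat) (eps : R).

(** The roots - eps, ..., - n eps lie in the inactive region when the threshold is 0. *)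
Definition model n eps : {poly R} := \prod_(i < n) ('X - (- (i.+1%:R * eps))%:P).

Lemma model_horner n eps (q : R) : (model n eps).[q] = \prod_(i < n) (q + i.+1%:R * eps).
Proof. by rewrite horner_prod; apply: eq_bigr => i _; rewrite hornerXsubC opprK. Qed.

Lemma model_top n eps : (model n eps)`_n = 1.
Proof.
have /monicP := monic_prod_XsubC (index_enum 'I_n) xpredT (fun i : 'I_n => - (i.+1%:R * eps)).
rewrite lead_coefE size_prod_XsubC /=.
by have -> : size (index_enum 'I_n) = n by rewrite [index_enum _]unlock -enumT size_enum_ord.
Qed.

Lemma model_high n eps k : (n < k)%N -> (model n eps)`_k = 0.
Proof.
move=> nk; apply/nth_default; rewrite size_prod_XsubC.
by have -> : size (index_enum 'I_n) = n by rewrite [index_enum _]unlock -enumT size_enum_ord.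
Qed.

Lemma model_recr n eps j :
  (model n.+1 eps)`_j = (if j == 0%N then 0 else (model n eps)`_j.-1)
    + (model n eps)`_j * (n.+1%:R * eps).
Proof.
by rewrite /model big_ord_recr /= mulrBr coefB coefMX coefMC mulrN opprK.
Qed.

(** All coefficients below the leading one tend to 0 with eps; the uniform bound on
    every coefficient is what the induction needs. *)
Lemma model_coef_small n : exists2 C : R, 0 <= C & forall eps, 0 <= eps <= 1 ->
  (forall j, `|(model n eps)`_j| <= C) /\ (forall j, (j < n)%N -> `|(model n eps)`_j| <= C * eps).
Proof.
elim: n => [|n [C C0 IH]].
  exists 1 => // eps _; split=> // j; rewrite /model big_ord0 coef1.
  by case: (j == 0%N); rewrite ?normr1 ?normr0.
exists (C * (n.+2)%:R); first by rewrite mulr_ge0.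
move=> eps epsI; have [h1 h2] := IH eps epsI; case/andP: epsI => e0 e1.
have split_bound (x y X Y : R) : `|x| <= X -> `|y| <= Y -> `|x + y| <= X + Y.
  by move=> xX yY; apply: (le_trans (ler_normD _ _)); rewrite lerD.
have second j : `|(model n eps)`_j * (n.+1%:R * eps)| <= C * (n.+1%:R * eps).
  by rewrite normrM (ger0_norm (mulr_ge0 _ e0))// ler_wpM2r// mulr_ge0.
split => [j|j jn]; rewrite model_recr.
  have -> : C * n.+2%:R = C + C * (n.+1%:R * 1) by rewrite -(natr1 n.+1); ring.
  apply: split_bound; first by case: ifP => _; rewrite ?normr0.
  by apply: (le_trans (second j)); rewrite !ler_wpM2l.
have -> : C * n.+2%:R * eps = C * eps + C * (n.+1%:R * eps) by rewrite -(natr1 n.+1); ring.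
apply: split_bound => //.
case: j jn => [|j] jn /=; first by rewrite normr0 mulr_ge0.
exact: h2.
Qed.

(** Each of the n factors has absolute value at least 1/2, and the first minn n k of
    them are negative. *)
Lemma half_integer_sign n k :
  2^-1 ^+ n <= (-1) ^+ (minn n k) * \prod_(i < n) (i%:R + 2^-1 - k%:R) :> R.
Proof.
elim: n => [|n IH]; first by rewrite min0n !expr0 big_ord0 mulr1.
rewrite big_ord_recr /= exprSr mulrA.
set P := (-1) ^+ minn n k * \prod_(i < n) (i%:R + 2^-1 - k%:R) in IH.
have h0 : 0 <= 2^-1 ^+ n :> R by rewrite exprn_ge0// invr_ge0.
have i2 : 0 <= 2^-1 :> R by rewrite invr_ge0.
case: (leqP k n) => kn.
  have -> : minn n.+1 k = minn n k by rewrite !(minn_idPr _)// leqW.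
  by rewrite -/P ler_pM// -addrA [2^-1 + _]addrC addrA lerDr subr_ge0 ler_nat.
have e1 : minn n.+1 k = n.+1 by apply/minn_idPl.
have e2 : minn n k = n by apply/minn_idPl/ltnW.
have -> : (-1) ^+ minn n.+1 k * \prod_(i < n) (i%:R + 2^-1 - k%:R) * (n%:R + 2^-1 - k%:R) =
   P * (k%:R - 2^-1 - n%:R) by rewrite /P e1 e2 exprS; ring.
rewrite ler_pM//.
have : n.+1%:R <= k%:R :> R by rewrite ler_nat.
rewrite -natr1; move: (n%:R) (k%:R) => a b ab.
have -> : (2^-1 : R) = 1 - 2^-1 by field.
by rewrite lerBrDr; move: ab; lra.
Qed.

End model_polynomial.

Section flat.
Context {R : realType}.

(** Taylor's estimate for a function flat to order k, by repeated mean values. *)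
Lemma flat_bound (F : nat -> R -> R) (r eta : R) k :
  (forall j (q : R), - r < q < r -> is_derive q 1 (F j) (F j.+1 q)) ->
  (forall j, (j < k)%N -> F j 0 = 0) ->
  (forall q : R, - r < q < r -> `|F k q| <= eta) ->
  forall q : R, - r < q < r -> `|F 0%N q| <= eta * `|q| ^+ k.
Proof.
elim: k F => [|k IH] F dF F0 Fk q qr; first by rewrite expr0 mulr1 Fk.
have eta0 : 0 <= eta by apply: le_trans (Fk q qr).
have IH1 (x : R) : - r < x < r -> `|F 1%N x| <= eta * `|x| ^+ k.
  by apply: (IH (fun j => F j.+1)) => // j jk; exact: F0.
case/andP: qr => q1 q2.
have cF (a b : R) : - r < a -> b < r -> {within `[a, b], continuous (F 0%N)}.
  move=> ar br; apply: (@is_derive_within _ _ (F 1%N)) => x /=; rewrite in_itv /= => /andP[x1 x2].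
  by apply: dF; rewrite (lt_le_trans ar x1) (le_lt_trans x2 br).
have [xi [xir xiq e]] : exists xi, [/\ - r < xi < r, `|xi| <= `|q| & F 0%N q = F 1%N xi * q].
  have [lt|gt|<-] := ltgtP 0 q.
  - have df (x : R) : 0 < x < q -> is_derive x 1 (F 0%N) (F 1%N x).
      by move=> /andP[? ?]; apply: dF; lra.
    have rn : - r < 0 by lra.
    have [c /andP[c1 c2]] := mean_value lt df (cF 0 q rn q2).
    rewrite (F0 0%N)// !subr0 => e; exists c; split => //; first lra.
    by rewrite !gtr0_norm ?ltW.
  - have df (x : R) : q < x < 0 -> is_derive x 1 (F 0%N) (F 1%N x).
      by move=> /andP[? ?]; apply: dF; lra.
    have rp : 0 < r by lra.
    have [c /andP[c1 c2]] := mean_value gt df (cF q 0 q1 rp).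
    rewrite (F0 0%N)// !sub0r => e; exists c; split => //; [lra|by rewrite !ltr0_norm ?lerN2 ?ltW|lra].
  - by exists 0; rewrite lexx mulr0 F0//; split => //; lra.
rewrite e normrM exprSr mulrA ler_wpM2r//.
by apply: (le_trans (IH1 xi xir)); rewrite ler_wpM2l// lerXn2r ?nnegrE.
Qed.

Lemma poly_chain (p : {poly R}) j (q : R) : is_derive q 1 (horner p^`(j)) p^`(j.+1).[q].
Proof. by rewrite derivnS; exact: is_derive_poly. Qed.

Lemma derivn_at0 (p : {poly R}) j : p^`(j).[0] = p`_j * j`!%:R.
Proof. by rewrite horner_coef0 coef_derivn addn0 ffactnn mulr_natr. Qed.

Lemma derivn_model n (eps q : R) : (model n eps)^`(n).[q] = n`!%:R.
Proof.
have -> : (model n eps)^`(n) = (n`!%:R)%:P.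
  apply/polyP => i; rewrite coef_derivn coefC.
  case: i => [|i] /=; first by rewrite addn0 model_top ffactnn.
  by rewrite model_high ?mul0rn// addnS ltnS leq_addr.
by rewrite hornerC.
Qed.

End flat.

(** * Displacements with the maximal number of zeros *)

Section many_zeros.
Context {R : realType}.
Variables (r sg : R) (S : nat -> R -> R) (Delta : R -> R) (n : nat) (ec c kap eps : R).
Hypothesis dis : displacement r 0 sg S Delta.
Hypothesis n2 : (2 <= n)%N.
Hypothesis ec1 : ec = 1 \/ ec = - 1.
Hypothesis ec_c : ec * c = `|c|.
Hypothesis c0 : c != 0.
Hypothesis top : forall q : R, - r < q < r -> 0 < ec * S n q.
Hypothesis eps0 : 0 < eps.
Hypothesis eps_r : n.+1%:R * eps < r.
Hypothesis coef : forall j, (j < n)%N -> S j 0 = c * (model n eps)`_j * j`!%:R.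
Hypothesis flat : forall q : R, - r < q < r -> `|S n q - c * n`!%:R| <= kap.
Hypothesis kap_small : kap * n.+1%:R ^+ n < `|c| * 2^-1 ^+ n.

Let S_derive j (q : R) : - r < q < r -> is_derive q 1 (S j) (S j.+1 q) := dis_S dis j (q := q).

(** The difference between S and c times the model is flat to order n at 0. *)
Lemma model_close (q : R) : - r < q < r -> `|S 0%N q - c * (model n eps).[q]| <= kap * `|q| ^+ n.
Proof.
pose F j (q : R) := S j q - c * (model n eps)^`(j).[q].
move=> qr; apply: (@flat_bound _ F r kap n) => //.
- move=> j x xr; have h1 := S_derive j xr; have h2 := poly_chain (model n eps) j x.
  exact: (is_deriveB h1 (is_deriveZ c h2)).
- by move=> j jn; rewrite /F coef// derivn_at0 mulrA subrr.
- by move=> x xr; rewrite /F derivn_model; exact: flat.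
Qed.

(** Points half-way between consecutive roots of the model, indexed increasingly. *)
Let half_point (k : nat) : R := - ((n - k)%:R + 2^-1) * eps.

Lemma half_point_range k : `|half_point k| < n.+1%:R * eps.
Proof.
rewrite /half_point normrM normrN (gtr0_norm eps0) ltr_pM2r// ger0_norm ?addr_ge0 ?invr_ge0//.
have : (n - k)%:R <= n%:R :> R by rewrite ler_nat leq_subr.
by rewrite -(natr1 n); move: (n%:R) ((n - k)%:R) => a b; lra.
Qed.

Lemma half_point_in k : - r < half_point k < r.
Proof. by rewrite -ltr_norml (lt_trans (half_point_range k)). Qed.

Lemma half_point_neg k : half_point k < 0.
Proof. by rewrite /half_point mulNr oppr_lt0 mulr_gt0// ltr_wpDl ?invr_gt0. Qed.

Lemma half_point_step k : (k < n)%N -> half_point k < half_point k.+1.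
Proof.
move=> kn; rewrite /half_point ltr_pM2r// ltrN2 ltrD2r ltr_nat.
by rewrite ltn_sub2l.
Qed.

(** At these points c times the model has size at least |c| (eps / 2)^n, which exceeds
    its distance to S, so S inherits its alternating signs. *)
Lemma half_point_sign k : (k <= n)%N -> 0 < (-1) ^+ (n - k) * (ec * S 0%N (half_point k)).
Proof.
move=> kn; set l := (n - k)%N; have ln : (l <= n)%N by rewrite leq_subr.
have := @half_integer_sign R n l; rewrite (minn_idPr ln) => hs.
have em : (model n eps).[half_point k] = eps ^+ n * \prod_(i < n) (i%:R + 2^-1 - l%:R).
  rewrite model_horner.
  have -> : eps ^+ n = \prod_(i < n) eps by rewrite prodr_const card_ord.
  rewrite -big_split /=; apply: eq_bigr => i _.
  by rewrite /half_point -/l -natr1; field.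
set P := \prod_(i < n) _ in hs em.
have cl := model_close (half_point_in k).
have en0 : 0 < eps ^+ n by rewrite exprn_gt0.
have lower : `|c| * 2^-1 ^+ n * eps ^+ n <= (-1) ^+ l * (ec * (c * (model n eps).[half_point k])).
  rewrite em; have -> : (-1) ^+ l * (ec * (c * (eps ^+ n * P))) = (ec * c) * ((-1) ^+ l * P) * eps ^+ n by ring.
  rewrite ec_c; apply: ler_wpM2r; first exact: ltW.
  by apply: ler_wpM2l.
have upper : `|(-1) ^+ l * (ec * (S 0%N (half_point k) - c * (model n eps).[half_point k]))| <= kap * n.+1%:R ^+ n * eps ^+ n.
  have -> : `|(-1) ^+ l * (ec * (S 0%N (half_point k) - c * (model n eps).[half_point k]))| = `|S 0%N (half_point k) - c * (model n eps).[half_point k]|.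
    by rewrite normrMsign normrM; case: ec1 => ->; rewrite ?normrN normr1 mul1r.
  apply: (le_trans cl); rewrite -mulrA -exprMn.
  have kap0 : 0 <= kap by apply: le_trans (flat (half_point_in k)).
  by rewrite ler_wpM2l// lerXn2r ?nnegrE ?mulr_ge0 ?(ltW eps0)// ltW// half_point_range.
have gap : kap * n.+1%:R ^+ n * eps ^+ n < `|c| * 2^-1 ^+ n * eps ^+ n by rewrite ltr_pM2r.
have -> : (-1) ^+ l * (ec * S 0%N (half_point k)) = (-1) ^+ l * (ec * (c * (model n eps).[half_point k]))
   + (-1) ^+ l * (ec * (S 0%N (half_point k) - c * (model n eps).[half_point k])) by ring.
move: upper lower gap; rewrite ler_norml => /andP[].
move: (_ * (ec * (S _ _ - _))) ((-1) ^+ l * (ec * (c * _))) (kap * _ * _) (`|c| * _ * _) => u v x y.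
lra.
Qed.

Lemma sign_zero (f df : R -> R) (a b s : R) : a < b ->
  (forall x, a <= x <= b -> is_derive x 1 f (df x)) ->
  0 < s * f a -> s * f b < 0 -> exists2 z, a < z < b & f z = 0.
Proof.
move=> ab fd fa fb.
have cf : {within `[a, b], continuous (fun x => s * f x)}.
  apply: (@is_derive_within _ _ (fun x => s * df x)) => x /=; rewrite in_itv /= => xab.
  exact: (is_deriveZ s (fd x xab)).
have [z [/andP[z1 z2] z3 _]] := first_hit (ltW ab) cf fa (ltW fb).
have s0 : s != 0 by apply: contraTneq fa => ->; rewrite mul0r ltxx.
exists z; last by move/eqP: z3; rewrite mulf_eq0 (negbTE s0) => /eqP.
rewrite z1 lt_neqAle z2 andbT; apply: contraTneq fb => <-.
by rewrite z3 ltxx.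
Qed.

Lemma inactive_zeros : exists w : nat -> R,
  forall k, (k < n)%N -> half_point k < w k < half_point k.+1 /\ S 0%N (w k) = 0.
Proof.
have H k : exists z, (k < n)%N -> half_point k < z < half_point k.+1 /\ S 0%N z = 0.
  have [kn|] := ltnP k n; last by exists 0.
  have [||||z z1 z2] := @sign_zero (S 0%N) (S 1%N) (half_point k) (half_point k.+1) ((-1) ^+ (n - k) * ec).
  - exact: half_point_step.
  - move=> x /andP[x1 x2]; apply: S_derive.
    have /andP[h1 _] := half_point_in k; have /andP[_ h2] := half_point_in k.+1.
    by rewrite (lt_le_trans h1 x1) (le_lt_trans x2 h2).
  - by rewrite -mulrA half_point_sign// ltnW.
  - have := half_point_sign kn; rewrite -mulrA.
    have -> : (n - k = (n - k.+1).+1)%N by rewrite subnSK.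
    by rewrite exprS mulN1r mulNr oppr_lt0.
  - by exists z.
by have [w wP] := choice H; exists w.
Qed.

(** A double zero is one more zero of S', which then has n zeros with the n - 1 mean
    values between the zeros of S; but the derivative of order n - 1 of S' has a sign. *)
Lemma zeros_simple (w : nat -> R) :
  (forall k, (k < n)%N -> - r < w k < r /\ S 0%N (w k) = 0) ->
  (forall k, (k.+1 < n)%N -> w k < w k.+1) ->
  forall k, (k < n)%N -> S 1%N (w k) != 0.
Proof.
move=> wz wm k kn; apply/eqP => S1.
have H i : exists z, (i.+1 < n)%N -> w i < z < w i.+1 /\ S 1%N z = 0.
  have [i_n|] := ltnP i.+1 n; last by exists 0.
  have [/andP[a1 a2] a3] := wz i (ltnW i_n); have [/andP[b1 b2] b3] := wz _ i_n.
  have df (x : R) : w i <= x <= w i.+1 -> is_derive x 1 (S 0%N) (S 1%N x).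
    by move=> /andP[x1 x2]; apply: S_derive; rewrite (lt_le_trans a1 x1) (le_lt_trans x2 b2).
  have df' (x : R) : w i < x < w i.+1 -> is_derive x 1 (S 0%N) (S 1%N x).
    by move=> /andP[x1 x2]; apply: df; rewrite !ltW.
  have cf : {within `[w i, w i.+1], continuous (S 0%N)}.
    by apply: (@is_derive_within _ _ (S 1%N)) => x /=; rewrite in_itv.
  have [z z1] := mean_value (wm i i_n) df' cf.
  rewrite a3 b3 subrr => /esym/eqP; rewrite mulf_eq0 => /orP[/eqP z2|].
    by exists z.
  by rewrite subr_eq0 gt_eqF// wm.
have [xi xiP] := choice H.
pose y i := if (i < k)%N then xi i else if i == k then w k else xi i.-1.
case: n n2 kn wz wm xiP top => [//|m] _ kn wz wm xiP topm.
have yin i : (i <= m)%N -> - r < y i < r /\ S 1%N (y i) = 0.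
  have xin i' : (i' < m)%N -> - r < xi i' < r /\ S 1%N (xi i') = 0.
    move=> im; have [/andP[h1 h2] h3] := xiP i' im; split => //.
    have [/andP[a1 _] _] := wz i' (leqW im); have [/andP[_ b2] _] := wz i'.+1 im.
    by rewrite (lt_trans a1 h1) (lt_trans h2 b2).
  move=> im; rewrite /y; case: (ssrnat.ltngtP i k) => [ik|ki|_].
  - by apply: xin; rewrite (leq_trans ik).
  - by apply: xin; case: i im ki => // i im _.
  - by split => //; have [] := wz k kn.
apply: (@alternation _ m (fun j q => ec * S j.+1 q) (- r) r y).
- by move=> j t tr; exact: (is_deriveZ ec (S_derive j.+1 tr)).
- exact: topm.
- by move=> i /yin[].
- move=> i im; rewrite /y; case: (ssrnat.ltngtP i.+1 k) => [ik|ki|e].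
  + have i1 : (i.+1 < m.+1)%N by rewrite ltnS.
    have i2 : (i.+2 < m.+1)%N by rewrite (leq_ltn_trans ik).
    have [/andP[_ h2] _] := xiP i i1; have [/andP[h3 _] _] := xiP i.+1 i2.
    exact: lt_trans h2 h3.
  + rewrite ltnS in ki; rewrite /=; case: (ssrnat.ltngtP i k) ki => // [ki _|e _].
      case: i im ki => // i im ki.
      have i1 : (i.+1 < m.+1)%N by rewrite ltnS ltnW.
      have i2 : (i.+2 < m.+1)%N by rewrite ltnS.
      have [/andP[_ h2] _] := xiP i i1; have [/andP[h3 _] _] := xiP i.+1 i2.
      exact: lt_trans h2 h3.
    rewrite e; have i1 : (k.+1 < m.+1)%N by rewrite ltnS -e.
    by have [/andP[h2 _] _] := xiP k i1.
  + have i1 : (i.+1 < m.+1)%N by rewrite ltnS.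
    by rewrite -e; have [/andP[_ h2] _] := xiP i i1.
- by move=> i /yin[_ ->]; rewrite !mulr0.
Qed.

Lemma simple_inactive (q : R) : `|q| < r -> q < 0 -> S 0%N q = 0 -> S 1%N q != 0 ->
  simple_zero Delta q.
Proof.
move=> qr q0 Sq S1.
have h : \near q, S 0%N q = Delta q.
  have qi : q \in `](- r), 0[ by rewrite in_itv /= q0 andbT; move: qr; rewrite ltr_norml => /andP[].
  have := near_in_itvoo qi; apply: filterS => x; rewrite in_itv /= => /andP[x1 x2].
  rewrite (dis_inactive dis) ?ltW// ltr_norml x1 (lt_trans x2)//.
  by rewrite (le_lt_trans _ qr).
have qr' : - r < q < r by rewrite -ltr_norml.
have d := near_eq_is_derive h (S_derive 0 qr').
split.
- by rewrite (dis_inactive dis) ?ltW.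
- exact: (@ex_derive _ _ _ _ _ _ _ d).
- by rewrite derive1E (@derive_val _ _ _ _ _ _ _ d).
Qed.

(** Enough zeros are all the zeros, since there are never more than max_zeros. *)
Lemma zeros_complete (s : seq R) : sorted <%R s -> size s = max_zeros sg n ec ->
  (forall q, q \in s -> `|q| < r /\ Delta q = 0) -> zeros_listed Delta r s.
Proof.
move=> ss sN sz; split => // q; split; first exact: sz.
move=> [qr zq]; apply/negPn/negP => qs.
have us : uniq (q :: s) by rewrite /= qs (sorted_uniq lt_trans (@ltxx _ R)).
have := zero_count dis n2 ec1 top us; rewrite /= sN ltnn.
have h x : x \in q :: s -> `|x| < r /\ Delta x = 0.
  by rewrite inE => /predU1P[->|/sz].
by move=> /(_ h).
Qed.

Hypothesis convex : forall q1 q2 q3 : R, `|q1| < r -> `|q2| < r -> `|q3| < r ->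
  0 <= q1 -> q1 < q2 -> q2 < q3 ->
  10 * `|c| * (q3 - q1) <=
    sg * ((Delta q3 - Delta q2) / (q3 - q2) - (Delta q2 - Delta q1) / (q2 - q1)).
Hypothesis lip : forall x y : R, `|x| < r -> `|y| < r ->
  `|Delta x - Delta y| <= 2^-1 * `|x - y|.
Hypothesis der : forall q : R, 0 < q -> q < r -> derivable Delta q 1.
Hypothesis kap_c : kap <= `|c|.
Variable q0 : R.
Hypotheses (q00 : 0 < q0) (q0r : q0 < r) (q01 : q0 <= 1).
Hypothesis eps_q0 : n%:R * eps <= q0 / 2.

Lemma origin_sign : ec = - sg -> sg * Delta 0 < 0.
Proof.
move=> es; have r0 : 0 < r := lt_trans q00 q0r.
rewrite (dis_inactive dis) ?normr0// coef ?(leq_trans _ n2)//.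
rewrite -horner_coef0 model_horner fact0 mulr1.
have -> : sg = - ec by rewrite es opprK.
rewrite mulrA mulNr ec_c mulNr oppr_lt0 mulr_gt0 ?normr_gt0//.
by apply: prodr_gt0 => i _; rewrite add0r mulr_gt0.
Qed.

Lemma reference_small : `|S 0%N (q0 / 2)| <= 2 * `|c| * q0 ^+ 2.
Proof.
have h0 : 0 < q0 / 2 by rewrite divr_gt0.
have hr : - r < q0 / 2 < r by apply/andP; split; move: q00 q0r => h1 h2; lra.
have cl := model_close hr.
have pw : q0 ^+ n <= q0 ^+ 2.
  by rewrite -(subnK n2) exprD ler_piMl ?exprn_ge0 ?exprn_ile1// ltW.
have mb : `|(model n eps).[q0 / 2]| <= q0 ^+ n.
  rewrite model_horner normr_prod.
  have -> : q0 ^+ n = \prod_(i < n) q0 by rewrite prodr_const card_ord.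
  apply: ler_prod => i _; rewrite normr_ge0 /=.
  have ie : i.+1%:R * eps <= n%:R * eps by rewrite ler_pM2r// ler_nat.
  have ie0 : 0 <= i.+1%:R * eps by rewrite mulr_ge0// ltW.
  rewrite (ger0_norm (addr_ge0 (ltW h0) ie0)).
  by move: eps_q0 ie; move: (_ * eps) (n%:R * eps) => a b; lra.
have m2 : kap * `|q0 / 2| ^+ n <= `|c| * q0 ^+ 2.
  apply: (@le_trans _ _ (`|c| * `|q0 / 2| ^+ n)); first by rewrite ler_wpM2r ?exprn_ge0.
  rewrite ler_wpM2l// (le_trans _ pw)// lerXn2r ?nnegrE ?(ltW q00)//.
  by rewrite gtr0_norm//; move: q00 => h; lra.
have m3 : `|c * (model n eps).[q0 / 2]| <= `|c| * q0 ^+ 2.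
  rewrite normrM; apply: ler_wpM2l; first exact: normr_ge0.
  exact: le_trans mb pw.
have -> : S 0%N (q0 / 2) = (S 0%N (q0 / 2) - c * (model n eps).[q0 / 2]) + c * (model n eps).[q0 / 2].
  by rewrite subrK.
rewrite (le_trans (ler_normD _ _))//; move: cl m2 m3.
move: (kap * _) (`|S _ _ - _|) (`|c * _|) => x y z.
move=> h1 h2 h3; have e : 2 * `|c| * q0 ^+ 2 = `|c| * q0 ^+ 2 + `|c| * q0 ^+ 2 by ring.
by rewrite e; lra.
Qed.

Lemma sigma_norm (x : R) : `|sg * x| = `|x|.
Proof. by rewrite normrM; case: (dis_sigma dis) => ->; rewrite ?normrN normr1 mul1r. Qed.

(** Compare the second difference of Delta on 0, q0 / 2, q0 with its lower bound
    5 |c| q0^2: the term at q0 / 2 is at least S (q0 / 2), of size at most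
    2 |c| q0^2, and Delta is negative at 0 in the direction sg. *)
Lemma end_sign : ec = - sg -> 0 < sg * Delta q0.
Proof.
move=> es; have neg := origin_sign es; have small := reference_small.
have a1 : `|0 : R| < r by rewrite normr0 (lt_trans q00 q0r).
have a2 : `|q0 / 2| < r by rewrite gtr0_norm ?divr_gt0//; move: q00 q0r => h1 h2; lra.
have a3 : `|q0| < r by rewrite gtr0_norm.
have b1 : 0 < q0 / 2 by rewrite divr_gt0.
have b2 : q0 / 2 < q0 by move: q00 => h; lra.
have act := dis_active dis a2 b1.
have cv := convex a1 a2 a3 (lexx 0) b1 b2.
have low : - (2 * `|c| * q0 ^+ 2) <= sg * S 0%N (q0 / 2).
  by move: small; rewrite -sigma_norm ler_norml => /andP[].
have K0 : 0 < `|c| * q0 ^+ 2 by rewrite mulr_gt0 ?normr_gt0 ?exprn_gt0.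
have e : sg * ((Delta q0 - Delta (q0 / 2)) / (q0 - q0 / 2) - (Delta (q0 / 2) - Delta 0) / (q0 / 2 - 0))
   = (sg * Delta q0 - 2 * (sg * Delta (q0 / 2)) + sg * Delta 0) * 2 / q0.
  by field; rewrite gt_eqF//= subr_eq0; lra.
move: cv; rewrite e subr0 ler_pdivlMr//.
move: act; rewrite mulrBr; move: neg low K0.
have -> : 10 * `|c| * q0 * q0 = 10 * (`|c| * q0 ^+ 2) by ring.
have -> : 2 * `|c| * q0 ^+ 2 = 2 * (`|c| * q0 ^+ 2) by ring.
move: (sg * Delta q0) (sg * Delta 0) (sg * Delta (q0 / 2)) (sg * S 0%N _) (`|c| * _) => a b x y z.
lra.
Qed.

(** The zero comes from the change of sign between 0 and q0.  It is simple because
    convexity bounds the slope to its right from below by the slope of the chord from 0. *)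
Lemma active_root : ec = - sg -> exists2 q, 0 < q < q0 & simple_zero Delta q.
Proof.
move=> es; have neg := origin_sign es; have pos := end_sign es.
have r0 : 0 < r := lt_trans q00 q0r.
have cD : {within `[0, q0], continuous (fun z => - sg * Delta z)}.
  apply: within_mul; first by apply: continuous_subspaceT; exact: cst_continuous.
  by apply: (lip_within lip) => //; rewrite oppr_lt0.
have p1 : 0 < - sg * Delta 0 by rewrite mulNr oppr_gt0.
have p2 : - sg * Delta q0 < 0 by rewrite mulNr oppr_lt0.
have [q [/andP[q1 q2] q3 _]] := first_hit (ltW q00) cD p1 (ltW p2).
have zq : Delta q = 0.
  move/eqP: q3; rewrite mulf_eq0 oppr_eq0; case: (dis_sigma dis) => ->.
    by rewrite oner_eq0 => /eqP.
  by rewrite oppr_eq0 oner_eq0 => /eqP.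
have qq0 : q < q0.
  rewrite lt_neqAle q2 andbT; apply/eqP => e.
  by move: pos; rewrite -e zq mulr0 ltxx.
have qr : q < r := lt_trans qq0 q0r.
exists q; first by rewrite q1.
split => //; first exact: der.
have dq := der q1 qr.
apply/eqP => d0; pose e := - (sg * Delta 0) / q.
have e0 : 0 < e by rewrite divr_gt0// oppr_gt0.
have [d dpos dP] := derive1_eps dq e0.
pose y := q + Num.min (d / 2) (q0 - q).
have m1 : 0 < Num.min (d / 2) (q0 - q) by rewrite lt_min divr_gt0// subr_gt0.
have m2 : Num.min (d / 2) (q0 - q) <= d / 2 by rewrite ge_min lexx.
have m3 : Num.min (d / 2) (q0 - q) <= q0 - q by rewrite ge_min lexx orbT.
have yq : y - q = Num.min (d / 2) (q0 - q) by rewrite /y; ring.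
have qy : q < y by rewrite -subr_gt0 yq.
have yr : y < r by move: m3 q0r; rewrite -yq; lra.
have yn : y != q by rewrite gt_eqF.
have yd : `|y - q| < d by rewrite gtr0_norm ?subr_gt0//; move: m2 dpos; rewrite -yq; lra.
have := dP y yn yd; rewrite d0 zq !subr0 -sigma_norm => h.
have a1 : `|0 : R| < r by rewrite normr0.
have a2 : `|q| < r by rewrite gtr0_norm.
have a3 : `|y| < r by rewrite gtr0_norm// (lt_trans q1).
have := dis_convex dis a1 a2 a3 (lexx 0) q1 qy; rewrite zq !subr0 sub0r.
have -> : sg * (Delta y / (y - q) - (- Delta 0) / q) = sg * (Delta y / (y - q)) - e.
  by rewrite /e; ring.
move: h; rewrite ltr_norml => /andP[_].
by move: (sg * _) => x; lra.
Qed.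

Variable e : R.
Hypotheses (eps_e : n.+1%:R * eps < e) (q0e : q0 < e).

Lemma many_zeros : exists s : seq R, [/\ size s = max_zeros sg n ec, zeros_listed Delta r s &
  forall q, q \in s -> `|q| < e /\ simple_zero Delta q].
Proof.
have [w wP] := inactive_zeros.
have wbound k : (k < n)%N -> w k < 0 /\ `|w k| < n.+1%:R * eps.
  move=> kn; have [/andP[w1 w2] _] := wP k kn.
  have w0 : w k < 0 := lt_trans w2 (half_point_neg k.+1).
  split => //; rewrite ltr0_norm// (le_lt_trans _ (half_point_range k))//.
  by rewrite ltr0_norm ?half_point_neg// lerN2 ltW.
have win k : (k < n)%N -> `|w k| < r by move=> /wbound[_ h]; exact: lt_trans eps_r.
have wz k : (k < n)%N -> - r < w k < r /\ S 0%N (w k) = 0.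
  by move=> kn; rewrite -ltr_norml win//; have [] := wP k kn.
have wm k : (k.+1 < n)%N -> w k < w k.+1.
  move=> kn; have [/andP[_ h1] _] := wP k (ltnW kn); have [/andP[h2 _] _] := wP k.+1 kn.
  exact: lt_trans h1 h2.
have wsimple k : (k < n)%N -> simple_zero Delta (w k).
  move=> kn; have [w0 _] := wbound k kn; have [_ h] := wz k kn.
  apply: simple_inactive => //; first exact: win.
  exact: (zeros_simple wz wm).
pose s := mkseq w n.
have ss : sorted <%R s.
  apply: (path_sorted (x := w 0%N - 1)).
  apply/(pathP 0) => i; rewrite size_mkseq => i_n.
  case: i i_n => [|i] i_n /=; first by rewrite nth_mkseq// gtrBl.
  by rewrite !nth_mkseq ?wm// ltnW.
have sP q : q \in s -> [/\ `|q| < r, `|q| < e, q < 0 & simple_zero Delta q].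
  move=> /mapP[k]; rewrite mem_iota /= add0n => kn ->.
  have [h1 h2] := wbound k kn.
  by split; [exact: win|exact: lt_trans h2 eps_e|exact: h1|exact: wsimple].
have sizes : size s = n by rewrite size_mkseq.
rewrite /max_zeros; have [es|nes] := eqVneq ec sg.
  exists s; split => //; last by move=> q /sP[].
  apply: zeros_complete => //; first by rewrite /max_zeros es eqxx.
  by move=> q /sP[h1 _ _ []].
have es : ec = - sg.
  by move: nes; case: ec1 => ->; case: (dis_sigma dis) => ->; rewrite ?eqxx ?opprK.
have [q /andP[qpos qq0] sq] := active_root es.
have sP' x : x \in rcons s q -> [/\ `|x| < r, `|x| < e & simple_zero Delta x].
  rewrite mem_rcons inE => /predU1P[->|/sP[]//].
  by rewrite gtr0_norm// (lt_trans qq0 q0r) (lt_trans qq0 q0e).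
exists (rcons s q); split; first by rewrite size_rcons sizes.
  apply: zeros_complete.
  - rewrite (sorted_pairwise lt_trans) pairwise_rcons -(sorted_pairwise lt_trans) ss andbT.
    by apply/allP => x /sP[_ _ x0 _]; exact: lt_trans x0 qpos.
  - by rewrite size_rcons sizes /max_zeros (negbTE nes).
  - by move=> x /sP'[h _ []].
by move=> x /sP'[].
Qed.

End many_zeros.

(** * The coefficient map *)

Section coefficients.
Context {R : realType} (m nu : nat).
Variable Z : multiwell_return R m nu.
Notation Theta := (param R m nu).

Lemma central_norm (p : 'rV[R]_m) : `|((p, 0) : Theta)| = `|p|.
Proof. by rewrite prod_normE /= normr0; apply/max_idPl. Qed.

Lemma coefficientE n (p : 'rV[R]_m) (j : 'I_n) : `|p| < prho Z ->
  coefficient_map Z n p ord0 j = Schain Z j (p, 0) 0 / j`!%:R.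
Proof.
move=> pr; rewrite mxE Sref_derive1n//; first by rewrite central_norm.
by rewrite normr0 delta_gt0.
Qed.

Let Rf (y : Theta * R) := mw_R Z y.1 y.2.
Let v : Theta * R := (0, 1).
Let dir (i : 'I_m) : Theta * R := ((delta_mx 0 i, 0), 0).
Let partial (j : nat) (i : 'I_m) (p : 'rV[R]_m) : R :=
  j`!%:R^-1 *: 'D_(dir i) (iterD v j Rf) ((p, 0), 0).

(** The coefficients are iterated derivatives in the direction of q; one more
    derivative in the direction of a parameter is still continuous. *)
Lemma coefficient_partial j i (p : 'rV[R]_m) : `|p| < prho Z ->
  is_derive p (delta_mx 0 i) (fun p => Schain Z j (p, 0) 0 / j`!%:R) (partial j i p) /\
  {for p, continuous (partial j i)}.
Proof.
move=> pr; have [U [oU sU cU]] := transition_smooth_set Z.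
have pU : U ((p, 0), 0) by apply: sU; rewrite ?central_norm// normr0 delta_gt0.
have cj : Ck 1 U (iterD v j Rf) := Ck_iterD v cU j 1.
split; last first.
  have h : {for p, continuous (fun p : 'rV[R]_m => (((p, 0) : Theta), (0 : R)))}.
    apply/(cvgrPdist_lt (FF := nbhs_filter p)) => e e0; have := @nbhsx_ballx _ _ p _ e0; apply: filterS => x.
    rewrite -ball_normE /= => xe; rewrite -[X in `|X|]/((p - x, 0 - 0), 0 - 0 : R).
    rewrite !subr0 prod_normE /= central_norm normr0.
    by rewrite (max_idPl _).
  have c0 : {for (((p, 0) : Theta), (0 : R)), continuous (fun x => 'D_(dir i) (iterD v j Rf) x)}.
    exact: (Ck_continuous (Ck_D (dir i) cj) pU).
  have := continuous_comp h c0; rewrite /comp => c1.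
  exact: (continuousZl_tmp c1).
have d1 := Ck_derive (dir i) cj pU.
pose emb (p : 'rV[R]_m) : Theta * R := ((p, 0), 0).
have iE (h : R) : emb (h *: delta_mx 0 i + p) = h *: dir i + emb p.
  by rewrite /emb /dir; congr ((_, _), _) => /=; rewrite ?scaler0 ?addr0.
have d2 := is_derive_along iE d1.
have -> : (fun p : 'rV[R]_m => Schain Z j (p, 0) 0 / j`!%:R) =
  (fun p => j`!%:R^-1 *: (iterD v j Rf (emb p) - (j == 1%N)%:R)).
  apply/funext => x; rewrite /GRing.scale /= mulrC; congr (_ * _).
  by case: j {cj d1 d2} => [|[|j]] //=; rewrite subr0.
have d3 := is_deriveB d2 (is_derive_cst ((j == 1%N)%:R : R) p (delta_mx 0 i)).
have := is_deriveZ (j`!%:R^-1) d3; rewrite subr0; exact.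
Qed.

Lemma coefficient_strict n : exists A, strict_diff0 (coefficient_map Z n) A.
Proof.
exists (\matrix_(i, j) partial j i 0) => e e0.
have rho0 : 0 < prho Z by case: (p_pos Z).
have z0 : `|0 : 'rV[R]_m| < prho Z by rewrite normr0.
have H (j : 'I_n) : exists rho : R, 0 < rho /\ forall x y : 'rV[R]_m, `|x| < rho -> `|y| < rho ->
    `|Schain Z j (y, 0) 0 / j`!%:R - Schain Z j (x, 0) 0 / j`!%:R
      - \sum_i (y ord0 i - x ord0 i) * partial j i 0| <= e * `|y - x|.
  have [||rho r1 r2] := @partials_strict R m (fun p => Schain Z j (p, 0) 0 / j`!%:R) (partial j) e _ _ e0.
  - have := @nbhsx_ballx _ _ (0 : 'rV[R]_m) _ rho0; apply: filterS => z.
    rewrite -ball_normE /= sub0r normrN => zr i.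
    by have [] := coefficient_partial j i zr.
  - by move=> i; have [] := coefficient_partial j i z0.
  - by exists rho.
have [rho rhoP] := choice H.
exists (\big[Num.min/prho Z]_j rho j).
  by apply/bigmin_gtP; split => // j _; have [] := rhoP j.
move=> x y /bigmin_gtP[xr xj] /bigmin_gtP[yr yj].
apply: rv_norm_le => [|j]; first by rewrite mulr_ge0// ltW.
have [_] := rhoP j; move=> /(_ x y (xj j isT) (yj j isT)).
rewrite ![in X in _ -> X]mxE !Sref_derive1n ?central_norm ?normr0 ?delta_gt0//.
congr (`| _ - _| <= _); apply: eq_bigr => i _.
by rewrite !mxE.
Qed.

(** Prescribing the first n derivatives of S at 0 amounts to solving an equation for
    the coefficient map, which is open at p = 0. *)
Lemma coefficients_attained n (e : R) : (forall j, (j < n)%N -> Schain Z j 0 0 = 0) ->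
  \rank ('J (coefficient_map Z n) 0) = n -> 0 < e ->
  exists2 d : R, 0 < d & forall y : 'rV[R]_n, `|y| <= d ->
    exists2 p : 'rV[R]_m, `|p| < e & forall j : 'I_n, Schain Z j (p, 0) 0 = y ord0 j * j`!%:R.
Proof.
move=> S0 rk e0; have [A sd] := coefficient_strict n.
have rho0 : 0 < prho Z by case: (p_pos Z).
rewrite (strict_diff0_jacobian sd) in rk.
have f0 : coefficient_map Z n 0 = 0.
  apply/rowP => j; rewrite coefficientE ?normr0// mxE.
  have S0j : Schain Z j (0, 0) 0 = 0 by exact: S0.
  by rewrite S0j mul0r.
have e1 : 0 < Num.min e (prho Z) by rewrite lt_min e0.
have [d d0 dP] := strict_open sd f0 rk e1.
exists d => // y yd; have [p] := dP y yd; rewrite lt_min => /andP[pe pr] fp.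
exists p => // j; have := coefficientE j pr; rewrite fp => ->.
by rewrite divfK// pnatr_eq0 -lt0n fact_gt0.
Qed.

End coefficients.

(** * Bound, sharpness and stability *)

Section constants.
Context {R : realType}.

Lemma linear_part (m nu : nat) (Z : multiwell_return R m nu) :
  Schain Z 1 0 0 = 0 -> derive1 (mw_R Z 0) 0 = 1.
Proof.
move=> S1; have z0 : `|0 : param R m nu| < prho Z by exact: zero_theta.
have z1 : `|0 : R| < mw_delta Z by rewrite normr0 delta_gt0.
have d := Rchain_derive 0 z0 z1.
have -> : derive1 (mw_R Z 0) 0 = Rchain Z 1 0 0.
  by rewrite derive1E; exact: (@derive_val _ _ _ _ _ _ _ d).
by apply/eqP; rewrite -subr_eq0; apply/eqP.
Qed.

Lemma small_constant (a : R) n : 0 < a -> exists kap : R,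
  [/\ 0 < kap, kap <= a & kap * n.+1%:R ^+ n < a * 2^-1 ^+ n].
Proof.
move=> a0; have b0 : 0 < n.+1%:R ^+ n :> R by rewrite exprn_gt0.
have h0 : 0 < (2^-1 : R) ^+ n by rewrite exprn_gt0 ?invr_gt0.
exists (a * 2^-1 ^+ n / n.+1%:R ^+ n / 2); split.
- by rewrite !divr_gt0// mulr_gt0.
- have b1 : 1 <= n.+1%:R ^+ n :> R by rewrite exprn_ege1// ler1n.
  have h1 : (2^-1 : R) ^+ n <= 1 by rewrite exprn_ile1//; lra.
  have k1 : a * 2^-1 ^+ n <= a by rewrite ler_piMr// ltW.
  have k2 : a * 2^-1 ^+ n / n.+1%:R ^+ n <= a * 2^-1 ^+ n.
    by rewrite ler_pdivrMr// ler_peMr// mulr_ge0// ltW.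
  by move: k1 k2; move: (a * _) => y; move: (y / _ ^+ _) => x; lra.
- have -> : a * 2^-1 ^+ n / n.+1%:R ^+ n / 2 * n.+1%:R ^+ n = a * 2^-1 ^+ n / 2.
    by field; rewrite expf_neq0 ?pnatr_eq0.
  have : 0 < a * 2^-1 ^+ n by rewrite mulr_gt0.
  by move: (a * _) => x; lra.
Qed.

(** The scales of sharpness: eps for the negative zeros, q0 for the positive one. *)
Lemma small_step (a e : R) n : 0 < a -> 0 < e -> forall C, 0 <= C -> exists eps : R,
  [/\ 0 < eps, eps <= 1, n.+1%:R * eps < e, C * eps <= a & exists q0 : R,
    [/\ 0 < q0, q0 < e, q0 <= 1 & n%:R * eps <= q0 / 2]].
Proof.
move=> a0 e0 C C0.
pose q0 := Num.min e 1 / 2.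
have m0 : 0 < Num.min e 1 by rewrite lt_min e0 ltr01.
have me : Num.min e 1 <= e by rewrite ge_min lexx.
have m1 : Num.min e 1 <= 1 by rewrite ge_min lexx orbT.
have q00 : 0 < q0 by rewrite /q0; lra.
have n0 : 0 < n.+1%:R :> R by rewrite ltr0n.
pose eps := Num.min (q0 / 2 / n.+1%:R) (a / (C + 1)).
have C1 : 0 < C + 1 by rewrite ltr_wpDl.
have eps0 : 0 < eps by rewrite lt_min (divr_gt0 _ n0) ?divr_gt0.
have e1 : n.+1%:R * eps <= q0 / 2.
  by rewrite mulrC -ler_pdivlMr// ge_min lexx.
have e2 : C * eps <= a.
  have : eps * (C + 1) <= a by rewrite -ler_pdivlMr// ge_min lexx orbT.
  by lra.
have qe : q0 / 2 < q0 by lra.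
have q1 : q0 < e by rewrite /q0; lra.
have q2 : q0 <= 1 by rewrite /q0; lra.
have e3 : n%:R * eps + eps = n.+1%:R * eps by rewrite -natr1; ring.
have ne : 0 <= n%:R * eps by rewrite mulr_ge0// ltW.
exists eps; split => //; [lra|lra|exists q0; split => //; lra].
Qed.

End constants.

Unset Implicit Arguments.

Theorem theorem7p6 (R : realType) (n m nu : nat)
    (hn : (2 <= n)%N) (hnu : (2 <= nu)%N) (hnu_even : ~~ odd nu)
    (Z : multiwell_return R m nu)
    (hR0 : mw_R Z 0 0 = 0)
    (hbeta : beta0 Z != 0)
    (hL0 : derive1 (mw_R Z 0) 0 != 0)
    (hS : forall j, (j < n)%N -> derive1n j (fun q => Sref Z q 0) 0 = 0)
    (c d : R)
    (hc : c = derive1n n (fun q => Sref Z q 0) 0 / n`!%:R) (hc0 : c != 0)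
    (hd : d = derive1 (mw_R Z 0) 0 * beta0 Z) (hd0 : d != 0) :
  let N := if 0 < c * d then n else n.+1 in
  exists (r0 : R) (V : set (param R m nu)),
    [/\ 0 < r0,
        nbhs 0 V,
        forall th, V th ->
          ([set q | `|q| < r0 /\ Delta Z q th = 0] #<= `I_N)%card /\
          (forall q, `|q| < r0 -> Delta Z q th = 0 ->
             \forall x \near q^', Delta Z x th != 0) &
        \rank ('J (coefficient_map Z n) 0) = n ->
        FR nu (fun p => return_map Z (p, 0)) ->
          (forall e : R, 0 < e -> exists (p : 'rV[R]_m) (s : seq R),
             [/\ `|p| < e, V (p, 0), size s = N,
                 zeros_listed (fun q => Delta Z q (p, 0)) r0 s &
                 forall q, q \in s -> `|q| < e /\
                   simple_zero (fun x => Delta Z x (p, 0)) q]) /\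
          (forall (p : 'rV[R]_m) (s : seq R), V (p, 0) ->
             zeros_listed (fun q => Delta Z q (p, 0)) r0 s ->
             (forall q, q \in s -> simple_zero (fun x => Delta Z x (p, 0)) q) ->
             alternating_stability (return_map Z (p, 0)) s)].
Proof.
move=> N.
have z0 : `|0 : param R m nu| < prho Z by exact: zero_theta.
have z1 : `|0 : R| < mw_delta Z by rewrite normr0 delta_gt0.
have S0 j : (j < n)%N -> Schain Z j 0 0 = 0.
  by move=> jn; rewrite -(Sref_derive1n j z0 z1) hS.
have Sn : Schain Z n 0 0 = c * n`!%:R.
  by rewrite -(Sref_derive1n n z0 z1) hc divfK// pnatr_eq0 -lt0n fact_gt0.
have S1 : Schain Z 1 0 0 = 0 by exact: S0.
have a0 : 0 < `|c| by rewrite normr_gt0.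
have [kap [kap0 kapc kap_small]] := small_constant n a0.
have K0 : 0 < 10 * `|c| by rewrite mulr_gt0.
have [r [sg [r0 rrho sgb loc]]] := local_form hnu hnu_even hbeta n S1 K0 kap0.
pose ec : R := if 0 < c then 1 else -1.
have ec1 : ec = 1 \/ ec = -1 by rewrite /ec; case: ifP; [left|right].
have ecc : ec * c = `|c|.
  rewrite /ec; case: ltP => h; first by rewrite mul1r gtr0_norm.
  by rewrite mulN1r ler0_norm.
(* The n-th derivative of S stays within |c| of c n!, hence keeps the sign of c. *)
have topn th : `|th| < r -> forall q : R, - r < q < r -> 0 < ec * Schain Z n th q.
  move=> thr q qr; have [mu [_ _ _ bnd _]] := loc th thr.
  have := bnd q; rewrite ltr_norml => /(_ qr); rewrite Sn.
  have -> : `|Schain Z n th q - c * n`!%:R| = `|ec * Schain Z n th q - `|c| * n`!%:R|.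
    rewrite -ecc -mulrA -mulrBr normrM.
    by case: ec1 => ->; rewrite ?normrN normr1 mul1r.
  have : `|c| <= `|c| * n`!%:R by rewrite ler_peMr// ler1n fact_gt0.
  rewrite ltr_norml => h /andP[h1 _]; move: h h1 kapc.
  by move: (ec * _) => x; move: (`|c| * _) => y; move: `|c| => z; lra.
have NE : N = max_zeros sg n ec.
  have t0 : `|0 : param R m nu| < r by rewrite normr0.
  have [mu [dis _ _ _ _]] := loc 0 t0.
  rewrite /N /max_zeros; congr (if _ then _ else _).
  have -> : c * d = c * beta0 Z by rewrite hd linear_part// mul1r.
  have sg0 : sg * beta0 Z = `|beta0 Z|.
    move: sgb; case: (dis_sigma dis) => ->; rewrite ?mul1r ?mulN1r => h.
      by rewrite gtr0_norm.
    by rewrite ltr0_norm// -oppr_gt0.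
  have sgg : (0 < c * beta0 Z) = (0 < ec * sg).
    have -> : c * beta0 Z = (ec * c) * (sg * beta0 Z) * (ec * sg).
      have e2 : ec * ec = 1 by case: ec1 => ->; rewrite ?mulrNN mulr1.
      have s2 : sg * sg = 1 by case: (dis_sigma dis) => ->; rewrite ?mulrNN mulr1.
      have -> : ec * c * (sg * beta0 Z) * (ec * sg) = (ec * ec) * (sg * sg) * (c * beta0 Z) by ring.
      by rewrite e2 s2 !mul1r.
    by rewrite ecc sg0 pmulr_rgt0// mulr_gt0// normr_gt0.
  rewrite sgg; have neq : (1 == -1 :> R) = false by apply/eqP; lra.
  have neq' : (-1 == 1 :> R) = false by rewrite eq_sym.
  by case: ec1 => ->; case: (dis_sigma dis) => ->;
    rewrite ?mulrNN ?mulr1 ?mul1r ?eqxx ?neq ?neq' ?ltr01 ?oppr_gt0 ?ltr10.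
exists r, [set th | `|th| < r]; split => //.
- have := @nbhsx_ballx _ _ (0 : param R m nu) _ r0; apply: filterS => th.
  by rewrite -ball_normE /= sub0r normrN.
- move=> th thr; have [mu [dis _ _ _ _]] := loc th thr; rewrite NE.
  exact: (zeros_few_isolated dis hn ec1 (topn th thr)).
- move=> rk _; split.
  + move=> e e0; have e1 : 0 < Num.min e r by rewrite lt_min e0.
    have [C C0 CP] := model_coef_small (R := R) n.
    have [dl dl0 dlP] := coefficients_attained S0 rk e1.
    have [eps [eps0 eps_1 epse epsC [q0 [q00 q0e q01 epsq]]]] :=
      small_step n dl0 e1 (mulr_ge0 (normr_ge0 c) C0).
    pose y : 'rV[R]_n := \row_j (c * (model n eps)`_j).
    have yd : `|y| <= dl.
      apply: rv_norm_le => [|j]; first exact: ltW.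
      have eps01 : 0 <= eps <= 1 by rewrite ltW.
      rewrite mxE normrM (le_trans _ epsC)// -mulrA ler_wpM2l//.
      by have [_ h] := CP eps eps01; exact: h.
    have [p pe pP] := dlP y yd.
    move: pe epse q0e; rewrite !lt_min => /andP[pe pr] /andP[epse epsr] /andP[q0e q0r].
    have thr : `|((p, 0) : param R m nu)| < r by rewrite central_norm.
    have [mu [dis conv lip bnd]] := loc _ thr.
    move=> /(_ p erefl)[mu0 der]; rewrite mu0 in dis conv.
    have coef j : (j < n)%N -> Schain Z j (p, 0) 0 = c * (model n eps)`_j * j`!%:R.
      by move=> jn; rewrite (pP (Ordinal jn)) mxE.
    have flat q : - r < q < r -> `|Schain Z n (p, 0) q - c * n`!%:R| <= kap.
      by rewrite -ltr_norml -Sn => /bnd /ltW.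
    have [s [s1 s2 s3]] := many_zeros dis hn ec1 ecc hc0 (topn _ thr) eps0 epsr coef flat
      kap_small conv lip der kapc q00 q0r q01 epsq epse q0e.
    by exists p, s; rewrite NE.
  + move=> p s thr zs simp; have [mu [_ _ lip _ _]] := loc _ thr.
    exact: (alternates lip zs simp).
Qed.
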